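(* Let $\mathcal G$ be a locally finite Borel graph on a standard Borel space $X$ and let $\mathcal S$ be a nested Borel separation system for $\mathcal G$ with property $(\ast)$, with associated space $Z$ and levels equivalence relation $Q$. If $Q$ is Borel treeable, then $\mathrm{Rel}(\mathcal G)$ is Borel treeable; and if $Q$ is measure treeable, then $\mathrm{Rel}(\mathcal G)$ is measure treeable.
   Context: Separations of a connected graph $G$: pairs $(S,B)$, $S\subset V(G)$ finite, $B\subset\partial_GS$ (edges with exactly one end in $S$), such that if $(u,v),(u',v')\in\partial S$ with $u,u'\in S$, $v,v'$ in the same component of $G\setminus S$, and $(u',v')\in B$, then $(u,v)\in B$. Proper: $G\setminus S$ disconnected and $\emptyset\ne B\subsetneq\partial S$. $(S,B)^-=(S,\partial S\setminus B)$. Sides: with $C$ the vertices outside $S$ incident to $B$ and $\bar C$ the union of components of $G\setminus S$ meeting $C$, $A_1=G[S\cup\bar C]$, $A_2=G[V(G)\setminus\bar C]$; $(S,B)\le(S',B')$ iff $A_1\subset A'_1$ and $A'_2\subset A_2$; $s,s'$ nested if $s$ is comparable with $s'$ or $s'^-$. A separation system is a set of proper separations closed under $^-$; a nested one has property $(\ast)$ if for all $s<s'$ in it only finitely many $s''$ satisfy $s<s''<s'$. For such $\mathcal S$: $s\sim s'$ iff $s=s'$ or $s^-$ is a predecessor of $s'$; $T_{\mathcal S}$ has the $\sim$-classes as vertices and edges $\{[s],[s^-]\}$, with parts $V_t=\bigcap_{s\in t}V(A_1(s))$ (then $(T_{\mathcal S},(V_t))$ is a tree decomposition). Borel setting: $\mathcal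 G\subset X\times X$ is a symmetric Borel set with finite degrees; $\mathrm{Rel}(\mathcal G)$ is the relation ''same component''. $\mathrm{Sep}(\mathcal G)\subset[X]^{<\infty}\times[\mathcal G]^{<\infty}$ is the Borel set of $(S,B)$ with $S$ in one component $G$ and $(S,B)$ a separation of $G$. A Borel separation system is a Borel $\mathcal S\subset\mathrm{Sep}(\mathcal G)$ with each $\mathcal S_G=\{(S,B)\in\mathcal S:S\subset V(G)\}$ a separation system; nested/property $(\ast)$ means each $\mathcal S_G$ has it. $Z=\{(x,t): t\text{ a vertex of }T_{\mathcal S_{\mathcal G_x}},\ x\in V_t\}$, with the standard Borel structure obtained by identifying $Z$ with $(Y/R)\sqcup U$, where $Y=\{(x,(S,B))\in X\times\mathcal S: x\in S\}$, $R$ is the smooth Borel equivalence relation $(x,s)R(y,s')$ iff $x=y$ and $s\sim s'$ (or $s=s'$), $[(x,s)]_R\mapsto(x,[s])$, and $U$ is the Borel set of $x$ lying in no adhesion set $S$ of $\mathcal S$ but in some part $V_t$, $x\mapsto(x,t)$. The levels equivalence relation $Q$ on $Z$ is $(x,t)\,Q\,(y,t')$ iff $t=t'$. A countable Borel equivalence relation $E$ on a standard Borel space $W$ is Borel treeable if $E=\mathrm{Rel}(\mathcal T)$ for some acyclic Borel graph $\mathcal T$ on $W$; $\mu$-treeable (for a Borel probability $\mu$) if $E|_{W_0}$ is Borel treeable for some Borel $W_0$ with $\mu(W_0)=1$; measure treeable if $\mu$-treeable for every Borel probability measure $\mu$ on $W$.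
   Formalization: Where a component G has no separations (S_G empty), T_S is taken to be one vertex with part V(G), and Q relates only points of the same component; read literally, S = ∅ gives Z = ∅ and the claim fails for non-treeable Rel(G). X is taken nonempty. *)

(* Defs.v *)
From HB Require Import structures.
From mathcomp Require Import all_boot all_order all_algebra finmap.
From mathcomp Require Import all_classical all_reals all_analysis.

Set Implicit Arguments.
Unset Strict Implicit.
Unset Printing Implicit Defensive.

Local Open Scope classical_set_scope.

(* A graph on T is given by its set E : set (T * T) of ordered adjacent pairs;
   an undirected edge is present as both of its orientations. *)
Section Graphs.
Variable T : choiceType.
Implicit Types (E : set (T * T)) (x y : T).

Definition adjacent E : rel T := fun x y => (x, y) \in E.

Definition symmetric_graph E := forall x y, E (x, y) -> E (y, x).

Definition locally_finite E := forall x, finite_set [set y | E (x, y)].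

(* Rel E is the relation "x and y are joined by a path". *)
Definition Rel E : set (T * T) :=
  [set xy | exists2 p, path (adjacent E) xy.1 p & last xy.1 p = xy.2].

Definition component E x : set T := [set y | Rel E (x, y)].

Definition acyclic E :=
  (forall x, ~ E (x, x)) /\
  (forall p : seq T, cycle (adjacent E) p -> uniq p -> (size p <= 2)%N).

End Graphs.

(* Separations of the connected graph whose vertex set is V, where V is a
   component of E.  No edge of E leaves V, so E itself serves as the edge set:
   its edges outside V never matter. *)
Section Separations.
Variable T : choiceType.

Definition sep : choiceType := ({fset T} * {fset T * T})%type.

Implicit Types (V : set T) (E : set (T * T)) (s : sep) (C : set sep).

(* Each edge with exactly one end in S is represented once, by the pair
   oriented from S to the complement. *)
Definition boundary E (S : {fset T}) : set (T * T) :=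
  [set e | [/\ E e, e.1 \in S & e.2 \notin S]].

Definition delete E (S : {fset T}) : set (T * T) :=
  [set e | [/\ E e, e.1 \notin S & e.2 \notin S]].

Definition separation V E s :=
  [/\ [set` s.1] `<=` V, [set` s.2] `<=` boundary E s.1 &
      forall u v u' v', boundary E s.1 (u, v) -> boundary E s.1 (u', v') ->
        Rel (delete E s.1) (v, v') -> (u', v') \in s.2 -> (u, v) \in s.2].

Definition proper_separation V E s :=
  [/\ exists v w, [/\ V v, V w, v \notin s.1, w \notin s.1 &
        ~ Rel (delete E s.1) (v, w)],
      [set` s.2] !=set0 & [set` s.2] `<` boundary E s.1].

(* fset_set is meaningful here because the boundary of a finite set is finite
   in a locally finite graph. *)
Definition opp_sep E s : sep :=
  (s.1, fset_set (boundary E s.1 `\` [set` s.2])).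

(* The union of the components of the graph minus S that meet the set of
   vertices outside S incident to B. *)
Definition far_side E s : set T :=
  [set v | v \notin s.1 /\
    exists2 e, e \in s.2 & Rel (delete E s.1) (e.2, v)].

(* Vertex sets of the sides A_1 and A_2.  The sides are induced subgraphs, so
   inclusion of sides is inclusion of their vertex sets. *)
Definition side1 E s : set T := [set` s.1] `|` far_side E s.
Definition side2 V E s : set T := V `\` far_side E s.

Definition sep_le V E s s' :=
  side1 E s `<=` side1 E s' /\ side2 V E s' `<=` side2 V E s.

Definition sep_lt V E s s' := sep_le V E s s' /\ s <> s'.

Definition comparable V E s s' := sep_le V E s s' \/ sep_le V E s' s.

Definition nested V E s s' :=
  comparable V E s s' \/ comparable V E s (opp_sep E s').

Definition separation_system V E C := forall s, C s ->
  [/\ separation V E s, proper_separation V E s & C (opp_sep E s)].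

Definition nested_system V E C := forall s s', C s -> C s' -> nested V E s s'.

Definition finite_intervals V E C := forall s s', C s -> C s' ->
  sep_lt V E s s' ->
  finite_set [set s'' | [/\ C s'', sep_lt V E s s'' & sep_lt V E s'' s']].

Definition predecessor V E C s s' :=
  [/\ C s, C s', sep_lt V E s s' &
      ~ exists s'', [/\ C s'', sep_lt V E s s'' & sep_lt V E s'' s']].

Definition sep_equiv V E C s s' := s = s' \/ predecessor V E C (opp_sep E s) s'.

Definition sep_class V E C s : set sep :=
  [set s' | C s' /\ sep_equiv V E C s s'].

(* Vertices of the structure tree of C.  The tree of the empty system is a
   single vertex, encoded as the empty class, whose part is all of V (the empty
   intersection). *)
Definition tree_vertex V E C : set (set sep) :=
  [set t | (exists2 s, C s & t = sep_class V E C s) \/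
           (C = set0 /\ t = set0)].

Definition part V E (t : set sep) : set T := V `&` \bigcap_(s in t) side1 E s.

End Separations.

Definition fset_display : measure_display -> measure_display.
Proof. exact. Qed.

(* The Borel structure on the space of finite subsets of T: the quotient
   structure under (x_1, ..., x_n) |-> {x_1, ..., x_n}, for all n. *)
Section FsetMeasurable.
Context d (T : measurableType d).

Definition fset_measurable : set (set {fset T}) :=
  [set D | forall n : nat,
    measurable [set t : n.-tuple T | D [fset x in tval t]%fset]].

Let fset_measurable0 : fset_measurable set0.
Proof. by move=> n; exact: measurable0. Qed.

Let fset_measurableC A : fset_measurable A -> fset_measurable (~` A).
Proof. by move=> mA n; exact: measurableC (mA n). Qed.

Let fset_measurable_bigcup (F : (set {fset T})^nat) :
  (forall i, fset_measurable (F i)) -> fset_measurable (\bigcup_i F i).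
Proof.
move=> mF n.
have -> : [set t : n.-tuple T | (\bigcup_i F i) [fset x in tval t]%fset] =
    \bigcup_i [set t : n.-tuple T | F i [fset x in tval t]%fset].
  by apply/seteqP; split => t [i _ Fi]; exists i.
by apply: bigcup_measurable => i _; exact: mF.
Qed.

HB.instance Definition _ := @isMeasurable.Build (fset_display d) {fset T}
  fset_measurable fset_measurable0 fset_measurableC fset_measurable_bigcup.

End FsetMeasurable.

Section StandardBorel.
Variable R : realType.

Definition polish (M : metricType R) :=
  (forall u : nat -> M, cauchy (u @ \oo) -> exists l : M, u @ \oo --> l) /\
  (exists2 D : set M, countable D & dense D).

(* The sigma-algebra of X is transported to the Borel sets of a Polish metric
   space by a bijection. *)
Definition standard_borel d (X : measurableType d) :=
  exists (M : metricType R) (f : X -> M),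
    [/\ polish M, bijective f &
        forall A : set X, measurable A <-> <<s [set U : set M | open U] >> (f @` A)].

End StandardBorel.

Section Treeability.
Context d (W : measurableType d).
Implicit Types (E : set (W * W)) (A : set W).

(* The restriction of E to the Borel set A is Borel treeable. *)
Definition borel_treeable_on A E :=
  exists T : set (W * W),
    [/\ measurable T, T `<=` A `*` A, symmetric_graph T, acyclic T &
        forall x y, A x -> A y -> E (x, y) <-> Rel T (x, y)].

Definition borel_treeable E := borel_treeable_on setT E.

Definition mu_treeable (R : realType) (mu : probability W R) E :=
  exists A, [/\ measurable A, mu A = 1%E & borel_treeable_on A E].

Definition measure_treeable (R : realType) E :=
  forall mu : probability W R, mu_treeable mu E.

End Treeability.

Section BorelSeparations.
Context d (X : measurableType d).
Implicit Types (G : set (X * X)) (C : set (sep X)).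

Definition locally_finite_borel_graph G :=
  [/\ measurable G, symmetric_graph G & locally_finite G].

Definition Sep G : set (sep X) :=
  [set s | exists x, separation (component G x) G s].

(* The members of C that live in the component of x. *)
Definition local_system G C (x : X) : set (sep X) :=
  [set s | C s /\ [set` s.1] `<=` component G x].

Definition borel_separation_system G C :=
  [/\ measurable (C : set ({fset X} * {fset X * X})), C `<=` Sep G &
      forall x, separation_system (component G x) G (local_system G C x)].

Definition nested_in_components G C :=
  forall x, nested_system (component G x) G (local_system G C x).

Definition star_in_components G C :=
  forall x, finite_intervals (component G x) G (local_system G C x).

Definition vertex_at G C (x : X) : set (set (sep X)) :=
  tree_vertex (component G x) G (local_system G C x).

Definition class_at G C (x : X) (s : sep X) : set (sep X) :=
  sep_class (component G x) G (local_system G C x) s.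

Definition Zset G C : set (X * set (sep X)) :=
  [set z | vertex_at G C z.1 z.2 /\ part (component G z.1) G z.2 z.1].

(* Y and U are the pieces of the identification of Z with (Y/R) + U. *)
Definition Yset C : set (X * sep X) :=
  [set y | C y.2 /\ y.1 \in y.2.1].

Definition Uset G C : set X :=
  [set x | (forall s, C s -> x \notin s.1) /\ exists t, Zset G C (x, t)].

Let Rel_trans (T : choiceType) (E : set (T * T)) x y z :
  Rel E (x, y) -> Rel E (y, z) -> Rel E (x, z).
Proof.
move=> [p /= pp px] [q /= qq qy]; exists (p ++ q) => /=.
  by rewrite cat_path pp px.
by rewrite last_cat px.
Qed.

Let Rel_sym (T : choiceType) (E : set (T * T)) x y :
  symmetric_graph E -> Rel E (x, y) -> Rel E (y, x).
Proof.
move=> symE [p /= pp <-] {y}; elim: p x pp => [x _|y p IH x /= /andP[xy yp]].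
  by exists [::].
apply: (Rel_trans (IH _ yp)); exists [:: x] => //=; rewrite andbT.
by move: xy; rewrite /adjacent !inE; exact: symE.
Qed.

Lemma Zset_nonempty G C : locally_finite_borel_graph G ->
  borel_separation_system G C -> exists z, Zset G C z.
Proof.
move=> [_ symG _] [_ _ sysC]; have [C0|/set0P[s Cs]] :=
    eqVneq (local_system G C point) set0.
  exists (point, set0); split; first by right.
  by split; [exists [::] | move=> s []].
have [[SV subB _] [_ [e eB] _] _] := sysC _ _ Cs.
have [_ uS _] := subB _ eB.
set u := e.1 in uS.
have Su v : v \in s.1 -> component G u v.
  by move=> vS; apply: Rel_trans (SV _ vS); apply: Rel_sym (SV _ uS).
have Cu : local_system G C u s by split; [exact: Cs.1|].
exists (u, class_at G C u s); split; first by left; exists s.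
split; first by exists [::].
move=> s' [_ [<-|[_ _ [[le1 _] _] _]]]; first by left.
by apply: le1; left.
Qed.

End BorelSeparations.

Definition levels_display : measure_display -> measure_display.
Proof. exact. Qed.

Section LevelsSpace.
Context d (X : measurableType d) (G : set (X * X)) (C : set (sep X)).

(* The proofs hG and hC only serve to show that Z is inhabited, as required of
   a measurableType. *)
Definition Zspace of locally_finite_borel_graph G & borel_separation_system G C :=
  {z : X * set (sep X) | z \in Zset G C}.

Variables (hG : locally_finite_borel_graph G) (hC : borel_separation_system G C).
Local Notation Z := (Zspace hG hC).

Let Zspace_point : Z.
Proof.
by have /cid[z Zz] := Zset_nonempty hG hC; exists z; rewrite inE.
Qed.

HB.instance Definition _ := Choice.on Z.
HB.instance Definition _ := isPointed.Build Z Zspace_point.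

(* A subset of Z is Borel iff its preimage under (x, s) |-> (x, [s]) is Borel
   in Y and its preimage under x |-> (x, t) is Borel in U, both carrying their
   subspace Borel structure. *)
Definition Z_measurable : set (set Z) :=
  [set A |
    (exists2 B : set (X * ({fset X} * {fset X * X})), measurable B &
       forall (z : Z) s, Yset C ((val z).1, s) ->
         (val z).2 = class_at G C (val z).1 s ->
         A z <-> B ((val z).1, s)) /\
    (exists2 B : set X, measurable B &
       forall z : Z, Uset G C (val z).1 -> A z <-> B (val z).1)].

Let Z_measurable0 : Z_measurable set0.
Proof. by split; exists set0. Qed.

Let Z_measurableC A : Z_measurable A -> Z_measurable (~` A).
Proof.
move=> [[B mB AB] [B' mB' AB']]; split.
- exists (~` B); first exact: measurableC.
  by move=> z s Yz zs; split => + /(AB _ _ Yz zs).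
- exists (~` B'); first exact: measurableC.
  by move=> z Uz; split => + /(AB' _ Uz).
Qed.

Let Z_measurable_bigcup (F : (set Z)^nat) :
  (forall i, Z_measurable (F i)) -> Z_measurable (\bigcup_i F i).
Proof.
move=> mF; split.
- have /choice[B BP] : forall i, exists B,
      measurable B /\ forall (z : Z) s, Yset C ((val z).1, s) ->
         (val z).2 = class_at G C (val z).1 s ->
         F i z <-> B ((val z).1, s).
    by move=> i; have [[B ? ?] _] := mF i; exists B.
  exists (\bigcup_i B i).
    by apply: bigcup_measurable => i _; exact: (BP i).1.
  by move=> z s Yz zs; split => -[i _ /((BP i).2 _ _ Yz zs) ?]; exists i.
- have /choice[B BP] : forall i, exists B,
      measurable B /\ forall z : Z, Uset G C (val z).1 ->
         F i z <-> B (val z).1.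
    by move=> i; have [_ [B ? ?]] := mF i; exists B.
  exists (\bigcup_i B i).
    by apply: bigcup_measurable => i _; exact: (BP i).1.
  by move=> z Uz; split => -[i _ /((BP i).2 _ Uz) ?]; exists i.
Qed.

HB.instance Definition _ := @isMeasurable.Build (levels_display d) Z
  Z_measurable Z_measurable0 Z_measurableC Z_measurable_bigcup.

(* A vertex of a structure tree determines the component it comes from, except
   for the empty class; the conjunct with Rel G separates the single-vertex
   trees of distinct components. *)
Definition levels : set (Z * Z) :=
  [set zz | (val zz.1).2 = (val zz.2).2 /\ Rel G ((val zz.1).1, (val zz.2).1)].

End LevelsSpace.

Arguments levels {d X G C} hG hC _.

(* Main.v *)
(** Call a graph bridged if each of its edges is the only edge leaving some set
    of vertices; for symmetric graphs this is the same as being acyclic, and it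
    survives the constructions below.

    Adding to a treeing of Q one edge between (x, [s]) and (x, [s^-]) for each
    s in the system, with x the least point of the separator of s for a Borel
    linear order, gives a bridged Borel graph H on Z whose components are the
    fibres of Z over the components of G: the bridges come from orienting the
    structure tree away from an edge or a vertex, and connectedness from the
    finiteness of intervals.  The parts need not cover X, so X is not a quotient of Z; but
    each component of G has a vertex in some part, so there is a Borel map
    rho : X -> Z with rho x above the component of x.  Moving each point of Z
    along H to a nearest point of rho(X), contracting the fibres of this
    retraction, and attaching the other points of X as leaves gives the treeing
    of Rel G.

    All choices are Borel because Rel G is a countable union of graphs of Borel
    functions.  This case of the Lusin-Novikov theorem is derived from Novikov's
    separation theorem for Souslin sets: if D ranges over a countable base, the
    Souslin sets of those (x, y) in G for which y is not in D or x has two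
    neighbours in D have empty intersection, and complements of Borel sets
    separating them cut G into countably many pieces with at most one point
    above each x.

    For measures, a probability mu on X is spread to Z by a weighted sum of its
    images under countably many Borel maps enumerating the fibres of Z over
    components, so that a conull set for this sum contains the preimage of a
    mu-conull invariant Borel set, over which the Borel case applies. *)
From HB Require Import structures.
From mathcomp Require Import all_boot all_order all_algebra finmap.
From mathcomp Require Import all_classical all_reals all_analysis.
From mathcomp Require Import choice lra.
Require Import Defs.

Set Implicit Arguments.
Unset Strict Implicit.
Unset Printing Implicit Defensive.

Local Open Scope classical_set_scope.

(** * Measurable predicates and Souslin sets *)

Section MeasurablePredicates.
Context d (T : measurableType d).
Implicit Types P Q : T -> Prop.

Lemma measurable_cstP (p : Prop) : measurable [set _ : T | p].
Proof.
have [h|h] := pselect p.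
  by rewrite (_ : mkset _ = setT); [exact: measurableT|apply/seteqP; split].
by rewrite (_ : mkset _ = set0); [exact: measurable0|apply/seteqP; split].
Qed.

Lemma measurable_and P Q : measurable [set x | P x] -> measurable [set x | Q x] ->
  measurable [set x | P x /\ Q x].
Proof. exact: measurableI. Qed.

Lemma measurable_or P Q : measurable [set x | P x] -> measurable [set x | Q x] ->
  measurable [set x | P x \/ Q x].
Proof. exact: measurableU. Qed.

Lemma measurable_not P : measurable [set x | P x] -> measurable [set x | ~ P x].
Proof. exact: measurableC. Qed.

Lemma measurable_imply P Q :
  measurable [set x | P x] -> measurable [set x | Q x] ->
  measurable [set x | P x -> Q x].
Proof.
move=> mP mQ; rewrite (_ : mkset _ = [set x | ~ P x \/ Q x]).
  exact: measurable_or (measurable_not mP) mQ.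
apply/seteqP; split => x /=; last by case=> // ? _.
by move=> PQ; have [/PQ|] := pselect (P x); [right|left].
Qed.

Lemma measurable_iff P Q :
  measurable [set x | P x] -> measurable [set x | Q x] ->
  measurable [set x | P x <-> Q x].
Proof. by move=> mP mQ; apply: measurable_and; exact: measurable_imply. Qed.

Lemma measurable_exists (I : countType) (P : I -> T -> Prop) :
  (forall i, measurable [set x | P i x]) ->
  measurable [set x | exists i, P i x].
Proof.
move=> mP; rewrite (_ : mkset _ =
    \bigcup_n (if unpickle n is Some i then [set x | P i x] else set0)).
  by apply: bigcup_measurable => n _; case: (unpickle n) => [i|].
apply/seteqP; split => [x [i Pix]|x [n _]].
  by exists (pickle i) => //; rewrite pickleK.
by case: (unpickle n) => [i Pix|//]; exists i.
Qed.

Lemma measurable_forall (I : countType) (P : I -> T -> Prop) :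
  (forall i, measurable [set x | P i x]) ->
  measurable [set x | forall i, P i x].
Proof.
move=> mP; rewrite (_ : mkset _ = ~` [set x | exists i, ~ P i x]).
  by apply/measurableC/measurable_exists => i; exact: measurable_not.
apply/seteqP; split => [x Px [i]|x /= nP i]; first exact.
by apply: contrapT => nPi; apply: nP; exists i.
Qed.

Lemma measurable_exists2 (I : countType) (P Q : I -> T -> Prop) :
  (forall i, measurable [set x | P i x]) ->
  (forall i, measurable [set x | Q i x]) ->
  measurable [set x | exists2 i, P i x & Q i x].
Proof.
move=> mP mQ.
rewrite (_ : mkset _ = [set x | exists i, P i x /\ Q i x]).
  by apply: measurable_exists => i; exact: measurable_and.
by apply/seteqP; split => x [i]; [exists i|case; exists i].
Qed.

Lemma measurable_preimage d' (T' : measurableType d') (f : T -> T') (A : set T') :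
  measurable_fun setT f -> measurable A -> measurable [set x | A (f x)].
Proof. by move=> mf mA; have := mf measurableT _ mA; rewrite setTI. Qed.

Lemma measurable_funT d' (T' : measurableType d') (f : T -> T') :
  (forall A : set T', measurable A -> measurable [set x | A (f x)]) ->
  measurable_fun setT f.
Proof. by move=> mf _ A mA; rewrite setTI; exact: mf. Qed.

Lemma measurable_preimage2 d1 d2 (T1 : measurableType d1)
    (T2 : measurableType d2) (f : T -> T1) (g : T -> T2) (A : set (T1 * T2)) :
  measurable_fun setT f -> measurable_fun setT g -> measurable A ->
  measurable [set x | A (f x, g x)].
Proof.
move=> mf mg; apply: (@measurable_preimage _ _ (fun x => (f x, g x))).
exact: measurable_fun_pair.
Qed.

(** The common form of the Borel choices below: take the value attached to the least index whose
    condition holds. The set where a given index is least is Borel, and on each such set [f] is one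
    of the given Borel functions. *)
Lemma measurable_first d' (T' : measurableType d') (P : nat -> T -> Prop)
    (F : nat -> T -> T') (dflt : T -> T') :
  (forall k, measurable [set x | P k x]) ->
  (forall k, measurable_fun setT (F k)) -> measurable_fun setT dflt ->
  exists f : T -> T', [/\ measurable_fun setT f,
    (forall x, (exists k, P k x) -> exists k, [/\ P k x, f x = F k x &
       forall l, P l x -> (k <= l)%N]) &
    forall x, (forall k, ~ P k x) -> f x = dflt x].
Proof.
move=> mP mF mD.
pose first k x := P k x /\ forall l : nat, P l x -> (k <= l)%N.
have firstP x : (exists k, P k x) -> exists k, first k x.
  move=> [k Pkx]; have ex : exists k, `[< P k x >] by exists k; apply/asboolP.
  case: (ex_minnP ex) => m /asboolP Pm mmin; exists m; split=> // l Pl.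
  by apply: mmin; apply/asboolP.
have first_inj x k l : first k x -> first l x -> k = l.
  move=> [Pk kmin] [Pl lmin]; apply/eqP.
  by rewrite eqn_leq kmin// lmin.
have mfirst k : measurable [set x | first k x].
  apply: measurable_and => //; apply: measurable_forall => l.
  by apply: measurable_imply => //; exact: measurable_cstP.
have /choice[f fP] x : exists y : T',
    (forall k, first k x -> y = F k x) /\ ((forall k, ~ P k x) -> y = dflt x).
  have [/firstP[k fk]|nP] := pselect (exists k, P k x).
    exists (F k x); split=> [l fl|nP]; first by rewrite (first_inj _ _ _ fk fl).
    by case: (nP k); case: fk.
  exists (dflt x); split=> // k [Pk _]; exfalso; apply: nP; by exists k.
exists f; split.
- apply: measurable_funT => A mA; rewrite (_ : mkset _ = [set x |
      (exists2 k, first k x & A (F k x)) \/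
      ((forall k, ~ P k x) /\ A (dflt x))]).
    apply: measurable_or.
      by apply: measurable_exists2 => // k; exact: measurable_preimage.
    apply: measurable_and; last exact: measurable_preimage.
    by apply: measurable_forall => k; exact: measurable_not.
  apply/seteqP; split => x /=.
    have [/firstP[k fk]|nP] := pselect (exists k, P k x).
      by rewrite (proj1 (fP x) _ fk); left; exists k.
    rewrite (proj2 (fP x)); first by move=> Ax; right; split=> // k Pk; apply: nP; exists k.
    by move=> k Pk; apply: nP; exists k.
  case=> [[k fk]|[nP]]; first by rewrite (proj1 (fP x) _ fk).
  by rewrite (proj2 (fP x)).
- move=> x /firstP[k fk]; exists k; split; [by case: fk|exact: (proj1 (fP x))|by case: fk].
- by move=> x; apply: (proj2 (fP x)).
Qed.

End MeasurablePredicates.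

(** * Souslin sets and Novikov's separation theorem *)

Section Cells.
Context d (T : measurableType d).

(* The model is a Polish space with c i j the closed ball of radius 1/(i+1)
   around the j-th point of a dense sequence. *)
Record cell_system (c : nat -> nat -> set T) : Prop := CellSystem {
  cell_measurable : forall i j, measurable (c i j);
  cell_cover : forall i x, exists j, c i j x;
  cell_complete : forall z : nat -> nat,
    (forall n, exists x, forall i, (i < n)%N -> c i (z i) x) ->
    exists p, forall i, c i (z i) p;
  cell_separated : forall (z w : nat -> nat) p q,
    (forall i, c i (z i) p) -> (forall i, c i (w i) q) -> p <> q ->
    exists n, c n (z n) `&` c n (w n) = set0;
  cell_generate : measurable `<=` <<s [set A | exists i j, A = c i j] >>;
  cell_closed : forall i j y, ~ c i j y ->
    exists n l, c n l y /\ c n l `&` c i j = set0 }.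

Variable c : nat -> nat -> set T.
Hypothesis cS : cell_system c.

Lemma cell_code x : exists z : nat -> nat, forall i, c i (z i) x.
Proof. by have /choice[z zx] := (cell_cover cS)^~ x; exists z. Qed.

Lemma cell_point_separated x y : x <> y ->
  exists i j, c i j x /\ ~ c i j y.
Proof.
move=> xy; have [z zx] := cell_code x; have [w wy] := cell_code y.
have [n n0] := cell_separated cS zx wy xy.
exists n, (z n); split=> // zy.
suff : set0 y by [].
by rewrite -n0.
Qed.

(* The scheme F stands for a continuous image of Baire space: along a branch
   all of whose sets are nonempty, these sets shrink to a point of A. *)
Definition souslin (A : set T) := exists F : seq nat -> set T,
  [/\ F [::] = A, forall s, F s = \bigcup_j F (rcons s j) &
    forall z : nat -> nat, (forall n, F (mkseq z n) !=set0) ->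
      exists p w, [/\ A p, forall i, c i (w i) p &
        forall i, exists n, F (mkseq z n) `<=` c i (w i)]].

Lemma mkseqS (A : Type) (z : nat -> A) n : mkseq z n.+1 = rcons (mkseq z n) (z n).
Proof. by rewrite /mkseq -addn1 iotaD map_cat /= cats1. Qed.

Lemma scheme_mono (F : seq nat -> set T) (z : nat -> nat) :
  (forall s, F s = \bigcup_j F (rcons s j)) ->
  forall m n, (m <= n)%N -> F (mkseq z n) `<=` F (mkseq z m).
Proof.
move=> FE m; elim=> [|n IH]; first by rewrite leqn0 => /eqP ->.
rewrite leq_eqVlt => /predU1P[->//|]; rewrite ltnS => /IH; apply: subset_trans.
by rewrite mkseqS [X in _ `<=` X]FE => x Fx; exists (z n).
Qed.

Lemma souslin0 : souslin set0.
Proof.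
exists (fun=> set0); split=> // [s|z /(_ 0)[//]].
by rewrite bigcup0.
Qed.

Lemma souslin_bigcup (A : nat -> set T) :
  (forall n, souslin (A n)) -> souslin (\bigcup_n A n).
Proof.
move=> /choice[F FP].
exists (fun s => if s is j :: s' then F j s' else \bigcup_n A n); split=> //.
- case=> [|j s] /=; last by have [_ + _] := FP j; exact.
  by apply: eq_bigcupr => j _; have [->] := FP j.
- move=> z zne; have [_ _ /(_ (z \o succn))] := FP (z 0).
  have E n : mkseq z n.+1 = z 0 :: mkseq (z \o succn) n.
    by rewrite /mkseq /= -[1]/(1 + 0) iotaDl -map_comp; congr cons; exact: eq_map.
  case=> [n|p [w [Ap cw Fw]]]; first by have := zne n.+1; rewrite E.
  exists p, w; split=> //; first by exists (z 0).
  by move=> i; have [n nP] := Fw i; exists n.+1; rewrite E.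
Qed.

(** Cells behave like closed sets. Replacing the [i]-th entry of [z] by [j] keeps the code
    consistent, so completeness gives a point [p] of [c i j]. If [p] differed from [x], two cells of
    the same level would be disjoint, although [x] or one of the given approximations lies in
    both. *)
Lemma cell_override z i j x :
  (forall n, exists y, c i j y /\ forall k, (k < n)%N -> c k (z k) y) ->
  (forall k, c k (z k) x) -> c i j x.
Proof.
move=> zP xz; pose w k := if k == i then j else z k.
have [p pw] : exists p, forall k, c k (w k) p.
  apply: (cell_complete cS) => n; have [y [yi yz]] := zP n; exists y => k kn.
  by rewrite /w; case: eqP => [->//|_]; exact: yz.
have [<-|px] := pselect (p = x); first by have := pw i; rewrite /w eqxx.
have [n n0] := cell_separated cS pw xz px.
suff : set0 (point : T) by [].
have [ni|ni] := eqVneq n i; last first.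
  suff : set0 x by [].
  by rewrite -n0 /w (negbTE ni); split.
have [y [yi yz]] := zP i.+1.
suff : set0 y by [].
by rewrite -n0 ni /w eqxx; split=> //; exact: yz.
Qed.

(** The scheme intersects [c i j] with the cells named by the letters read so far; [cell_override]
    keeps the limit of a branch inside [c i j]. *)
Lemma souslin_cell i j : souslin (c i j).
Proof.
exists (fun s => c i j `&` [set x | forall k, (k < size s)%N -> c k (nth 0 s k) x]).
split.
- by apply/seteqP; split => x; [case|split].
- move=> s; apply/seteqP; split => x /=.
    move=> [cx sx]; have [l cl] := cell_cover cS (size s) x.
    exists l => //; split=> // k; rewrite size_rcons ltnS nth_rcons leq_eqVlt.
    by case: ltngtP => //= [/sx//|-> _].
  move=> [l _ [cx sx]]; split=> // k ks; have := sx k.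
  by rewrite size_rcons nth_rcons ks; apply; exact: ltnW.
move=> z zne.
have zP n : exists y, c i j y /\ forall k, (k < n)%N -> c k (z k) y.
  have [y [yi yz]] := zne n; exists y; split=> // k kn.
  by have := yz k; rewrite size_mkseq nth_mkseq//; exact.
have [p pz] : exists p, forall k, c k (z k) p.
  by apply: (cell_complete cS) => n; have [y [_ ?]] := zP n; exists y.
exists p, z; split=> //; first exact: (cell_override zP).
move=> k; exists k.+1 => x [_]; rewrite size_mkseq => /(_ k (ltnSn _)).
by rewrite nth_mkseq.
Qed.

Lemma souslin_setT : souslin setT.
Proof.
rewrite (_ : setT = \bigcup_j c 0 j).
  by apply: souslin_bigcup => j; exact: souslin_cell.
by apply/seteqP; split => x // _; have [j] := cell_cover cS 0 x; exists j.
Qed.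

Lemma souslin_cellC i j : souslin (~` c i j).
Proof.
pose D n := if @unpickle (nat * nat)%type n is Some (k, l)
  then if `[< c k l `&` c i j = set0 >] then c k l else set0 else set0.
rewrite (_ : ~` _ = \bigcup_n D n).
  apply: souslin_bigcup => n; rewrite /D.
  case: (unpickle n) => [[k l]|]; last exact: souslin0.
  by case: asboolP => _; [exact: souslin_cell|exact: souslin0].
apply/seteqP; split => x.
  move=> /(cell_closed cS)[k [l [xkl kl0]]]; exists (pickle (k, l)) => //.
  by rewrite /D pickleK; case: asboolP.
move=> [n _]; rewrite /D; case: (unpickle n) => [[k l]|//].
by case: asboolP => // kl0 xkl xij; suff : set0 x by []; rewrite -kl0.
Qed.

(* A finite sequence of letters, each coding a sequence of numbers, carries the
   initial segments of infinitely many sequences: the n-th one starts at the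
   n-th letter. *)
Definition strand (n : nat) (s : seq (seq nat)) : seq nat :=
  [seq nth 0 l n | l <- drop n s].

Lemma strand_rcons n s l : strand n (rcons s l) =
  if (n <= size s)%N then rcons (strand n s) (nth 0 l n) else strand n s.
Proof.
rewrite /strand; case: ifPn => [ns|]; first by rewrite drop_rcons// map_rcons.
rewrite -ltnNge => ns; rewrite !drop_oversize ?size_rcons//; exact: ltnW.
Qed.

Lemma strand_mkseq n (z : nat -> seq nat) m :
  strand n (mkseq z m) = mkseq (fun k => nth 0 (z (k + n)) n) (m - n).
Proof.
elim: m => [|m IH]; first by rewrite sub0n.
rewrite mkseqS strand_rcons size_mkseq; case: ifPn => [nm|].
  by rewrite subSn// mkseqS IH subnK.
by rewrite -ltnNge IH => nm; move: (nm); rewrite -subn_eq0 => /eqP ->;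
  rewrite (_ : m - n = 0)//; apply/eqP; rewrite subn_eq0 ltnW.
Qed.

Definition separable (A : nat -> set T) := exists B : nat -> set T,
  [/\ forall n, measurable (B n), forall n, A n `<=` B n & \bigcap_n B n = set0].

Lemma separableS (A A' : nat -> set T) : (forall n, A n `<=` A' n) ->
  separable A' -> separable A.
Proof.
by move=> AA' [B [mB AB B0]]; exists B; split=> // n; exact: subset_trans (AB n).
Qed.

Definition override (A : nat -> set T) n (D : set T) m :=
  if m == n then D else A m.

(** Separators for all the pieces [D j] combine into one family: their union over [j] at index [n],
    their intersection over [j] at every other index. *)
Lemma separable_split (A : nat -> set T) n (D : nat -> set T) :
  A n = \bigcup_j D j -> (forall j, separable (override A n (D j))) -> separable A.
Proof.
move=> An /choice[B BP].
exists (fun m => if m == n then \bigcup_j B j m else \bigcap_j B j m); split.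
- move=> m; case: eqP => _.
    by apply: bigcup_measurable => j _; have [+ _ _] := BP j; exact.
  by apply: bigcap_measurableType => j _; have [+ _ _] := BP j; exact.
- move=> m; case: eqP => [->|/eqP mn].
    rewrite An => x [j _ Dx]; exists j => //; have [_ /(_ n) + _] := BP j.
    by rewrite /override eqxx; exact.
  move=> x Ax j _; have [_ /(_ m) + _] := BP j.
  by rewrite /override (negbTE mn); exact.
- apply/seteqP; split => // x xB.
  have := xB n I; rewrite eqxx => -[j _ Bx].
  have [_ _ <-] := BP j => m _; have := xB m I.
  by case: eqP => [->//|_]; exact.
Qed.

(** The splitting lemma is applied to the indices 0, ..., N-1 in turn; each application adds one
    entry to [l], and inseparability survives for some choice of it. *)
Lemma separable_split_lt (F : nat -> seq nat -> set T) (u : nat -> seq nat) N :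
  (forall n s, F n s = \bigcup_j F n (rcons s j)) ->
  ~ separable (fun n => F n (u n)) ->
  exists l : seq nat, ~ separable
    (fun n => F n (if (n < N)%N then rcons (u n) (nth 0 l n) else u n)).
Proof.
move=> FE nsep; suff [l [sl lP]] : exists l : seq nat, size l = N /\ ~ separable
    (fun n => F n (if (n < N)%N then rcons (u n) (nth 0 l n) else u n)).
  by exists l.
elim: N => [|N [l [sl lP]]]; first by exists [::].
have /existsNP[j jP] : ~ forall j, separable
    (fun n => F n (if (n < N.+1)%N then rcons (u n) (nth 0 (rcons l j) n) else u n)).
  move=> sepj; apply: lP; apply: (@separable_split _ N (fun j => F N (rcons (u N) j))).
    by rewrite ltnn; exact: FE.
  move=> j; apply: separableS (sepj j) => n; rewrite /override ltnS nth_rcons sl.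
  have [->|nN] := eqVneq n N; first by rewrite leqnn ltnn.
  by rewrite [(n <= N)%N]leq_eqVlt (negbTE nN) /=; case: ifP => _ x.
by exists (rcons l j); rewrite size_rcons sl.
Qed.

Lemma separable_pair (A : nat -> set T) n m (U V : set T) : n <> m ->
  measurable U -> measurable V -> A n `<=` U -> A m `<=` V -> U `&` V = set0 ->
  separable A.
Proof.
move=> nm mU mV AU AV UV0.
exists (fun k => if k == n then U else if k == m then V else setT); split.
- by move=> k; case: eqP => // _; case: eqP => // _; exact: measurableT.
- by move=> k; case: eqP => [->//|_]; case: eqP => [->//|_].
- apply/seteqP; split=> // x xB; rewrite -UV0; split.
    by have := xB n I; rewrite eqxx.
  by have := xB m I; rewrite eqxx; case: eqP => // /esym.
Qed.

(** If there were no separators, inseparable families could be refined forever: at stage [m] the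
    strands 0, ..., m each grow by one number. In the limit every [A n] receives a point [p n].
    These points cannot all agree, and two that differ lie in disjoint cells, which separate the
    family at a finite stage. *)
Lemma novikov_separation (A : nat -> set T) :
  (forall n, souslin (A n)) -> \bigcap_n A n = set0 -> separable A.
Proof.
move=> /choice[F FP] A0; apply: contrapT => nsep.
have FE n s : F n s = \bigcup_j F n (rcons s j) by have [_ + _] := FP n; exact.
have FA n : F n [::] = A n by have [-> _ _] := FP n.
pose good (s : seq (seq nat)) := ~ separable (fun n => F n (strand n s)).
have good0 : good [::].
  apply: contra_not nsep; apply: separableS => n.
  by rewrite /strand /= FA.
have goodS s : {l | good s -> good (rcons s l)}.
  apply: cid; have [gs|] := pselect (good s); last by exists [::].
  have [l lP] := separable_split_lt (size s).+1 FE gs.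
  exists l => _; apply: contra_not lP; apply: separableS => n.
  by rewrite ltnS strand_rcons; case: ifP => _ x.
pose st := fix st n := if n is m.+1 then rcons (st m) (sval (goodS (st m))) else [::].
pose z n := sval (goodS (st n)).
have stE n : st n = mkseq z n by elim: n => // n IH; rewrite mkseqS -IH.
have good_st n : good (mkseq z n).
  rewrite -stE; elim: n => // n IH /=; exact: (svalP (goodS (st n))).
pose zn n k := nth 0 (z (k + n)) n.
have {}good_st m : ~ separable (fun n => F n (mkseq (zn n) (m - n))).
  apply: contra_not (good_st m); apply: separableS => n.
  by rewrite strand_mkseq.
have limit n : exists p w, [/\ A n p, forall i, c i (w i) p &
    forall i, exists m, F n (mkseq (zn n) m) `<=` c i (w i)].
  have [_ _] := FP n; apply=> m; apply: contrapT => /nonemptyPn F0.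
  (* At stage [m + n] the strand [n], which starts at letter [n], has length exactly [m]. One empty
     set makes a family separable at once. *)
  apply: (good_st (m + n)%N); apply: (@separable_pair _ n n.+1 set0 setT) => //.
  - by rewrite addnK F0.
  - by rewrite set0I.
have /choice[p /choice[w pw]] := limit.
have [peq|/existsNP[n pn]] := pselect (forall n, p n = p 0).
  suff : set0 (p 0) by [].
  by rewrite -A0 => n _; rewrite -(peq n); have [] := pw n.
have [_ wn Fn] := pw n; have [_ w0 F0] := pw 0.
have [i i0] := cell_separated cS wn w0 pn.
have [m mP] := Fn i; have [m' mP'] := F0 i.
(* By this stage strand [n] has length at least [m] and strand 0 length at least [m'], so both sets
   are already inside the disjoint cells. *)
apply: (good_st (maxn (m + n) m')).
apply: (@separable_pair _ n 0 (c i (w n i)) (c i (w 0 i))) => //.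
- by move=> n0; apply: pn; rewrite n0.
- exact: (cell_measurable cS).
- exact: (cell_measurable cS).
- apply: subset_trans mP; apply: scheme_mono; first exact: FE.
  by rewrite leq_subRL ?(addnC n) ?leq_maxl// (leq_trans _ (leq_maxl _ _))// leq_addl.
- apply: subset_trans mP'; apply: scheme_mono; first exact: FE.
  by rewrite subn0 leq_maxr.
Qed.

(** A single branch carries a branch of every scheme by way of its strands. The limits [p n] all
    coincide, since otherwise two disjoint cells would share a point of a nonempty set of the
    combined scheme. *)
Lemma souslin_bigcap (A : nat -> set T) :
  (forall n, souslin (A n)) -> souslin (\bigcap_n A n).
Proof.
move=> /choice[F FP].
have FE n s : F n s = \bigcup_j F n (rcons s j) by have [_ + _] := FP n; exact.
have FA n : F n [::] = A n by have [-> _ _] := FP n.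
pose dec (n : nat) : seq nat := odflt [::] (unpickle n).
exists (fun s => \bigcap_n F n (strand n (map dec s))); split.
- by apply: eq_bigcapr => n _; rewrite /strand /= FA.
- move=> s; apply/seteqP; split => x.
    move=> xF; have /choice[j jP] : forall n, exists j, F n (rcons (strand n (map dec s)) j) x.
      by move=> n; have := xF n I; rewrite FE => -[j _]; exists j.
    (* The next letter extends exactly the strands 0, ..., size s, so it codes that many numbers;
       all later strands are still empty. *)
    exists (pickle (mkseq j (size s).+1)) => // n _.
    rewrite map_rcons /dec pickleK /= strand_rcons size_map.
    by case: ifPn => [ns|_]; [rewrite nth_mkseq//; exact: jP|exact: xF].
  move=> [j _ xF] n _; have := xF n I; rewrite map_rcons strand_rcons.
  by case: ifP => // _ Fx; rewrite FE; exists (nth 0 (dec j) n).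
move=> z zne; pose zn n k := nth 0 (dec (z (k + n))) n.
have E n m : strand n (map dec (mkseq z m)) = mkseq (zn n) (m - n).
  rewrite /mkseq -map_comp; exact: (strand_mkseq n (dec \o z) m).
have limit n : exists p w, [/\ A n p, forall i, c i (w i) p &
    forall i, exists m, F n (mkseq (zn n) m) `<=` c i (w i)].
  have [_ _] := FP n; apply=> m; have [x /(_ n I)] := zne (m + n).
  by rewrite E addnK; exists x.
have /choice[p /choice[w pw]] := limit.
have [peq|/existsNP[n pn]] := pselect (forall n, p n = p 0).
  have [_ w0 F0] := pw 0; exists (p 0), (w 0); split=> //.
    by move=> n _; rewrite -(peq n); have [] := pw n.
  by move=> i; have [m mP] := F0 i; exists m => x /(_ 0 I); rewrite E subn0; exact: mP.
have [_ wn Fn] := pw n; have [_ w0 F0] := pw 0.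
have [i i0] := cell_separated cS wn w0 pn.
have [m mP] := Fn i; have [m' mP'] := F0 i.
have [x xF] := zne (maxn (m + n) m').
suff : set0 x by [].
rewrite -i0; split.
- apply: mP; apply: (@scheme_mono _ _ (FE n) _ (maxn (m + n) m' - n)).
    by rewrite leq_subRL ?(addnC n) ?leq_maxl// (leq_trans _ (leq_maxl _ _))// leq_addl.
  by have := xF n I; rewrite E.
- apply: mP'; apply: (@scheme_mono _ _ (FE 0) _ (maxn (m + n) m')).
    by rewrite leq_maxr.
  by have := xF 0 I; rewrite E subn0.
Qed.

(** The sets that are Souslin together with their complement form a sigma-algebra, and it contains
    the generating cells. *)
Lemma measurable_souslin A : measurable A -> souslin A.
Proof.
move=> /(cell_generate cS) => mA.
suff /(_ _ mA)[] : <<s [set A | exists i j, A = c i j] >> `<=`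
    [set A | souslin A /\ souslin (~` A)] by [].
apply: smallest_sub; last first.
  by move=> _ [i [j ->]]; split; [exact: souslin_cell|exact: souslin_cellC].
split=> /=.
- by rewrite setC0; split; [exact: souslin0|exact: souslin_setT].
- by move=> B [sB sBC]; rewrite setTD setCK.
- move=> B BP; split; first by apply: souslin_bigcup => n; have [] := BP n.
  by rewrite setC_bigcup; apply: souslin_bigcap => n; have [] := BP n.
Qed.

Lemma souslinU A B : souslin A -> souslin B -> souslin (A `|` B).
Proof.
move=> sA sB; rewrite (_ : _ `|` _ = \bigcup_n (if n is 0 then A else B)).
  by apply: souslin_bigcup => -[|n].
apply/seteqP; split => x; first by case=> ?; [exists 0|exists 1].
by case=> -[|n] _ ?; [left|right].
Qed.

Lemma souslinI A B : souslin A -> souslin B -> souslin (A `&` B).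
Proof.
move=> sA sB; rewrite (_ : _ `&` _ = \bigcap_n (if n is 0 then A else B)).
  by apply: souslin_bigcap => -[|n].
apply/seteqP; split => x; first by move=> [? ?] [|n].
by move=> xAB; split; [exact: (xAB 0)|exact: (xAB 1)].
Qed.

Lemma souslin_exists (I : countType) (A : I -> set T) :
  (forall i, souslin (A i)) -> souslin [set x | exists i, A i x].
Proof.
move=> sA; rewrite (_ : mkset _ =
    \bigcup_n (if unpickle n is Some i then A i else set0)).
  apply: souslin_bigcup => n; case: (unpickle n) => [i//|]; exact: souslin0.
apply/seteqP; split => [x [i Aix]|x [n _]].
  by exists (pickle i) => //; rewrite pickleK.
by case: (unpickle n) => [i Aix|//]; exists i.
Qed.

End Cells.

(** * Borel graphs with finite sections *)

Section ProductCells.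
Context d d' (T : measurableType d) (T' : measurableType d').
Variables (c : nat -> nat -> set T) (c' : nat -> nat -> set T').
Hypotheses (cS : cell_system c) (cS' : cell_system c').

Definition decode_pair (j : nat) : nat * nat := odflt (0, 0) (unpickle j).

Lemma decode_pairK (p : nat * nat) : decode_pair (pickle p) = p.
Proof. by rewrite /decode_pair pickleK. Qed.

(** Both factors have the same level [i]: in the model these are closed balls for the maximum
    metric, with the pair of centres coded by [j]. *)
Definition prod_cell i j : set (T * T') :=
  c i (decode_pair j).1 `*` c' i (decode_pair j).2.

(** One factor is treated at a time. A cell times the whole space is a countable union of product
    cells, because the cells of any one level cover the other factor; complements and countable
    unions then extend this to all Borel sets. *)
Lemma sigma_prod_cell (A : set T) (B : set T') : measurable A -> measurable B ->
  <<s [set D | exists i j, D = prod_cell i j] >> (A `*` B).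
Proof.
set S := <<s _ >> => mA mB.
have sS : sigma_algebra setT S by exact: smallest_sigma_algebra.
have SC D : S D -> S (~` D) by case: sS => _ + _ => /(_ D); rewrite setTD; exact.
have SU (F : nat -> set (T * T')) : (forall n, S (F n)) -> S (\bigcup_n F n).
  by case: sS => _ _; exact.
have Scell i j l : S (c i j `*` c' i l).
  apply: sub_sigma_algebra; exists i, (pickle (j, l)).
  by rewrite /prod_cell decode_pairK.
have S1 : S (A `*` setT).
  suff /(_ _ (cell_generate cS mA)) : <<s [set A | exists i j, A = c i j] >> `<=`
    [set A | S (A `*` setT)] by [].
  apply: smallest_sub; last first.
    move=> _ [i [j ->]] /=; rewrite (_ : _ `*` _ = \bigcup_l (c i j `*` c' i l)).
      exact: SU.
    apply/seteqP; split => [[x y] [/= cx _]|[x y] [l _ [cx _]]//].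
    by have [l cl] := cell_cover cS' i y; exists l.
  split=> /=.
  - by rewrite set0X; case: sS.
  - move=> D /SC; rewrite setTD; congr S; apply/seteqP; split => [[x y]|[x y] [Dx _] []//].
    by move=> /= h; split=> // Dx; apply: h; split.
  - move=> F /SU; congr S; apply/seteqP; split => [[x y] [n _ [Fx _]]|[x y] [[n _ Fx] _]].
      by split=> //; exists n.
    by exists n.
have S2 : S (setT `*` B).
  suff /(_ _ (cell_generate cS' mB)) : <<s [set A | exists i j, A = c' i j] >> `<=`
    [set B | S (setT `*` B)] by [].
  apply: smallest_sub; last first.
    move=> _ [i [j ->]] /=; rewrite (_ : _ `*` _ = \bigcup_l (c i l `*` c' i j)).
      exact: SU.
    apply/seteqP; split => [[x y] [/= _ cy]|[x y] [l _ [_ cy]]//].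
    by have [l cl] := cell_cover cS i x; exists l.
  split=> /=.
  - by rewrite setX0; case: sS.
  - move=> D /SC; rewrite setTD; congr S; apply/seteqP; split => [[x y]|[x y] [_ Dx] []//].
    by move=> /= h; split=> // Dx; apply: h; split.
  - move=> F /SU; congr S; apply/seteqP; split => [[x y] [n _ [_ Fx]]|[x y] [_ [n _ Fx]]].
      by split=> //; exists n.
    by exists n.
rewrite (_ : A `*` B = ~` (\bigcup_n (if n is 0 then ~` (A `*` setT) else ~` (setT `*` B)))).
  by apply: (SC _); apply: SU => -[|n]; exact: SC.
apply/seteqP; split => [[x y] [/= Ax By] [[|n] _]|[x y] /= h]; try by apply; split.
by split; apply: contrapT => hn; apply: h; [exists 0|exists 1] => // -[].
Qed.

Lemma prod_cell_system : cell_system prod_cell.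
Proof.
split.
- by move=> i j; apply: measurableX; [exact: (cell_measurable cS)|exact: (cell_measurable cS')].
- move=> i [x y]; have [j cj] := cell_cover cS i x; have [l cl] := cell_cover cS' i y.
  by exists (pickle (j, l)); rewrite /prod_cell decode_pairK.
- move=> z zP.
  have [p pz] : exists p, forall i, c i (decode_pair (z i)).1 p.
    apply: (cell_complete cS) => n; have [[x y] xy] := zP n.
    by exists x => i /xy[].
  have [q qz] : exists q, forall i, c' i (decode_pair (z i)).2 q.
    apply: (cell_complete cS') => n; have [[x y] xy] := zP n.
    by exists y => i /xy[].
  by exists (p, q).
- move=> z w [p1 p2] [q1 q2] pz qw pq.
  have [p1q1|p1q1] := pselect (p1 = q1).
    have p2q2 : p2 <> q2 by move=> p2q2; apply: pq; rewrite p1q1 p2q2.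
    have [n n0] := cell_separated cS' (fun i => (pz i).2) (fun i => (qw i).2) p2q2.
    exists n; apply/seteqP; split=> // -[x y] [[_ /= xz] [_ /= xw]].
    by suff : set0 y by []; rewrite -n0.
  have [n n0] := cell_separated cS (fun i => (pz i).1) (fun i => (qw i).1) p1q1.
  exists n; apply/seteqP; split=> // -[x y] [[/= xz _] [/= xw _]].
  by suff : set0 x by []; rewrite -n0.
- rewrite measurable_prod_measurableType; apply: smallest_sub.
    exact: smallest_sigma_algebra.
  by move=> _ [A mA [B mB <-]]; exact: sigma_prod_cell.
- move=> i j [x y] /not_andP[/= nx|/= ny].
    have [n [l [xl nl]]] := cell_closed cS nx; have [m ym] := cell_cover cS' n y.
    exists n, (pickle (l, m)); rewrite /prod_cell decode_pairK; split=> //.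
    apply/seteqP; split=> // -[a b] [[/= al _] [/= aj _]].
    by suff : set0 a by []; rewrite -nl.
  have [n [l [yl nl]]] := cell_closed cS' ny; have [m xm] := cell_cover cS n x.
  exists n, (pickle (m, l)); rewrite /prod_cell decode_pairK; split=> //.
  apply/seteqP; split=> // -[a b] [[/= _ al] [/= _ aj]].
  by suff : set0 b by []; rewrite -nl.
Qed.

(** Projecting every set of the scheme commutes with the unions and creates no new nonempty sets, so
    the same branches converge. *)
Lemma souslin_fst (A : set (T * T')) :
  souslin prod_cell A -> souslin c [set x | exists y, A (x, y)].
Proof.
move=> [F [F0 FS FP]]; exists (fun s => [set x | exists y, F s (x, y)]); split.
- by rewrite F0.
- move=> s; apply/seteqP; split => x.
    by move=> [y]; rewrite FS => -[j _ Fx]; exists j => //; exists y.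
  by move=> [j _ [y Fx]]; exists y; rewrite FS; exists j.
- move=> z zne; have [n|[p1 p2] [w [Ap pw Fw]]] := FP z.
    by have [x [y Fxy]] := zne n; exists (x, y).
  exists p1, (fun i => (decode_pair (w i)).1); split.
  + by exists p2.
  + by move=> i; have [] := pw i.
  + by move=> i; have [n nP] := Fw i; exists n => x [y /nP[]].
Qed.

(** Each letter codes a letter of the scheme for [A] together with the index of a cell for the
    second coordinate, which makes the second coordinate converge too. *)
Lemma souslin_fst_preimage (A : set T) :
  souslin c A -> souslin prod_cell (A `*` setT).
Proof.
move=> [F [F0 FS FP]].
pose f1 (j : nat) := (decode_pair j).1; pose f2 (j : nat) := (decode_pair j).2.
exists (fun s => F (map f1 s) `*`
  [set y | forall k, (k < size s)%N -> c' k (f2 (nth 0 s k)) y]); split.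
- by rewrite F0; apply/seteqP; split => -[x y] [].
- move=> s; apply/seteqP; split => -[x y].
    move=> [/=]; rewrite FS => -[j _ Fx] sy.
    have [l cl] := cell_cover cS' (size s) y.
    exists (pickle (j, l)) => //; split => /=.
      by rewrite map_rcons {2}/f1 decode_pairK.
    move=> k; rewrite size_rcons ltnS nth_rcons leq_eqVlt.
    by case: ltngtP => //= [/sy//|-> _]; rewrite /f2 decode_pairK.
  move=> [j _ [/= Fx sy]]; split=> /=.
    by rewrite FS; exists (f1 j) => //; rewrite -map_rcons.
  move=> k ks; have := sy k.
  by rewrite size_rcons nth_rcons ks; apply; exact: ltnW.
- move=> z zne; have E n : map f1 (mkseq z n) = mkseq (f1 \o z) n.
    by rewrite /mkseq -map_comp.
  have [n|p [w [Ap pw Fw]]] := FP (f1 \o z).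
    by have [[x y] [/= + _]] := zne n; rewrite E; exists x.
  have [q qz] : exists q, forall k, c' k (f2 (z k)) q.
    apply: (cell_complete cS') => n; have [[x y] [_ /= sy]] := zne n.
    exists y => i ni; have := sy i.
    by rewrite size_mkseq nth_mkseq//; exact.
  exists (p, q), (fun i => pickle (w i, f2 (z i))); split=> //.
    by move=> i; rewrite /prod_cell decode_pairK.
  (* Length [n] controls the first coordinate; [i.+1] letters are needed before the cell of level
     [i] is named for the second. *)
  move=> i; have [n nP] := Fw i; exists (maxn n i.+1) => -[x y] [/=].
  rewrite E size_mkseq => Fx sy; rewrite /prod_cell decode_pairK; split=> /=.
    by apply: nP; exact: (scheme_mono FS (leq_maxl n i.+1) Fx).
  have := sy i (leq_maxr _ _); rewrite nth_mkseq//; exact: leq_maxr.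
Qed.

End ProductCells.

(** * Borel uniformization of relations with finite sections *)

Section Uniformization.
Context d (T : measurableType d) (c : nat -> nat -> set T).
Hypothesis cS : cell_system c.

Lemma souslin_proj (A : set (T * T)) (U : set T) :
  measurable A -> measurable U -> souslin c [set x | exists y, A (x, y) /\ U y].
Proof.
move=> mA mU; apply: (@souslin_fst _ _ _ _ c c (A `&` [set xy | U xy.2])).
apply: (measurable_souslin (prod_cell_system cS cS)); apply: measurableI => //.
exact: measurable_preimage.
Qed.

Lemma separate_pair (A B : set T) : souslin c A -> souslin c B ->
  A `&` B = set0 ->
  exists D, [/\ measurable D, A `<=` D & D `&` B = set0].
Proof.
move=> sA sB AB0.
have [n|//|D [mD AD D0]] :=
    @novikov_separation _ _ c cS (fun n => if n is 0 then A else B).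
- by case: n.
- apply/seteqP; split=> // x xAB; rewrite -AB0; split; first exact: (xAB 0).
  exact: (xAB 1).
- exists (D 0); split=> //; first exact: (AD 0).
  apply/seteqP; split=> // x [D0x Bx]; rewrite -D0 => -[|n] _ //.
  exact: (AD n.+1).
Qed.

Lemma measurable_fun_cell d' (W : measurableType d') (f : W -> T) :
  (forall i j, measurable [set x | c i j (f x)]) -> measurable_fun setT f.
Proof.
move=> mf; apply: measurable_funT => A /(cell_generate cS) SA.
suff /(_ _ SA) : <<s [set A | exists i j, A = c i j] >> `<=`
  [set A | measurable [set x | A (f x)]] by [].
apply: smallest_sub; last by move=> _ [i [j ->]]; exact: mf.
split=> /= [|B mB|F mF].
- exact: measurable0.
- by apply: measurable_and; [exact: measurable_cstP|exact: measurable_not].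
- by apply: (@bigcup_measurable _ _ (fun k => [set x | F k (f x)]) setT) => k _.
Qed.

Lemma measurable_if d1 d2 (W : measurableType d1) (W' : measurableType d2)
    (P : W -> Prop) (f g : W -> W') : measurable [set x | P x] ->
  measurable_fun setT f -> measurable_fun setT g ->
  measurable_fun setT (fun x => if `[< P x >] then f x else g x).
Proof.
move=> mP mf mg; apply: measurable_funT => A mA.
rewrite (_ : mkset _ = [set x | (P x /\ A (f x)) \/ (~ P x /\ A (g x))]).
  apply: measurable_or; apply: measurable_and => //; first exact: measurable_preimage.
    exact: measurable_not.
  exact: measurable_preimage.
apply/seteqP; split => x /=; case: asboolP => Px; first by left.
- by right.
- by case=> -[].
- by case=> -[].
Qed.

Lemma cell_code_inj z p q : (forall i, c i (z i) p) -> (forall i, c i (z i) q) -> p = q.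
Proof.
move=> pz qz; apply: contrapT => /(cell_separated cS pz qz)[n n0].
by suff : set0 p by []; rewrite -n0.
Qed.

Lemma first_cell i x : exists j, c i j x /\ forall l, (l < j)%N -> ~ c i l x.
Proof.
have [j cj] := cell_cover cS i x.
have ex : exists j, `[< c i j x >] by exists j; apply/asboolP.
case: (ex_minnP ex) => m /asboolP cm mmin; exists m; split=> // l lm /asboolP cl.
by have := mmin _ cl; rewrite leqNgt lm.
Qed.

(** For each cell, made disjoint from the earlier cells of its level, the points whose value lies
    inside it and those whose value lies outside form disjoint Souslin sets. Borel separators [B]
    then let a code of the value be read off from [x]; a consistent code determines [phi x] by
    completeness, and any other [x] is sent to [point]. *)
Lemma measurable_extension (g : set (T * T)) : measurable g ->
  (forall x y y', g (x, y) -> g (x, y') -> y = y') ->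
  exists phi : T -> T,
    measurable_fun setT phi /\ forall x y, g (x, y) -> phi x = y.
Proof.
move=> mg gfun; pose c' i j := [set y | c i j y /\ forall l, (l < j)%N -> ~ c i l y].
have mc' i j : measurable (c' i j).
  apply: measurable_and; first exact: (cell_measurable cS).
  apply: measurable_forall => l; apply: measurable_imply; first exact: measurable_cstP.
  exact/measurable_not/(cell_measurable cS).
have c'_inj i j l y : c' i j y -> c' i l y -> j = l.
  by move=> [cj minj] [cl minl]; case: (ltngtP j l) => // [/minl/(_ cj)|/minj/(_ cl)].
have /choice[B BP] (ij : nat * nat) : exists B, [/\ measurable B,
    forall x y, g (x, y) -> c' ij.1 ij.2 y -> B x &
    forall x y, g (x, y) -> B x -> c' ij.1 ij.2 y].
  have [|D [mD AD DB]] := separate_pair (souslin_proj mg (mc' ij.1 ij.2))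
    (souslin_proj mg (measurableC (mc' ij.1 ij.2))).
    apply/seteqP; split=> // x [[y [gy cy]] [y' [gy' cy']]].
    by apply: cy'; rewrite -(gfun _ _ _ gy gy').
  exists D; split=> // [x y gxy cy|x y gxy Dx]; first by apply: AD; exists y.
  apply: contrapT => cy; suff : set0 x by [].
  by rewrite -DB; split=> //; exists y.
pose first i j x := B (i, j) x /\ forall l, (l < j)%N -> ~ B (i, l) x.
have mfirst i j : measurable [set x | first i j x].
  have mB l : measurable (B (i, l)) by have [] := BP (i, l).
  apply: (measurable_and (mB j)); apply: measurable_forall => l.
  by apply: measurable_imply; [exact: measurable_cstP|exact: measurable_not (mB l)].
have first_inj i j l x : first i j x -> first i l x -> j = l.
  by move=> [cj minj] [cl minl]; case: (ltngtP j l) => // [/minl/(_ cj)|/minj/(_ cl)].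
(* The first [n] cells read off from [x] have a common point in [A]. For [A := setT] and all [n]
   this is consistency of the code; for a cell [A] it expresses, by [cell_override], that [phi x]
   lies in [A]. *)
pose approx (A : set T) n (x : T) := exists l : seq nat,
  [/\ size l = n, exists y, A y /\ forall i, (i < n)%N -> c i (nth 0 l i) y &
      forall i, (i < n)%N -> first i (nth 0 l i) x].
have mapprox A : measurable [set x | forall n, approx A n x].
  apply: measurable_forall => n; apply: measurable_exists => l.
  rewrite (_ : mkset _ = [set x | (size l = n /\ exists y, A y /\
      forall i, (i < n)%N -> c i (nth 0 l i) y) /\
      forall i, (i < n)%N -> first i (nth 0 l i) x]).
    apply: measurable_and; first exact: measurable_cstP.
    apply: measurable_forall => i; apply: measurable_imply => //.
    exact: measurable_cstP.
  by apply/seteqP; split => x /=; [case|case=> -[]].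
have approxP A x : (forall n, approx A n x) -> exists z : nat -> nat,
    (forall i, first i (z i) x) /\
    forall n, exists y, A y /\ forall i, (i < n)%N -> c i (z i) y.
  move=> Ax; have /choice[z zP] i : exists j, first i j x.
    by have [l [_ _ /(_ i (ltnSn i))]] := Ax i.+1; exists (nth 0 l i).
  exists z; split=> // n; have [l [sl [y [Ay yP]] xP]] := Ax n.
  exists y; split=> // i ni.
  by rewrite (first_inj _ _ _ _ (zP i) (xP i ni)); exact: yP.
have approx_intro A x z : (forall i, first i (z i) x) ->
    (forall n, exists y, A y /\ forall i, (i < n)%N -> c i (z i) y) ->
    forall n, approx A n x.
  move=> xz zP n; exists (mkseq z n); rewrite size_mkseq; split=> //.
    by have [y [Ay yP]] := zP n; exists y; split=> // i ni; rewrite nth_mkseq//; exact: yP.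
  by move=> i ni; rewrite nth_mkseq.
pose good x := forall n, approx setT n x.
have /choice[phi phiP] x : exists p : T,
    (good x -> forall z, (forall i, first i (z i) x) -> forall i, c i (z i) p) /\
    (~ good x -> p = point).
  have [gx|] := pselect (good x); last by exists point.
  have [z [xz zP]] := approxP _ _ gx.
  have [p pz] : exists p, forall i, c i (z i) p.
    by apply: (cell_complete cS) => n; have [y [_ yP]] := zP n; exists y.
  by exists p; split=> // _ w xw i; rewrite -(first_inj _ _ _ _ (xz i) (xw i)).
exists phi; split.
  apply: measurable_fun_cell => a b.
  rewrite (_ : mkset _ = [set x | (good x /\ forall n, approx (c a b) n x) \/
      (~ good x /\ c a b point)]).
    apply: measurable_or; apply: measurable_and.
    - exact: mapprox.
    - exact: mapprox.
    - exact: measurable_not (mapprox setT).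
    - exact: measurable_cstP.
  apply/seteqP; split => x /=; have [gx|ngx] := pselect (good x).
  - have [z [xz _]] := approxP _ _ gx; have pz := (phiP x).1 gx z xz.
    by move=> cphi; left; split=> //; apply: (approx_intro _ _ z) => // n; exists (phi x).
  - by rewrite (phiP x).2//; right.
  - case=> [[_ cx]|[]//]; have [z [xz zP]] := approxP _ _ cx.
    exact: (cell_override cS zP ((phiP x).1 gx z xz)).
  - by case=> [[]//|[_]]; rewrite (phiP x).2.
move=> x y gxy; have /choice[z zP] := first_cell^~ y.
have xz i : first i (z i) x.
  have [_ gB _] := BP (i, z i); split; first exact: (gB _ _ gxy).
  move=> l lz Bx; have [_ _ /(_ _ _ gxy Bx) cl] := BP (i, l).
  by have /= lE := c'_inj _ _ _ _ cl (zP i); move: lz; rewrite lE ltnn.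
have gx : good x.
  by apply: (approx_intro _ _ z) => // n; exists y; split=> // i _; have [] := zP i.
apply: (@cell_code_inj z); first exact: (phiP x).1.
by move=> i; have [] := zP i.
Qed.

Definition finite_cell (l : seq (nat * nat)) : set T :=
  [set y | forall p, p \in l -> c p.1 p.2 y].

Lemma measurable_finite_cell l : measurable (finite_cell l).
Proof.
apply: measurable_forall => p; apply: measurable_imply; first exact: measurable_cstP.
exact: (cell_measurable cS).
Qed.

Lemma isolating_cell (F : set T) y : finite_set F ->
  exists l, finite_cell l y /\ forall y', F y' -> finite_cell l y' -> y' = y.
Proof.
move=> /finite_seqP[s ->]; elim: s => [|a s [l [ly lP]]]; first by exists [::].
have [ay|ay] := pselect (y = a).
  exists l; split=> // y' /=; rewrite inE => /predU1P[->|/lP//]; by rewrite ay.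
have [i [j [yj aj]]] := cell_point_separated cS ay.
exists ((i, j) :: l); split.
  by move=> p; rewrite inE => /predU1P[->//|/ly].
move=> y' /=; rewrite inE => /predU1P[->|ys] y'P.
  by exfalso; apply: aj; exact: (y'P (i, j) (mem_head _ _)).
by apply: lP => // p pl; apply: y'P; rewrite inE pl orbT.
Qed.

Lemma lusin_novikov (G : set (T * T)) : measurable G ->
  (forall x, finite_set [set y | G (x, y)]) ->
  exists psi : nat -> T -> T, [/\ forall k, measurable_fun setT (psi k),
    forall k x, psi k x = x \/ G (x, psi k x) &
    forall x y, G (x, y) -> exists k, psi k x = y].
Proof.
move=> mG finG.
(* [Q l] says that [x] has two neighbours in [finite_cell l]. Distinctness is witnessed by disjoint
   cells, so that [Q l] is a countable union of intersections of projections. *)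
pose Q l := [set x | exists i : nat * (nat * nat),
  c i.1 i.2.1 `&` c i.1 i.2.2 = set0 /\
  ((exists y, G (x, y) /\ (finite_cell l `&` c i.1 i.2.1) y) /\
   (exists y, G (x, y) /\ (finite_cell l `&` c i.1 i.2.2) y))].
have QP l x y y' : G (x, y) -> G (x, y') -> finite_cell l y -> finite_cell l y' ->
    y <> y' -> Q l x.
  move=> Gy Gy' ly ly' yy'.
  have [z yz] := cell_code cS y; have [w yw] := cell_code cS y'.
  have [n n0] := cell_separated cS yz yw yy'.
  exists (n, (z n, w n)); split=> //.
  by split; [exists y|exists y'].
have mfc l i j : measurable (finite_cell l `&` c i j).
  by apply: measurableI; [exact: measurable_finite_cell|exact: (cell_measurable cS)].
have sQ l : souslin c (Q l).
  apply: souslin_exists => i.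
  have [i0|i0] := pselect (c i.1 i.2.1 `&` c i.1 i.2.2 = set0).
    rewrite (_ : (fun _ => _) = [set x | exists y, G (x, y) /\ (finite_cell l `&` c i.1 i.2.1) y]
      `&` [set x | exists y, G (x, y) /\ (finite_cell l `&` c i.1 i.2.2) y]).
      by apply: souslinI => //; exact: souslin_proj.
    by apply/seteqP; split => x; [case|].
  rewrite (_ : (fun _ => _) = set0); first exact: souslin0.
  by apply/seteqP; split => x // [].
pose dec (n : nat) : seq (nat * nat) := odflt [::] (unpickle n).
pose K n := G `&` ((Q (dec n) `*` setT) `|` [set xy | ~ finite_cell (dec n) xy.2]).
have cSS := prod_cell_system cS cS.
have [n||B [mB KB B0]] := novikov_separation cSS (A := K).
- apply: souslinI => //; first exact: (measurable_souslin cSS).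
  apply: souslinU; first exact: souslin_fst_preimage.
  apply: (measurable_souslin cSS); apply: measurable_not.
  by apply: (@measurable_preimage _ _ _ _ snd) => //; exact: measurable_finite_cell.
- apply/seteqP; split=> // -[x y] xyK.
  have [Gxy _] := xyK 0 I.
  have [l [ly lP]] := isolating_cell y (finG x).
  have [_] := xyK (pickle l) I; rewrite /dec pickleK /=.
  case=> [[[[n [i j]] /= [ij0 [[u [Gu [lu ui]]] [v [Gv [lv vj]]]]]] _]|]; last exact.
  suff : set0 y by [].
  by rewrite -ij0; split; [rewrite -(lP u)|rewrite -(lP v)].
(* An edge of [G] outside [B n] avoids [K n]: its second end lies in the [n]-th finite cell, which
   contains only one neighbour of [x]. Thus [G] minus [B n] is the graph of a partial function. *)
have /choice[phi phiP] n : exists phi : T -> T, measurable_fun setT phi /\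
    forall x y, (G `&` ~` B n) (x, y) -> phi x = y.
  apply: measurable_extension; first exact/measurableI/measurableC.
  move=> x y y' [Gy By] [Gy' By']; apply: contrapT => yy'.
  have nK u : (~` B n) (x, u) -> G (x, u) ->
      finite_cell (dec n) u /\ ~ Q (dec n) x.
    move=> Bu Gu; split.
      by apply: contrapT => nu; apply: Bu; apply: KB; split=> //; right.
    by move=> Qx; apply: Bu; apply: KB; split=> //; left.
  have [ly nQ] := nK _ By Gy; have [ly' _] := nK _ By' Gy'.
  by apply: nQ; exact: (QP _ _ _ _ Gy Gy').
exists (fun n x => if `[< G (x, phi n x) >] then phi n x else x); split.
- move=> n; have [mphi _] := phiP n; apply: measurable_if => //.
  by apply: measurable_preimage2.
- by move=> n x; case: asboolP => ?; [right|left].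
- move=> x y Gxy; have /existsNP[n nB] : ~ forall n, B n (x, y).
    by move=> xyB; suff : set0 (x, y) by []; rewrite -B0 => n _; exact: xyB.
  have [_ phi_n] := phiP n; exists n.
  by rewrite (phi_n _ _ (conj Gxy nB)); case: asboolP.
Qed.

End Uniformization.

(** * Polish spaces have cell systems *)

Section PolishCells.
Import Order.TTheory GRing.Theory Num.Theory.
Context d (X : measurableType d) (R : realType).
Local Open Scope ring_scope.

Lemma small_radius (e : R) : 0 < e -> exists n : nat, n.+1%:R^-1 < e.
Proof.
move=> e0; have [N _ NP] := near_infty_natSinv_lt (PosNum e0).
by exists N; exact: (NP N (leqnn N)).
Qed.

Lemma standard_borel_cells : standard_borel R X ->
  exists c : nat -> nat -> set X, cell_system c.
Proof.
move=> [M [f [[completeM [D cD dD]] [g fK gK] mX]]].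
have [u uP] : exists u : nat -> M, forall x e, 0 < e -> exists n, mdist (u n) x < e.
  have [u uD] : exists u : nat -> M, D `<=` range u.
    have [x0 Dx0] : D !=set0.
      have [||x [_ Dx]] := dD setT; [by exists (f point)|exact: openT|by exists x].
    have /pfcard_geP[D0|[h]] := cD; first by rewrite D0 in Dx0.
    by exists h; have := 'surj_h; rewrite /set_surj.
  exists u => x e e0; have [||y [xy Dy]] := dD (ball x e)°.
  - by exists x; exact: nbhsx_ballx.
  - exact: open_interior.
  - have [n _ ny] := uD _ Dy; exists n; rewrite ny metric_sym.
    by move/interior_subset: xy; rewrite ballEmdist.
pose c i j := [set x | mdist (u j) (f x) <= i.+1%:R^-1].
have tri (x y z : M) : mdist x y <= mdist z x + mdist z y.
  by rewrite (metric_sym z x); exact: metric_triangle.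
(* Cells form a network: inside every ball around [f x] there is a cell containing [x]. This gives
   both generation of the Borel sets and closedness of cells. *)
have sub_ball x e : 0 < e -> exists n l, c n l x /\ forall y, c n l y -> mdist (f x) (f y) < e.
  move=> e0; have e20 : 0 < e / 2 by rewrite divr_gt0.
  have [n ne] := small_radius e20.
  have [l lP] : exists l, mdist (u l) (f x) < n.+1%:R^-1 by apply: uP; rewrite invr_gt0.
  exists n, l; split; first exact: ltW.
  move=> y cy; apply: le_lt_trans (tri _ _ (u l)) _.
  by rewrite (splitr e) ltrD// (le_lt_trans _ ne)// ltW.
have fP (B : set M) : f @` [set x | B (f x)] = B.
  apply/seteqP; split => [_ [x Bx <-//]|y By].
  by exists (g y); rewrite ?gK//= gK.
have radius_gt0 (n : nat) : 0 < n.+1%:R^-1 :> R by rewrite invr_gt0.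
have sC (B : set M) : <<s [set U : set M | open U] >> B ->
    <<s [set U : set M | open U] >> (~` B).
  by case: (smallest_sigma_algebra setT [set U : set M | open U]) => _ h _ /h; rewrite setTD.
exists c; split.
- move=> i j; apply/mX; rewrite [f @` _](fP [set y | mdist (u j) y <= i.+1%:R^-1]).
  rewrite -[X in <<s _ >> X]setCK.
  apply: sC; apply: sub_sigma_algebra => /=.
  rewrite openE => y /= /negP; rewrite -ltNge => yj.
  apply/nbhs_ballP; exists (mdist (u j) y - i.+1%:R^-1) => /=; first by rewrite subr_gt0.
  move=> y'; rewrite ballEmdist /= => yy'; apply/negP; rewrite -ltNge.
  have := tri (u j) y y'; rewrite (metric_sym y') (metric_sym y').
  move: yy' => h1 h2; move: yj h1 h2; set r := _^-1; lra.
- move=> i x; have [j jP] := uP (f x) _ (radius_gt0 i).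
  by exists j; exact: ltW.
- move=> z /choice[x xP]; have cx : cauchy ((f \o x) @ \oo).
    apply: cauchy_exP => e e0; have [n ne] := small_radius e0.
    exists (u (z n)); exists n.+1 => // m /= nm.
    by rewrite ballEmdist /=; apply: le_lt_trans ne; exact: xP.
  have [l xl] := completeM _ cx; exists (g l) => i; rewrite /c /= gK.
  apply/ler_addgt0Pl => e e0.
  have [N _ NP] : \forall n \near \oo, ball l e (f (x n)).
    by apply: xl; exact: nbhsx_ballx.
  have := NP (maxn N i.+1) (leq_maxl _ _); rewrite ballEmdist /= => le_e.
  apply: le_trans (tri _ _ (f (x (maxn N i.+1)))) _.
  rewrite addrC lerD//; first by rewrite metric_sym ltW.
  by rewrite metric_sym; apply: xP; exact: leq_maxr.
- move=> z w p q pz qw pq.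
  (* A point common to the two cells would join [f p] to [f q] through the two centres in four
     steps, each at most one radius long. *)
  have D0 : 0 < mdist (f p) (f q) / 4.
    by rewrite divr_gt0// mdist_gt0; apply/eqP => /(can_inj fK).
  have [n ne] := small_radius D0; exists n; apply/seteqP; split=> // x [xz xw].
  have h1 := tri (f p) (f x) (u (z n)); have h2 := tri (f x) (f q) (u (w n)).
  have h3 := tri (f p) (f q) (f x); rewrite (metric_sym (f x)) in h3.
  have := pz n; have := qw n; move: xz xw ne; rewrite /c /=; set r := n.+1%:R^-1; lra.
- move=> A /mX sA.
  suff /(_ _ sA) : <<s [set U : set M | open U] >> `<=`
      [set U | <<s [set A | exists i j, A = c i j] >> [set x | U (f x)]].
    rewrite /= (_ : [set x | _] = A)//; apply/seteqP; split => [x [y Ay]|x Ax].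
      by move/(can_inj fK) => <-.
    by exists x.
  apply: smallest_sub.
    have sS := smallest_sigma_algebra setT [set A | exists i j, A = c i j].
    split => /=.
    + by case: sS.
    + by move=> B; case: sS => _ + _ => /[apply].
    + by move=> F FP; case: sS => _ _; apply.
  move=> U /= oU.
  rewrite (_ : [set x | _] =
    \bigcup_n (if unpickle n is Some (i, j) then
       if `[< c i j `<=` [set x | U (f x)] >] then c i j else set0 else set0)).
    have [sS0 _ sSU] := smallest_sigma_algebra setT [set A | exists i j, A = c i j].
    apply: sSU => n; case: (unpickle n) => [[i j]|//]; case: asboolP => // _.
    by apply: sub_sigma_algebra; exists i, j.
  apply/seteqP; split => [x Ux|x [n _]].
    have [e /= e0 eU] : nbhs_ball (f x) U by apply/nbhs_ballP; exact: open_nbhs_nbhs.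
    have [n [l [cx clU]]] := sub_ball x _ e0.
    exists (pickle (n, l)) => //; rewrite pickleK; case: asboolP => // -[] y cy.
    by apply: eU; rewrite ballEmdist; exact: clU.
  by case: (unpickle n) => [[i j]|//]; case: asboolP => // + cx; apply.
- move=> i j y /= /negP; rewrite -ltNge => yij.
  have e0 : 0 < mdist (u j) (f y) - i.+1%:R^-1 by rewrite subr_gt0.
  have [n [l [cy clP]]] := sub_ball y _ e0; exists n, l; split=> //.
  apply/seteqP; split=> // x [/clP xl xi].
  have := tri (u j) (f y) (f x); rewrite (metric_sym (f x)) (metric_sym (f x)).
  by move: xi xl; rewrite /c /=; set r := i.+1%:R^-1; lra.
Qed.

End PolishCells.

(** * Bridged graphs *)

Section RelTheory.
Variable T : choiceType.
Implicit Types (E H : set (T * T)) (x y z : T).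

Lemma adjacentP E x y : adjacent E x y <-> E (x, y).
Proof. by rewrite /adjacent inE. Qed.

Lemma Rel_refl E x : Rel E (x, x).
Proof. by exists [::]. Qed.

Lemma Rel_trans E x y z : Rel E (x, y) -> Rel E (y, z) -> Rel E (x, z).
Proof.
move=> [p /= pp px] [q /= qq qy]; exists (p ++ q) => /=.
  by rewrite cat_path pp px.
by rewrite last_cat px.
Qed.

Lemma Rel_edge E x y : E (x, y) -> Rel E (x, y).
Proof. by move=> /adjacentP xy; exists [:: y] => //=; rewrite xy. Qed.

Lemma Rel_invariant E (P : T -> Prop) : (forall x y, E (x, y) -> P x -> P y) ->
  forall x y, Rel E (x, y) -> P x -> P y.
Proof.
move=> PE x y [p /=]; elim: p x => [x _ <-//|z p IH x /= /andP[/adjacentP xz zp] py Px].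
by apply: (IH z) => //; exact: PE Px.
Qed.

Lemma Rel_sym E x y : symmetric_graph E -> Rel E (x, y) -> Rel E (y, x).
Proof.
move=> symE xy; apply: (Rel_invariant (P := fun z => Rel E (z, x)) _ xy).
  by move=> u v /symE vu; apply: Rel_trans; exact: Rel_edge.
exact: Rel_refl.
Qed.

Lemma Rel_rel E E' : (forall x y, E (x, y) -> Rel E' (x, y)) ->
  forall x y, Rel E (x, y) -> Rel E' (x, y).
Proof.
move=> EE' x y xy; apply: (Rel_invariant (P := fun z => Rel E' (x, z)) _ xy).
  by move=> u v /EE' uv; move=> h; exact: Rel_trans uv.
exact: Rel_refl.
Qed.

Lemma Rel_sub E E' x y : E `<=` E' -> Rel E (x, y) -> Rel E' (x, y).
Proof. by move=> EE'; apply: Rel_rel => u v /EE'; exact: Rel_edge. Qed.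

Definition bridged H := forall u v, H (u, v) -> exists K : set T,
  [/\ K u, ~ K v & forall a b, H (a, b) -> K a -> ~ K b -> a = u /\ b = v].

(** A cycle that leaves [K] along [(u, v)] must come back, and by symmetry it can do so only from
    [v] to [u]. So [v] is the last vertex of the cycle as well as the second, which bounds the
    length by 2. *)
Lemma bridged_acyclic H : symmetric_graph H -> bridged H -> acyclic H.
Proof.
move=> symH brH; split=> [x xx|].
  by have [K [? + _]] := brH _ _ xx.
case=> [//|u [//|v p]] /= /andP[/adjacentP uv vp] /andP[].
rewrite inE negb_or => /andP[uv' up] /andP[vp' _].
have [K [Ku Kv KP]] := brH _ _ uv.
have last_v : forall q w, u \notin q -> path (adjacent H) w (rcons q u) ->
    ~ K w -> last w q = v.
  elim=> [w _ /= /andP[/adjacentP wu _] Kw|x q IH w /=].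
    by have [] := KP _ _ (symH _ _ wu) Ku Kw.
  rewrite inE negb_or => /andP[ux uq] /andP[/adjacentP wx xq] Kw.
  have [Kx|Kx] := pselect (K x); last exact: IH.
  have [xu] := KP _ _ (symH _ _ wx) Kx Kw.
  by rewrite xu eqxx in ux.
have := last_v _ _ up vp Kv; case: p {up vp last_v} vp' => // x p vp' /= lv.
by move: vp'; have := mem_last x p; rewrite lv => ->.
Qed.

(** [K] is the component of [u] once the edge is deleted. If [v] were still in it, a simple path
    from [u] to [v] closed by the edge would be a cycle with at least three vertices. *)
Lemma acyclic_bridged H : symmetric_graph H -> acyclic H -> bridged H.
Proof.
move=> symH [irrH cycH] u v uv.
pose H' := [set e | [/\ H e, e <> (u, v) & e <> (v, u)]].
exists [set w | Rel H' (u, w)]; split; first exact: Rel_refl.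
- move=> [p /= pp lp]; move: lp; case/shortenP: pp => q qq uq _ lq.
  have subH : subrel (adjacent H') (adjacent H).
    by move=> a b /adjacentP[? _ _]; exact/adjacentP.
  case: q => [|x [|y q]] in qq uq lq.
  + by move: uv; rewrite /= in lq; rewrite lq => /irrH.
  + by rewrite /= in lq; move: qq; rewrite /= lq andbT => /adjacentP[].
  suff : (size [:: u, x, y & q] <= 2)%N by [].
  apply: cycH => //; rewrite /cycle rcons_path (sub_path subH qq) lq.
  by apply/adjacentP; exact: symH.
- move=> a b ab /= ua ub; have [[<- <-]//|abuv] := pselect ((a, b) = (u, v)).
  exfalso; apply: ub.
  have [[_ ->]|abvu] := pselect ((a, b) = (v, u)); first exact: Rel_refl.
  by apply: Rel_trans ua _; exact: Rel_edge.
Qed.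

End RelTheory.

(** * Contracting the fibres of a retraction *)

Section Contraction.
Variables (Z X : choiceType) (A : set X) (D : set Z) (H : set (Z * Z)).
Variables (rho : X -> Z) (r : Z -> X) (f : Z -> Z) (rank : Z -> nat).
Hypothesis symH : symmetric_graph H.
Hypothesis HD : forall z z', H (z, z') -> D z -> D z'.
Hypothesis rhoD : forall x, A x -> D (rho x).
Hypothesis rA : forall z, D z -> A (r z).
Hypothesis rho_r_rho : forall x, A x -> rho (r (rho x)) = rho x.
Hypothesis rP : forall z, D z -> rho (r z) = z \/
  [/\ H (z, f z), r (f z) = r z & (rank (f z) < rank z)%N].

(* The fibres of r are connected in H.  Contract them, and attach each vertex
   outside the image of r as a leaf. *)
Definition contraction : set (X * X) := [set xy |
  [/\ A xy.1, A xy.2, xy.1 <> xy.2 &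
    [\/ xy.2 = r (rho xy.1), xy.1 = r (rho xy.2) |
      exists z z', [/\ D z, H (z, z'), r z = xy.1 & r z' = xy.2]]]].

Lemma contraction_sym : symmetric_graph contraction.
Proof.
move=> x y [/= Ax Ay xy h]; split=> //=; first exact: nesym.
case: h => [?|?|[z [z' [Dz zz' zx zy]]]]; [exact: Or32|exact: Or31|].
by apply: Or33; exists z', z; split=> //; [exact: HD zz' Dz|exact: symH].
Qed.

(** [f] moves inside a fibre of [r] and lowers [rank], so iterating it ends at a point fixed by
    [rho] after [r]. *)
Lemma fibre_ind (P : Z -> Prop) :
  (forall z, D z -> rho (r z) = z -> P z) ->
  (forall z, D z -> D (f z) -> H (z, f z) -> r (f z) = r z -> P (f z) -> P z) ->
  forall z, D z -> P z.
Proof.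
move=> Pbase Pstep z; have [n] := ubnP (rank z).
elim: n z => // n IH z; rewrite ltnS => zn Dz.
have [/Pbase|[zf rf ff]] := rP Dz; first exact.
have Df := HD zf Dz.
by apply: Pstep => //; apply: IH => //; exact: leq_trans zn.
Qed.

Lemma r_rho_r z : D z -> r (rho (r z)) = r z.
Proof. by elim/fibre_ind => {}z Dz // => [->//|_ _ ->]. Qed.

(** An edge to a leaf is cut off by the leaf itself. An edge coming from an edge [(w, w')] of [H] is
    cut by the preimage under [rho] of the set [K] belonging to [(w, w')]. *)
Lemma contraction_bridged : bridged H -> bridged contraction.
Proof.
move=> brH.
have leaf x b : r (rho x) <> x -> contraction (x, b) -> b = r (rho x).
  move=> rx [/= Ax Ab xb [//|xE|[z [z' [Dz _ zx _]]]]]; exfalso; apply: rx.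
    by rewrite [in rho x]xE rho_r_rho.
  by rewrite -zx r_rho_r.
move=> x y [/= Ax Ay xy [yE|xE|[w [w' [Dw ww' wx wy]]]]].
- exists [set x]; split=> [//|/esym//|a b ab /= ax bx].
  rewrite ax in ab *; split=> //; rewrite yE; apply: leaf ab.
  by rewrite -yE; exact: nesym.
- exists (~` [set y]); split=> // [|a b ab /= ay /contrapT yb]; first by apply.
  rewrite yb in ab *; split=> //; rewrite xE; apply: leaf (contraction_sym ab).
  by rewrite -xE.
- have [K [Kw Kw' KP]] := brH _ _ ww'.
  (* [K] does not split a fibre of [r]: only the edge between [w] and [w'] crosses its border, and
     the ends of that edge have different images [x] and [y]. *)
  have K_r z : D z -> K z <-> K (rho (r z)).
    elim/fibre_ind => {}z Dz; first by move=> ->.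
    move=> _ zf rf IH; rewrite -[in X in _ <-> X]rf -IH.
    have ne : ~ (z = w /\ f z = w') /\ ~ (f z = w /\ z = w').
      by split=> -[zw fw]; apply: xy; rewrite -wx -wy -zw -fw rf.
    split=> Kz; apply: contrapT => nK.
      by apply: ne.1; exact: KP zf Kz nK.
    by apply: ne.2; exact: KP (symH zf) Kz nK.
  exists [set a | K (rho a)]; rewrite /= -wx -wy; split.
  + exact: (K_r _ Dw).1.
  + by move/(K_r _ (HD ww' Dw)).2.
  + move=> a b [/= Aa Ab ab [bE|aE|[v [v' [Dv vv' va vb]]]]] Ka Kb.
    * by case: Kb; rewrite bE rho_r_rho.
    * by case: Kb; rewrite aE rho_r_rho in Ka.
    * have [vw vw'] : v = w /\ v' = w'.
        apply: KP => //; first by apply/(K_r _ Dv); rewrite va.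
        by move/(K_r _ (HD vv' Dv)); rewrite vb.
      by rewrite -va -vb vw vw'.
Qed.

Lemma contraction_Rel x y : A x -> A y -> Rel H (rho x, rho y) ->
  Rel contraction (x, y).
Proof.
move=> Ax Ay xy.
have to_leaf a : A a -> Rel contraction (a, r (rho a)).
  move=> Aa; have [<-|ne] := pselect (a = r (rho a)); first exact: Rel_refl.
  apply: Rel_edge; split=> //=; first by apply: rA; exact: rhoD.
  exact: Or31.
apply: (Rel_trans (to_leaf _ Ax)).
apply: (Rel_trans _ (Rel_sym contraction_sym (to_leaf _ Ay))).
suff : D (rho y) /\ Rel contraction (r (rho x), r (rho y)) by case.
apply: (Rel_invariant
  (P := fun z => D z /\ Rel contraction (r (rho x), r z)) _ xy); last first.
  by split; [exact: rhoD|exact: Rel_refl].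
move=> z z' zz' [Dz xz]; have Dz' := HD zz' Dz; split=> //.
have [<-//|ne] := pselect (r z = r z').
apply: (Rel_trans xz); apply: Rel_edge; split=> //=; [exact: rA|exact: rA|].
by apply: Or33; exists z, z'.
Qed.

End Contraction.

(** * Tree sets *)

Section TreeSet.
Variables (P : choiceType) (C : set P) (le : P -> P -> Prop) (opp : P -> P).

(* For le := sep_le V E and opp := opp_sep E these are convertible to sep_lt,
   predecessor and sep_class. *)
Definition tree_lt s s' := le s s' /\ s <> s'.
Local Notation lt := tree_lt.

Definition tree_pred s s' := [/\ C s, C s', lt s s' &
  ~ exists s'', [/\ C s'', lt s s'' & lt s'' s']].

Definition tree_class s : set P :=
  [set s' | C s' /\ (s = s' \/ tree_pred (opp s) s')].

Record tree_set : Prop := TreeSet {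
  tree_le_refl : forall s, le s s;
  tree_le_trans : forall s s' s'', le s s' -> le s' s'' -> le s s'';
  tree_le_anti : forall s s', C s -> C s' -> le s s' -> le s' s -> s = s';
  tree_oppC : forall s, C s -> C (opp s);
  tree_oppK : forall s, C s -> opp (opp s) = s;
  tree_le_opp : forall s s', C s -> C s' -> le s s' -> le (opp s') (opp s);
  tree_le_oppN : forall s, C s -> ~ le s (opp s);
  tree_nested : forall s s', C s -> C s' ->
    (le s s' \/ le s' s) \/ (le s (opp s') \/ le (opp s') s);
  tree_finite : forall s s', C s -> C s' -> lt s s' ->
    finite_set [set s'' | [/\ C s'', lt s s'' & lt s'' s']] }.

Hypothesis TS : tree_set.
Let le_refl := tree_le_refl TS.
Let le_trans := tree_le_trans TS.
Let le_anti := tree_le_anti TS.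
Let oppC := tree_oppC TS.
Let oppK := tree_oppK TS.
Let le_opp := tree_le_opp TS.
Let le_oppN := tree_le_oppN TS.

Let opp_leN s : C s -> ~ le (opp s) s.
Proof. by move=> Cs; rewrite -[in X in le _ X](oppK Cs); apply: le_oppN; exact: oppC. Qed.

Let le_lt_trans s s' s'' : C s -> C s' -> C s'' -> le s s' -> lt s' s'' -> lt s s''.
Proof.
move=> Cs Cs' Cs'' ss' [ss'' ne]; split; first exact: le_trans ss' ss''.
by move=> E; apply: ne; apply: le_anti => //; rewrite -E.
Qed.

Let lt_le_trans s s' s'' : C s -> C s' -> C s'' -> lt s s' -> le s' s'' -> lt s s''.
Proof.
move=> Cs Cs' Cs'' [ss' ne] ss''; split; first exact: le_trans ss' ss''.
by move=> E; apply: ne; apply: le_anti => //; rewrite E.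
Qed.

Let lt_opp s s' : C s -> C s' -> lt s s' -> lt (opp s') (opp s).
Proof.
move=> Cs Cs' [ss' ne]; split; first exact: le_opp.
by move=> E; apply: ne; rewrite -(oppK Cs) -(oppK Cs') E.
Qed.

Let le_both s s' : C s -> C s' -> le s s' -> ~ le s (opp s').
Proof.
by move=> Cs Cs' ss' so; apply: (le_oppN Cs); apply: (le_trans so); exact: le_opp.
Qed.

Let le_both_opp s s' : C s -> C s' -> le s' s -> ~ le (opp s') s.
Proof.
move=> Cs Cs' ss' so; apply: (opp_leN Cs'); apply: (le_trans so).
by apply: contrapT => h; apply: (opp_leN Cs); apply: le_trans ss';
  rewrite -(oppK Cs'); apply: le_opp => //; exact: oppC.
Qed.

(** Induction on the number of elements strictly between [s] and [s']; splitting at one of them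
    gives two strictly smaller intervals. *)
Lemma tree_lt_ind (R : P -> P -> Prop) :
  (forall s s', tree_pred s s' -> R s s') ->
  (forall s s' s'', C s -> C s' -> C s'' -> lt s s'' -> lt s'' s' ->
     R s s'' -> R s'' s' -> R s s') ->
  forall s s', C s -> C s' -> lt s s' -> R s s'.
Proof.
move=> Rpred Rtrans s s'.
pose I s s' := [set s'' | [/\ C s'', lt s s'' & lt s'' s']].
have [n] := ubnP #|` fset_set (I s s')|.
elim: n s s' => // n IH s s'; rewrite ltnS => card_n Cs Cs' ss'.
have [[s'' [Cs'' ss'' s's'']]|none] := pselect (exists s'', I s s' s''); last first.
  by apply: Rpred; split.
have fI := tree_finite TS Cs Cs' ss'.
have sub a b : C a -> C b -> lt a b -> I a b `<=` I s s' -> ~ I a b s'' ->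
    (#|` fset_set (I a b)| < n)%N.
  move=> Ca Cb ab sub_I nI; apply: leq_trans card_n; apply: fproper_ltn_card.
  have fab := tree_finite TS Ca Cb ab.
  rewrite fproperE; apply/andP; split.
    by apply/fsubsetP => x; rewrite !in_fset_set// !inE; exact: sub_I.
  apply/negP => /fsubsetP/(_ s''); rewrite !in_fset_set// !inE.
  by move=> h; apply: nI; apply: h.
apply: (Rtrans _ _ s'') => //; apply: IH => //; apply: sub => //.
- move=> x [Cx sx xs'']; split=> //.
  by apply: (lt_le_trans _ _ _ xs'') => //; case: s's''.
- by case=> _ _ [].
- move=> x [Cx sx xs'']; split=> //.
  by apply: (lt_le_trans _ _ _ ss'') => //; case: sx.
- by case=> _ [].
Qed.

Let ex_pred s s' : C s -> C s' -> lt s s' -> exists2 s1, tree_pred s1 s' & le s s1.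
Proof.
apply: (@tree_lt_ind (fun s s' => exists2 s1, tree_pred s1 s' & le s s1)).
  by move=> a b ab; exists a.
move=> a b x Ca Cb Cx [ax _] _ _ [s1 s1b xs1].
by exists s1 => //; exact: le_trans xs1.
Qed.

Let ex_succ s s' : C s -> C s' -> lt s s' -> exists2 s1, tree_pred s s1 & le s1 s'.
Proof.
apply: (@tree_lt_ind (fun s s' => exists2 s1, tree_pred s s1 & le s1 s')).
  by move=> a b ab; exists b.
move=> a b x Ca Cb Cx _ [xb _] [s1 as1 s1x] _.
by exists s1 => //; exact: le_trans xb.
Qed.

Let pred_opp s s' : tree_pred s s' -> tree_pred (opp s') (opp s).
Proof.
move=> [Cs Cs' ss' none]; split; [exact: oppC|exact: oppC|exact: lt_opp|].
move=> [w [Cw sw ws]]; apply: none; exists (opp w); split; first exact: oppC.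
  by rewrite -(oppK Cs); apply: lt_opp => //; exact: oppC.
by rewrite -(oppK Cs'); apply: lt_opp => //; exact: oppC.
Qed.

Definition tree_vertices : set (set P) := [set t | exists2 s, C s & t = tree_class s].

(* The edge s points towards the vertex t. *)
Definition points (t : set P) s := exists2 s', t s' & le s' s.

Lemma tree_class_refl s : C s -> tree_class s s.
Proof. by split=> //; left. Qed.

Lemma vertex_sub t s : tree_vertices t -> t s -> C s.
Proof. by move=> [s0 _ ->] []. Qed.

(** The edges pointing at one vertex form a star. When both differ from [s0], nestedness leaves four
    relations: comparability of [s] and [s'] contradicts their minimality above [opp s0], and [s]
    below [opp s'] would put [s] below [s0]. *)
Lemma class_lt s0 s s' : C s0 -> tree_class s0 s -> tree_class s0 s' -> s <> s' ->
  lt (opp s) s'.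
Proof.
move=> C0 [Cs [<-|[_ _ s0s min_s]]] [Cs' [<-//|[_ _ s0s' min_s']]] ne.
- exact: s0s'.
- by rewrite -(oppK C0); apply: lt_opp => //; exact: oppC.
have Co := oppC C0; have Cos := oppC Cs'.
have absurd : le s s0 -> False.
  by move=> ss0; apply: (opp_leN C0); apply: le_trans ss0; case: s0s.
case: (tree_nested TS Cs Cs') => -[h|h].
- by case: min_s'; exists s; split.
- by case: min_s; exists s'; split=> //; split=> // /esym.
- exfalso; apply: absurd; apply: (le_trans h).
  by rewrite -(oppK C0); apply: le_opp => //; case: s0s'.
- have [E|ne'] := pselect (opp s' = s).
    exfalso; apply: absurd; rewrite -E -(oppK C0).
    by apply: le_opp => //; case: s0s'.
  by rewrite -(oppK Cs'); apply: lt_opp.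
Qed.

Lemma class_pred s0 s s' : C s0 -> tree_class s0 s -> tree_class s0 s' -> s <> s' ->
  tree_pred (opp s) s'.
Proof.
move=> C0 ts ts' ne; have ss' := class_lt C0 ts ts' ne.
case: ts ts' => Cs [E|ps] [Cs' [E'|ps']].
- by case: ne; rewrite -E.
- by rewrite -E.
- by rewrite -E' -[X in tree_pred _ X](oppK C0); exact: pred_opp.
split=> //; first exact: oppC.
move=> [w [Cw sw ws']].
have [_ _ s0s min_s] := ps; have [_ _ s0s' min_s'] := ps'.
have Co := oppC C0; have Cos := oppC Cs.
have absurd1 : le s0 s' -> False.
  by move=> h; apply: (le_both_opp Cs' C0 h); case: s0s'.
have absurd2 : le (opp s) (opp s0) -> False.
  move=> h; have := le_opp Cos Co h; rewrite !oppK// => h'.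
  by apply: (le_both_opp Cs C0 h'); case: s0s.
case: (tree_nested TS Cw C0) => -[h|h].
- have [E|ne'] := pselect (w = s0).
    by apply: absurd1; rewrite -E; case: ws'.
  case: min_s; exists (opp w); split; first exact: oppC.
    by apply: lt_opp.
  by rewrite -(oppK Cs); exact: lt_opp.
- by apply: absurd1; apply: le_trans h _; case: ws'.
- by apply: absurd2; apply: le_trans h; case: sw.
- have [E|ne'] := pselect (opp s0 = w).
    by apply: absurd2; rewrite E; case: sw.
  by case: min_s'; exists w.
Qed.

(** This is where symmetry and transitivity of the relation defining the classes are obtained, both
    from [class_pred]. *)
Lemma tree_class_eq s s' : C s -> tree_class s s' -> tree_class s = tree_class s'.
Proof.
move=> Cs ss'; have Cs' : C s' by case: ss'.
have sub a b : C a -> tree_class a b -> tree_class a `<=` tree_class b.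
  move=> Ca ab c ac; split; first by case: ac.
  have [->|ne] := pselect (b = c); first by left.
  by right; exact: class_pred ab ac ne.
apply/seteqP; split; first exact: sub.
apply: (sub _ _ Cs'); apply: (sub _ _ Cs ss'); exact: tree_class_refl.
Qed.

(** With [points_excl], a vertex orients every edge in exactly one way. If [s] or [opp s] is
    strictly below the representative [s0], some predecessor [s1] of [s0] is above it, and [opp s1]
    belongs to the class. *)
Lemma points_total t s : tree_vertices t -> C s -> points t s \/ points t (opp s).
Proof.
move=> [s0 C0 ->] Cs; have t0 := tree_class_refl C0.
have to_class s1 : tree_pred s1 s0 -> tree_class s0 (opp s1).
  by move=> h; have [C1 _ _ _] := h; split; [exact: oppC|right; exact: pred_opp].
case: (tree_nested TS C0 Cs) => -[h|h].
- by left; exists s0.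
- have [E|ne] := pselect (s = s0); first by left; exists s0 => //; rewrite E.
  have [//|s1 p1 ss1] := ex_pred Cs C0; have [C1 _ _ _] := p1.
  by right; exists (opp s1); [exact: to_class|exact: le_opp].
- by right; exists s0.
- have [E|ne] := pselect (opp s = s0); first by right; exists s0 => //; rewrite E.
  have [//|s1 p1 ss1] := ex_pred (oppC Cs) C0; have [C1 _ _ _] := p1.
  left; exists (opp s1); first exact: to_class.
  by rewrite -(oppK Cs); apply: le_opp => //; exact: oppC.
Qed.

Lemma points_excl t s : tree_vertices t -> C s -> points t s -> ~ points t (opp s).
Proof.
move=> tV Cs [s' ts' s's] [s'' ts'' s''s].
have Cs' := vertex_sub tV ts'; have Cs'' := vertex_sub tV ts''.
have [E|ne] := pselect (s' = s''); first by rewrite E in s's; exact: (le_both _ _ s's s''s).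
have [s0 C0 tE] := tV; rewrite tE in ts' ts''.
have [h /nesym] := class_lt C0 ts' ts'' ne; apply.
apply: le_anti => //; first exact: oppC.
by apply: (le_trans s''s); exact: le_opp.
Qed.

Let points_le t s s' : points t s -> le s s' -> points t s'.
Proof. by move=> [a ta as_] ss'; exists a => //; exact: le_trans ss'. Qed.

(** Crossing the edge [s] from one end to the other reverses the orientation of no other edge. *)
Lemma points_edge s s' : C s -> C s' -> s' <> s -> s' <> opp s ->
  points (tree_class s) s' -> points (tree_class (opp s)) s'.
Proof.
move=> Cs Cs' ne neo ps; have Co := oppC Cs.
have ts : tree_vertices (tree_class s) by exists s.
have excl : points (tree_class s) (opp s') -> False by exact: points_excl ts Cs' ps.
case: (tree_nested TS Cs Cs') => -[h|h].
- have [|s1 p1 s1s'] := ex_succ Cs Cs' _; first by split=> //; exact: nesym.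
  exists s1 => //; have [_ C1 _ _] := p1; split=> //.
  by right; rewrite oppK.
- exfalso; apply: excl.
  have [|s1 p1 s1s'] := ex_succ Co (oppC Cs') _; first exact: lt_opp.
  by exists s1 => //; have [_ C1 _ _] := p1; split=> //; right.
- by exfalso; apply: excl; exists s => //; exact: tree_class_refl.
- exists (opp s); first exact: tree_class_refl.
  by rewrite -(oppK Cs'); apply: le_opp => //; exact: oppC.
Qed.

Let class_min t s s' : tree_vertices t -> t s -> t s' -> le s s' -> s = s'.
Proof.
move=> tV ts ts' ss'; apply: contrapT => ne.
have Cs := vertex_sub tV ts; have Cs' := vertex_sub tV ts'.
have [s0 C0 tE] := tV; rewrite tE in ts ts'.
have [h _] := class_lt C0 ts ts' ne.
exact: (le_both_opp Cs' Cs ss').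
Qed.

(** A vertex is determined by its orientation, because its members are the minimal edges pointing to
    it. *)
Lemma points_inj t t' : tree_vertices t -> tree_vertices t' ->
  (forall s, C s -> points t s -> points t' s) -> t = t'.
Proof.
move=> tV tV' tt'.
have t't s : C s -> points t' s -> points t s.
  move=> Cs p; have [//|/(tt' _ (oppC Cs)) q] := points_total tV Cs.
  by exfalso; exact: points_excl tV' Cs p q.
have sub u u' : tree_vertices u -> tree_vertices u' ->
    (forall s, C s -> points u s -> points u' s) ->
    (forall s, C s -> points u' s -> points u s) -> u `<=` u'.
  move=> uV uV' uu' u'u s us; have Cs := vertex_sub uV us.
  have [|s' us' ss'] := uu' _ Cs; first by exists s.
  have Cs' := vertex_sub uV' us'.
  have [|s'' us'' ss''] := u'u _ Cs'; first by exists s'.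
  have E := class_min uV us'' us (le_trans ss'' ss').
  by rewrite (le_anti Cs Cs' _ ss')// -E.
by apply/seteqP; split; exact: sub.
Qed.

(** [s] is the first edge on the way from [t] to [t']; [side_unique] shows that it is the only
    one. *)
Lemma side_exists t t' : tree_vertices t -> tree_vertices t' -> t <> t' ->
  exists2 s, t s & points t' (opp s).
Proof.
move=> tV tV' ne; apply: contrapT => none; apply: ne; apply: points_inj => // s Cs.
move=> [s' ts' s's]; have Cs' := vertex_sub tV ts'.
have [p|p] := points_total tV' Cs'; first exact: points_le s's.
by exfalso; apply: none; exists s'.
Qed.

Lemma side_unique t t' s s' : tree_vertices t -> tree_vertices t' -> t s -> t s' ->
  points t' (opp s) -> points t' (opp s') -> s = s'.
Proof.
move=> tV tV' ts ts' p p'; apply: contrapT => ne.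
have Cs' := vertex_sub tV ts'; have [s0 C0 tE] := tV; rewrite tE in ts ts'.
have [h _] := class_lt C0 ts ts' ne.
by apply: (points_excl tV' Cs' _ p'); exact: points_le p h.
Qed.

(** An interval refines to a chain of predecessors. For a predecessor [s] of [s'], one crosses the
    edge from [s] to [opp s], which lies in the class of [s']. *)
Lemma tree_connected (R : P -> P -> Prop) :
  (forall s, C s -> R s (opp s)) ->
  (forall s s', C s -> C s' -> tree_class s = tree_class s' -> R s s') ->
  (forall s s', R s s' -> R s' s) ->
  (forall s s' s'', R s s' -> R s' s'' -> R s s'') ->
  forall s s', C s -> C s' -> R s s'.
Proof.
move=> Ropp Rcls Rsym Rtrans.
have Rlt s s' : C s -> C s' -> lt s s' -> R s s'.
  apply: tree_lt_ind => {s s'} [s s' ss'|s s' s'' _ _ _ _ _]; last exact: Rtrans.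
  have [Cs Cs' _ _] := ss'; apply: (Rtrans _ (opp s)); first exact: Ropp.
  apply: Rcls => //; first exact: oppC.
  by apply: tree_class_eq; [exact: oppC|split=> //; right; rewrite oppK].
have Rle s s' : C s -> C s' -> le s s' -> R s s'.
  move=> Cs Cs' ss'; have [<-|ne] := pselect (s = s'); last exact: Rlt.
  exact: Rcls.
move=> s s' Cs Cs'; have Co := oppC Cs'.
have Rs' : R (opp s') s' by apply: Rsym; exact: Ropp.
case: (tree_nested TS Cs Cs') => -[h|h].
- exact: Rle.
- by apply: Rsym; exact: Rle.
- by apply: Rtrans Rs'; exact: Rle.
- by apply: Rtrans Rs'; apply: Rsym; exact: Rle.
Qed.

End TreeSet.

(** * Separations of a component *)

Section ComponentSeparations.
Variables (T : choiceType) (E : set (T * T)) (x0 : T) (C : set (sep T)).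
Hypotheses (symE : symmetric_graph E) (finE : locally_finite E).
Local Notation V := (component E x0).
Hypothesis sysC : separation_system V E C.

Lemma component_connected x y : V x -> V y -> Rel E (x, y).
Proof. by move=> x0x; apply: Rel_trans; exact: Rel_sym. Qed.

Lemma component_closed x y : V x -> Rel E (x, y) -> V y.
Proof. exact: Rel_trans. Qed.

Lemma delete_sym (S : {fset T}) : symmetric_graph (delete E S).
Proof. by move=> x y [/= /symE]. Qed.

Lemma Rel_delete (S : {fset T}) x y : Rel (delete E S) (x, y) -> Rel E (x, y).
Proof. by apply: Rel_sub => e []. Qed.

Lemma boundary_finite (S : {fset T}) : finite_set (boundary E S).
Proof.
apply: (@sub_finite_set _ _ (\bigcup_(u in [set` S]) (pair u @` [set y | E (u, y)]))).
  by move=> [u v] [/= uv uS _]; exists u => //; exists v.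
by apply: bigcup_finite => // u _; exact: finite_image.
Qed.

Lemma mem_opp_sep (s : sep T) e :
  e \in (opp_sep E s).2 <-> boundary E s.1 e /\ e \notin s.2.
Proof.
rewrite in_fset_set; last exact: finite_setD (boundary_finite _).
rewrite inE /=; split=> -[be]; last by move=> es; split=> //; exact/negP.
by move=> /= es; split=> //; apply/negP.
Qed.

Lemma sep_vertices s x : C s -> x \in s.1 -> V x.
Proof. by move=> /sysC[[sV _ _] _ _] /sV. Qed.

Lemma sep_edges s e : C s -> e \in s.2 -> boundary E s.1 e.
Proof. by move=> /sysC[[_ sB _] _ _] /sB. Qed.

Lemma sep_opp s : C s -> C (opp_sep E s).
Proof. by move=> /sysC[]. Qed.

Lemma sep_edge_exists s : C s -> exists e, e \in s.2.
Proof. by move=> /sysC[_ [_ [e es] _] _]; exists e. Qed.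

Lemma far_sideN s x : far_side E s x -> x \notin s.1.
Proof. by case. Qed.

Lemma far_side_component s x : C s -> far_side E s x -> V x.
Proof.
move=> Cs [_ [[u v] es ex]]; have [uv uS _] := sep_edges Cs es.
apply: component_closed (sep_vertices Cs uS) _.
exact: Rel_trans (Rel_edge uv) (Rel_delete ex).
Qed.

Lemma far_side_boundary s u v : C s -> boundary E s.1 (u, v) ->
  far_side E s v <-> (u, v) \in s.2.
Proof.
move=> Cs uv; have [_ _ vS] := uv; split=> [[_ [[u' v'] es vv']]|uvs].
  have [[_ _ sP] _ _] := sysC Cs.
  apply: (sP _ _ _ _ uv (sep_edges Cs es)) => //.
  exact: Rel_sym (@delete_sym _) vv'.
by split=> //; exists (u, v) => //; exact: Rel_refl.
Qed.

Lemma reach_boundary (S : {fset T}) x y : Rel E (x, y) -> x \notin S -> y \in S ->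
  exists u v, boundary E S (u, v) /\ Rel (delete E S) (x, v).
Proof.
move=> xy xS yS; apply: contrapT => none.
suff : Rel (delete E S) (x, y) /\ y \notin S by case=> _; rewrite yS.
apply: (Rel_invariant
    (P := fun z => Rel (delete E S) (x, z) /\ z \notin S) _ xy); last first.
  by split=> //; exact: Rel_refl.
move=> a b ab [xa aS]; have bS : b \notin S.
  apply/negP => bS; apply: none; exists b, a; split=> //.
  by split=> //; exact: symE.
by split=> //; apply: (Rel_trans xa); apply: Rel_edge.
Qed.

(** Every component of the graph minus the separator has a boundary edge, by connectedness, and its
    boundary edges are either all in [s.2] or all outside it. *)
Lemma far_side_opp s x : C s ->
  far_side E (opp_sep E s) x <-> [/\ V x, x \notin s.1 & ~ far_side E s x].
Proof.
move=> Cs; have [[_ _ sP] _ _] := sysC Cs; split.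
  move=> fx; have := fx; case=> xS [[u v] /mem_opp_sep[uv uvs] vx].
  split=> //; first exact: far_side_component (sep_opp Cs) fx.
  move=> [_ [[u' v'] es v'x]]; move/negP: uvs; apply.
  apply: (sP _ _ _ _ uv (sep_edges Cs es)) => //.
  exact: Rel_trans vx (Rel_sym (@delete_sym _) v'x).
move=> [Vx xS nfx]; split=> //.
have [e es] := sep_edge_exists Cs; have [_ eS _] := sep_edges Cs es.
have [u [v [uv xv]]] := reach_boundary
  (component_connected Vx (sep_vertices Cs eS)) xS eS.
exists (u, v); last exact: Rel_sym (@delete_sym _) xv.
apply/mem_opp_sep; split=> //; apply/negP => uvs; apply: nfx; split=> //.
by exists (u, v) => //; exact: Rel_sym (@delete_sym _) xv.
Qed.

Lemma side1_opp s : C s -> side1 E (opp_sep E s) = side2 V E s.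
Proof.
move=> Cs; apply/seteqP; split => x.
  case=> [/= xS|/(far_side_opp _ Cs)[]//].
  by split; [exact: sep_vertices xS|move=> /far_sideN; rewrite xS].
move=> [Vx nfx]; have [xS|xS] := boolP (x \in s.1); first by left.
by right; apply/far_side_opp.
Qed.

Lemma side2_opp s : C s -> side2 V E (opp_sep E s) = side1 E s.
Proof.
move=> Cs; apply/seteqP; split => x.
  move=> [Vx nf]; have [xS|xS] := boolP (x \in s.1); first by left.
  by right; apply: contrapT => nfx; apply: nf; apply/far_side_opp.
case=> [/= xS|fx].
  by split; [exact: sep_vertices xS|move=> /far_sideN; rewrite xS].
by split; [exact: far_side_component fx|move=> /(far_side_opp _ Cs)[]].
Qed.

Lemma mem_sides s x : C s -> x \in s.1 <-> side1 E s x /\ side2 V E s x.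
Proof.
move=> Cs; split=> [xS|[[//|fx] [_ /(_ fx)]//]].
by split; [left|split; [exact: sep_vertices xS|move=> /far_sideN; rewrite xS]].
Qed.

Lemma far_side_sides s x : C s -> far_side E s x <-> side1 E s x /\ x \notin s.1.
Proof.
move=> Cs; split=> [fx|[[/= ->//|//]]].
by split; [right|exact: far_sideN fx].
Qed.

(** The separator is the intersection of the two sides, and the chosen edges are the boundary edges
    whose outer end lies in the first side. This gives antisymmetry of [sep_le]. *)
Lemma sep_eq s s' : C s -> C s' -> side1 E s = side1 E s' ->
  side2 V E s = side2 V E s' -> s = s'.
Proof.
move=> Cs Cs' E1 E2.
have S12 : s.1 = s'.1.
  apply/fsetP => x; apply/idP/idP => [/(mem_sides _ Cs)|/(mem_sides _ Cs')] h.
  - by apply/(mem_sides _ Cs'); rewrite -E1 -E2.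
  - by apply/(mem_sides _ Cs); rewrite E1 E2.
have B12 : s.2 = s'.2.
  apply/fsetP => -[u v]; apply/idP/idP => h.
  - have uv := sep_edges Cs h; have uv' := uv; rewrite S12 in uv'.
    apply/(far_side_boundary Cs' uv')/(far_side_sides _ Cs'); rewrite -E1 -S12.
    by apply/(far_side_sides _ Cs)/(far_side_boundary Cs uv).
  - have uv := sep_edges Cs' h; have uv' := uv; rewrite -S12 in uv'.
    apply/(far_side_boundary Cs uv')/(far_side_sides _ Cs); rewrite E1 S12.
    by apply/(far_side_sides _ Cs')/(far_side_boundary Cs' uv).
by rewrite [s]surjective_pairing [s']surjective_pairing S12 B12.
Qed.

Lemma opp_sepK s : C s -> opp_sep E (opp_sep E s) = s.
Proof.
move=> Cs; have Co := sep_opp Cs; apply: sep_eq => //; first exact: sep_opp.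
  by rewrite side1_opp// side2_opp.
by rewrite side2_opp// side1_opp.
Qed.

Lemma sep_le_oppN s : C s -> ~ sep_le V E s (opp_sep E s).
Proof.
move=> Cs [+ _]; rewrite side1_opp// => h.
have [[u v] es] := sep_edge_exists Cs.
have fv : far_side E s v by apply/(far_side_boundary Cs (sep_edges Cs es)).
by have [_] := h v (or_intror fv); apply.
Qed.

Lemma sep_le_opp s s' : C s -> C s' -> sep_le V E s s' ->
  sep_le V E (opp_sep E s') (opp_sep E s).
Proof. by move=> Cs Cs' [h1 h2]; split; rewrite ?side1_opp ?side2_opp. Qed.

Hypotheses (nestC : nested_system V E C) (starC : finite_intervals V E C).

Lemma component_tree_set : tree_set C (sep_le V E) (opp_sep E).
Proof.
split.
- by move=> s; split.
- by move=> s s' s'' [h1 h2] [h1' h2']; split;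
    [exact: subset_trans h1'|exact: subset_trans h2].
- by move=> s s' Cs Cs' [h1 h2] [h1' h2']; apply: sep_eq => //; apply/seteqP.
- exact: sep_opp.
- exact: opp_sepK.
- exact: sep_le_opp.
- exact: sep_le_oppN.
- exact: nestC.
- exact: starC.
Qed.

Lemma part_of_separator s x : C s -> x \in s.1 -> part V E (sep_class V E C s) x.
Proof.
move=> Cs xS; split; first exact: sep_vertices xS.
move=> s' [Cs' [<-|[_ _ [[le1 _] _] _]]]; first by left.
by apply: le1; left.
Qed.

(** Orient [s] towards [t], which keeps its separator. A member [s'] of [t] below it has [x] in its
    first side because [x] is in the part, and in its second side because second sides grow
    downwards. *)
Lemma part_separator t s x : tree_vertices C (sep_le V E) (opp_sep E) t ->
  part V E t x -> C s -> x \in s.1 -> exists2 s', t s' & x \in s'.1.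
Proof.
have TS := component_tree_set.
move=> tV [Vx tx] Cs xS.
have main r : C r -> x \in r.1 -> points (sep_le V E) t r -> exists2 s', t s' & x \in s'.1.
  move=> Cr xr [s' ts' [_ le2]]; exists s' => //.
  apply/(mem_sides _ (vertex_sub tV ts')); split; first exact: tx.
  by apply: le2; have [] := (mem_sides x Cr).1 xr.
have [p|p] := points_total TS tV Cs; first exact: main p.
by apply: main p => //; exact: sep_opp.
Qed.

(** A point common to two different parts lies on both sides of the edge leading from [t] to [t'],
    hence in its separator. *)
Lemma part_inj t t' x : tree_vertices C (sep_le V E) (opp_sep E) t ->
  tree_vertices C (sep_le V E) (opp_sep E) t' ->
  part V E t x -> part V E t' x -> (forall s, C s -> x \notin s.1) -> t = t'.
Proof.
have TS := component_tree_set.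
move=> tV tV' [Vx tx] [_ tx'] nx; apply: contrapT => ne.
have [s ts [s' ts' [le1 _]]] := side_exists TS tV tV' ne.
have Cs := vertex_sub tV ts.
suff : x \in s.1 by move=> xs; have := nx _ Cs; rewrite xs.
apply/(mem_sides _ Cs); split; first exact: tx.
by rewrite -side1_opp//; apply: le1; exact: tx'.
Qed.

End ComponentSeparations.

(** * Borel enumeration of components *)

Section Separated.
Context d (T : measurableType d) (I : countType) (D : I -> set T).
Hypotheses (mD : forall i, measurable (D i))
  (sepD : forall x y, (forall i, D i x <-> D i y) -> x = y).

Lemma measurable_eq d' (W : measurableType d') (f g : W -> T) :
  measurable_fun setT f -> measurable_fun setT g ->
  measurable [set w | f w = g w].
Proof.
move=> mf mg; rewrite (_ : mkset _ = [set w | forall i, D i (f w) <-> D i (g w)]).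
  apply: measurable_forall => i.
  by apply: measurable_iff; exact: measurable_preimage.
by apply/seteqP; split => w /=; [move=> ->|exact: sepD].
Qed.

End Separated.

Section CellConsequences.
Context d (T : measurableType d) (c : nat -> nat -> set T).
Hypothesis cS : cell_system c.

Lemma cell_sep (x y : T) : (forall ij : nat * nat, c ij.1 ij.2 x <-> c ij.1 ij.2 y) -> x = y.
Proof.
move=> xy; apply: contrapT => /(cell_point_separated cS)[i [j [xij yij]]].
by apply: yij; apply/(xy (i, j)).
Qed.

Lemma measurable_cell_eq d' (W : measurableType d') (f g : W -> T) :
  measurable_fun setT f -> measurable_fun setT g ->
  measurable [set w | f w = g w].
Proof.
apply: (measurable_eq (D := fun ij : nat * nat => c ij.1 ij.2)); last exact: cell_sep.
by move=> ij; exact: (cell_measurable cS).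
Qed.

(** A countable family of Borel sets separating the finite subsets: an isolating cell around a point
    of one set misses a set without that point. Equality of finite sets is Borel as a
    consequence. *)
Let hits (l : seq (nat * nat)) : set {fset T} :=
  [set S | exists2 x, x \in S & finite_cell c l x].

Let measurable_hits l : measurable (hits l).
Proof.
move=> n; rewrite (_ : mkset _ =
    [set t : n.-tuple T | exists i : 'I_n, finite_cell c l (tnth t i)]).
  apply: measurable_exists => i.
  apply: (@measurable_preimage _ _ _ _ (fun t : n.-tuple T => tnth t i)).
    exact: measurable_tnth.
  exact: (measurable_finite_cell cS).
apply/seteqP; split => t [].
  by move=> x; rewrite !inE => /tnthP[i ->]; exists i.
by move=> i ti; exists (tnth t i); rewrite ?inE ?mem_tnth.
Qed.

Let hits_sep S S' : (forall l, hits l S <-> hits l S') -> S = S'.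
Proof.
move=> SS'; suff sub A B : (forall l, hits l A -> hits l B) -> {subset A <= B}.
  by apply/fsetP => x; apply/idP/idP; apply: sub => l /SS'.
move=> AB x xA; apply: contrapT => xB.
have [|l [lx lP]] := isolating_cell cS x (F := [set` B]); first exact: finite_fset.
have [|y yB ly] := AB l; first by exists x.
by apply: xB; rewrite -(lP _ yB ly).
Qed.

Lemma measurable_fset_eq d' (W : measurableType d') (f g : W -> {fset T}) :
  measurable_fun setT f -> measurable_fun setT g ->
  measurable [set w | f w = g w].
Proof.
apply: (measurable_eq (D := hits)); [exact: measurable_hits|exact: hits_sep].
Qed.

Lemma measurable_fset_seq d' (W : measurableType d') (I : eqType)
    (F : I -> W -> T) (s : seq I) : (forall i, measurable_fun setT (F i)) ->
  measurable_fun setT (fun w => [fset x in [seq F i w | i <- s]]%fset).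
Proof.
move=> mF; apply: measurable_funT => A mA.
have := mA (size s); pose t w : (size s).-tuple T := map_tuple (F^~ w) (in_tuple s).
apply: (@measurable_preimage _ _ _ _ t).
apply/measurable_fun_tnthP => i; rewrite (_ : _ \o _ = F (tnth (in_tuple s) i))//.
by apply/funext => w /=; rewrite tnth_map.
Qed.

(** Lexicographic comparison of the membership sequences in the enumerated cells, membership coming
    first: a Borel linear order. *)
Definition cell_prec (x y : T) := exists n,
  [/\ forall m, (m < n)%N -> c (decode_pair m).1 (decode_pair m).2 x <->
        c (decode_pair m).1 (decode_pair m).2 y,
      c (decode_pair n).1 (decode_pair n).2 x &
      ~ c (decode_pair n).1 (decode_pair n).2 y].

Lemma cell_prec_irr x : ~ cell_prec x x.
Proof. by move=> [n []]. Qed.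

Lemma cell_prec_trans x y z : cell_prec x y -> cell_prec y z -> cell_prec x z.
Proof.
move=> [n [xyn xn yn]] [m [yzm ym zm]].
have [nm|mn|E] := ltngtP n m.
- exists n; split=> //; last by move=> /(yzm _ nm).
  by move=> k kn; rewrite (xyn _ kn); apply: yzm; exact: ltn_trans nm.
- exists m; split=> //; last by apply/(xyn _ mn).
  by move=> k km; rewrite -(yzm _ km); apply: xyn; exact: ltn_trans mn.
- by rewrite E in yn.
Qed.

Lemma cell_prec_total x y : x <> y -> cell_prec x y \/ cell_prec y x.
Proof.
move=> xy; pose D n := c (decode_pair n).1 (decode_pair n).2.
have ex : exists n, `[< ~ (D n x <-> D n y) >].
  apply: contrapT => none; apply: xy; apply: cell_sep => ij.
  apply: contrapT => h; apply: none; exists (pickle ij); apply/asboolP.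
  by rewrite /D decode_pairK.
case: (ex_minnP ex) => n /asboolP nP nmin.
have agree m : (m < n)%N -> D m x <-> D m y.
  move=> mn; apply: contrapT => h.
  by have := nmin m; rewrite leqNgt mn; move/(_ (asboolT h)).
have [xn|xn] := pselect (D n x); have [yn|yn] := pselect (D n y).
- by case: nP.
- by left; exists n.
- by right; exists n; split=> // m /agree h; exact: iff_sym.
- by case: nP.
Qed.

Lemma cell_prec_min (s : seq T) : s <> [::] ->
  exists2 x, x \in s & forall y, y \in s -> ~ cell_prec y x.
Proof.
elim: s => // a s IH _; have [->|/eqP/IH[m ms mP]] := eqVneq s [::].
  by exists a; rewrite ?mem_head// => y; rewrite inE => /eqP ->; exact: cell_prec_irr.
have [am|am] := pselect (cell_prec a m).
  exists a; rewrite ?mem_head// => y; rewrite inE => /predU1P[->|ys ya].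
    exact: cell_prec_irr.
  exact: mP ys (cell_prec_trans ya am).
exists m; first by rewrite inE ms orbT.
by move=> y; rewrite inE => /predU1P[->//|]; exact: mP.
Qed.

Definition least_in (S : {fset T}) x := x \in S /\ forall y, y \in S -> ~ cell_prec y x.

Lemma least_in_exists S x : x \in S -> exists y, least_in S y.
Proof.
move=> xS; have [|y yS yP] := @cell_prec_min (enum_fset S); last by exists y.
by move=> S0; move: xS; rewrite -[x \in S]/(x \in enum_fset S) S0.
Qed.

Lemma least_in_unique S x y : least_in S x -> least_in S y -> x = y.
Proof.
move=> [xS xP] [yS yP]; apply: contrapT => /cell_prec_total[].
  exact: yP.
exact: xP.
Qed.

Lemma measurable_cell_prec d' (W : measurableType d') (f g : W -> T) :
  measurable_fun setT f -> measurable_fun setT g ->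
  measurable [set w | cell_prec (f w) (g w)].
Proof.
move=> mf mg.
have mD n (h : W -> T) : measurable_fun setT h ->
    measurable [set w | c (decode_pair n).1 (decode_pair n).2 (h w)].
  by move=> mh; apply: measurable_preimage mh _; exact: (cell_measurable cS).
apply: measurable_exists => n; rewrite (_ : mkset _ = [set w |
  (forall m, (m < n)%N -> c (decode_pair m).1 (decode_pair m).2 (f w) <->
        c (decode_pair m).1 (decode_pair m).2 (g w)) /\
  (c (decode_pair n).1 (decode_pair n).2 (f w) /\
   ~ c (decode_pair n).1 (decode_pair n).2 (g w))]).
  apply: measurable_and; last by apply: measurable_and; [exact: mD|exact/measurable_not/mD].
  apply: measurable_forall => m; apply: measurable_imply; first exact: measurable_cstP.
  by apply: measurable_iff; exact: mD.
by apply/seteqP; split => w [h]; [split|case].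
Qed.

Lemma component_enumeration (G : set (T * T)) : measurable G -> locally_finite G ->
  exists phi : nat -> T -> T, [/\ forall n, measurable_fun setT (phi n),
    forall x, phi 0 x = x & forall x y, Rel G (x, y) <-> exists n, phi n x = y].
Proof.
move=> mG finG; have [psi [mpsi psiG Gpsi]] := lusin_novikov cS mG finG.
pose walk (l : seq nat) x := foldl (fun y k => psi k y) x l.
have mwalk l : measurable_fun setT (walk l).
  elim: l => [|k l IH]; first exact: measurable_id.
  exact: (measurableT_comp IH (mpsi k)).
pose dec (n : nat) : seq nat := odflt [::] (unpickle n).
have decK l : dec (pickle l) = l by rewrite /dec pickleK.
(* Positive indices code finite compositions of the functions [psi k]; index 0 is kept for the
   identity, so that [x] itself occurs as [phi 0 x]. *)
exists (fun n => if n is m.+1 then walk (dec m) else id); split=> //.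
  by move=> [|n] //; exact: measurable_id.
move=> x y; split.
  move=> [p /= pp <-]; suff [l lP] : exists l, walk l x = last x p.
    by exists (pickle l).+1; rewrite decK.
  elim: p x pp => [x _|z p IH x /= /andP[/adjacentP/Gpsi[k kP] zp]]; first by exists [::].
  by have [l lP] := IH _ zp; exists (k :: l); rewrite /= kP.
move=> [[|n] <-]; first exact: Rel_refl.
elim: (dec n) x => [x|k l IH x]; first exact: Rel_refl.
apply: Rel_trans (IH _).
by have [->|h] := psiG k x; [exact: Rel_refl|exact: Rel_edge].
Qed.

End CellConsequences.

(** * The space Z *)

Section Coding.
Context d (X : measurableType d) (G : set (X * X)) (C : set (sep X)).
Hypotheses (hG : locally_finite_borel_graph G) (hC : borel_separation_system G C).
Hypotheses (nestedC : nested_in_components G C) (starC : star_in_components G C).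
Variables (c : nat -> nat -> set X) (phi : nat -> X -> X).
Hypotheses (cS : cell_system c) (mphi : forall n, measurable_fun setT (phi n)).
Hypotheses (phi0 : forall x, phi 0 x = x)
  (phiP : forall x y, Rel G (x, y) <-> exists n, phi n x = y).
Local Notation comp := (component G).
Local Notation loc := (local_system G C).

Let mG : measurable G. Proof. by case: hG. Qed.
Let symG : symmetric_graph G. Proof. by case: hG. Qed.
Let finG : locally_finite G. Proof. by case: hG. Qed.
Let sysC x : separation_system (comp x) G (loc x). Proof. by case: hC. Qed.

Let measurable_ext (P Q : X -> Prop) : (forall x, P x <-> Q x) ->
  measurable [set x | Q x] -> measurable [set x | P x].
Proof. by move=> PQ; congr measurable; apply/seteqP; split => x /PQ. Qed.

Lemma component_eq x y : Rel G (x, y) -> comp x = comp y.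
Proof.
move=> xy; apply/seteqP; split => z; last exact: Rel_trans.
by apply: Rel_trans; exact: Rel_sym.
Qed.

Lemma local_system_eq x y : Rel G (x, y) -> loc x = loc y.
Proof. by move=> xy; rewrite /local_system (component_eq xy). Qed.

Lemma class_at_eq x y s : Rel G (x, y) -> class_at G C x s = class_at G C y s.
Proof. by move=> xy; rewrite /class_at (local_system_eq xy) (component_eq xy). Qed.

Lemma tree_set_at x : tree_set (loc x) (sep_le (comp x) G) (opp_sep G).
Proof. exact: component_tree_set. Qed.

Lemma component_phi x i : comp x (phi i x).
Proof. by apply/phiP; exists i. Qed.

(** Indices, relative to a base point [x], of the vertices and edges of a separation in the
    component of [x]. Quantifiers over such separations become countable. *)
Definition sep_code := (seq nat * seq (nat * nat))%type.

Definition coded_sep (k : sep_code) x : sep X :=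
  ([fset y in [seq phi i x | i <- k.1]]%fset,
   [fset e in [seq (phi p.1 x, phi p.2 x) | p <- k.2]]%fset).
Local Notation cs := coded_sep.

Lemma mem_coded1 k x y : y \in (cs k x).1 <-> exists2 i, i \in k.1 & phi i x = y.
Proof.
by rewrite inE; split=> [/mapP[i ik ->]|[i ik <-]]; [exists i|exact: map_f].
Qed.

Lemma mem_coded2 k x e :
  e \in (cs k x).2 <-> exists2 p, p \in k.2 & (phi p.1 x, phi p.2 x) = e.
Proof.
rewrite inE; split=> [/mapP[p pk ->]|[p pk <-]]; first by exists p.
exact: (map_f (fun p => (phi p.1 x, phi p.2 x))).
Qed.

Lemma coded_local k x : loc x (cs k x) <-> C (cs k x).
Proof.
split=> [[]//|Ck]; split=> // y /mem_coded1[i _ <-]; exact: component_phi.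
Qed.

Lemma local_coded x s : loc x s -> exists k, cs k x = s.
Proof.
move=> ls; have [ix ixP] : exists ix : X -> nat, forall y, comp x y -> phi (ix y) x = y.
  have /choice[ix ixP] y : exists i, comp x y -> phi i x = y.
    by have [/phiP[i <-]|] := pselect (comp x y); [exists i|exists 0].
  by exists ix.
exists ([seq ix y | y <- enum_fset s.1],
  [seq (ix e.1, ix e.2) | e <- enum_fset s.2]).
have s1 y : y \in s.1 -> phi (ix y) x = y.
  by move=> ys; apply: ixP; exact: (sep_vertices (@sysC x) ls ys).
have s2 e : e \in s.2 -> (phi (ix e.1) x, phi (ix e.2) x) = e.
  move=> es; have [eE eS _] := sep_edges (@sysC x) ls es.
  have e1 := sep_vertices (@sysC x) ls eS.
  rewrite !ixP -?surjective_pairing//; apply: Rel_trans e1 _.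
  by apply: Rel_edge; rewrite -surjective_pairing.
rewrite [RHS]surjective_pairing; congr pair; apply/fsetP => y; apply/idP/idP.
- by move=> /mem_coded1[i /= /mapP[z zs ->]]; rewrite s1// => <-.
- by move=> ys; apply/mem_coded1; exists (ix y); [exact: map_f|exact: s1].
- by move=> /mem_coded2[p /= /mapP[z zs ->]] /=; rewrite s2// => <-.
- move=> ys; apply/mem_coded2; exists (ix y.1, ix y.2); last exact: s2.
  exact: (map_f (fun e => (ix e.1, ix e.2))).
Qed.

Lemma measurable_coded_sep k :
  measurable_fun setT (cs k : X -> ({fset X} * {fset X * X})%type).
Proof.
apply: measurable_fun_pair.
  exact: (measurable_fset_seq (F := phi)).
apply: (measurable_fset_seq (F := fun p x => (phi p.1 x, phi p.2 x))) => p.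
exact: measurable_fun_pair.
Qed.

Lemma measurable_sep_eq d' (W : measurableType d')
    (f g : W -> ({fset X} * {fset X * X})%type) :
  measurable_fun setT f -> measurable_fun setT g ->
  measurable [set w | f w = g w].
Proof.
move=> mf mg; have [mf1 mf2] := (measurable_fun_pairP f).1 mf.
have [mg1 mg2] := (measurable_fun_pairP g).1 mg.
rewrite (_ : mkset _ = [set w | (f w).1 = (g w).1 /\ (f w).2 = (g w).2]).
  apply: measurable_and; first exact: (measurable_fset_eq cS).
  exact: (measurable_fset_eq (prod_cell_system cS cS)).
apply/seteqP; split => w /=; first by move=> ->.
by move=> [E1 E2]; rewrite [LHS]surjective_pairing E1 E2 -surjective_pairing.
Qed.

Lemma measurable_coded k : measurable [set x | C (cs k x)].
Proof.
have [mC _ _] := hC.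
exact: (measurable_preimage (measurable_coded_sep k) mC).
Qed.

Let m_phi_eq i j : measurable [set x | phi i x = phi j x].
Proof. exact: (measurable_cell_eq cS). Qed.

Let m_G i j : measurable [set x | G (phi i x, phi j x)].
Proof. exact: measurable_preimage2. Qed.

Let m_mem k i : measurable [set x | phi i x \in (cs k x).1].
Proof.
apply: measurable_ext (fun x => mem_coded1 k x (phi i x)) _.
by apply: measurable_exists2 => j; [exact: measurable_cstP|exact: m_phi_eq].
Qed.

Let m_nmem k i : measurable [set x | phi i x \notin (cs k x).1].
Proof. by apply: measurable_ext (measurable_not (m_mem k i)) => x; split=> /negP. Qed.

Let m_edge k i j : measurable [set x | (phi i x, phi j x) \in (cs k x).2].
Proof.
apply: (measurable_ext (Q := fun x => exists2 p, p \in k.2 &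
    phi p.1 x = phi i x /\ phi p.2 x = phi j x)).
  move=> x; rewrite mem_coded2; split=> -[p pk]; first by case=> ? ?; exists p.
  by case=> h1 h2; exists p => //; rewrite h1 h2.
by apply: measurable_exists2 => p; [exact: measurable_cstP|exact: measurable_and].
Qed.

Let m_delete k i j : measurable [set x | delete G (cs k x).1 (phi i x, phi j x)].
Proof.
apply: (measurable_ext (Q := fun x => G (phi i x, phi j x) /\
    (phi i x \notin (cs k x).1 /\ phi j x \notin (cs k x).1))).
  by move=> x; split=> [[]|[? []]].
by apply: measurable_and => //; exact: measurable_and.
Qed.

Let m_boundary k i j : measurable [set x | boundary G (cs k x).1 (phi i x, phi j x)].
Proof.
apply: (measurable_ext (Q := fun x => G (phi i x, phi j x) /\
    (phi i x \in (cs k x).1 /\ phi j x \notin (cs k x).1))).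
  by move=> x; split=> [[]|[? []]].
by apply: measurable_and => //; exact: measurable_and.
Qed.

(** Reachability is the existence of a walk of some length [n]. As [D x] is inside [G], the walk
    stays in the component of [x], where every vertex is some [phi k x]. *)
Let m_Rel (D : X -> set (X * X)) : (forall x, D x `<=` G) ->
  (forall i j, measurable [set x | D x (phi i x, phi j x)]) ->
  forall i j, measurable [set x | Rel (D x) (phi i x, phi j x)].
Proof.
move=> DG mD i j; pose walk := fix walk n x a b := if n is m.+1
  then exists k, D x (a, phi k x) /\ walk m x (phi k x) b else a = b.
apply: (measurable_ext (Q := fun x => exists n, walk n x (phi i x) (phi j x))).
  move=> x; split=> [[p /= pp <-]|[n]]; last first.
    elim: n (phi i x) => [a /= ->|n IH a /= [k [ak /IH]]]; first exact: Rel_refl.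
    by apply: Rel_trans; exact: Rel_edge.
  exists (size p); have := component_phi x i.
  elim: p (phi i x) pp => [//|b p IH a /= /andP[/adjacentP ab bp] xa].
  have xb : comp x b by apply: Rel_trans xa _; apply/Rel_edge/DG; exact: ab.
  by have [k kb] := (phiP x b).1 xb; exists k; rewrite kb; split=> //; exact: IH.
apply: measurable_exists => n; elim: n i => [i|n IH i]; first exact: m_phi_eq.
by apply: measurable_exists => k; exact: measurable_and.
Qed.

Let m_far k i : measurable [set x | far_side G (cs k x) (phi i x)].
Proof.
apply: (measurable_ext (Q := fun x => phi i x \notin (cs k x).1 /\
  exists ab : nat * nat, (phi ab.1 x, phi ab.2 x) \in (cs k x).2 /\
    Rel (delete G (cs k x).1) (phi ab.2 x, phi i x))).
  move=> x; split=> -[nx]; last by case=> [[a b] [? ?]]; split=> //; exists (phi a x, phi b x).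
  by case=> e es; case/mem_coded2: (es) => p _ pe ex; split=> //; exists p; rewrite pe -[in X in Rel _ (X, _)]/(phi p.1 x, phi p.2 x).2 pe.
apply: measurable_and => //; apply: measurable_exists => ab.
apply: measurable_and => //; apply: m_Rel; last exact: m_delete.
by move=> x e [].
Qed.

Let far_comp k x y : far_side G (cs k x) y -> comp x y.
Proof.
move=> [_ [e /mem_coded2[p _ <-] /Rel_delete]].
exact: Rel_trans (component_phi _ _).
Qed.

Let side1_comp k x y : side1 G (cs k x) y -> comp x y.
Proof. by case=> [/mem_coded1[i _ <-]|/far_comp//]; exact: component_phi. Qed.

Let m_side1 k i : measurable [set x | side1 G (cs k x) (phi i x)].
Proof. exact: measurable_or (m_mem k i) (m_far k i). Qed.

Let m_side2 k i : measurable [set x | side2 (comp x) G (cs k x) (phi i x)].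
Proof.
apply: (measurable_ext (Q := fun x => ~ far_side G (cs k x) (phi i x))).
  by move=> x; split=> [[]|h] //; split=> //; exact: component_phi.
exact: measurable_not.
Qed.

Let m_le k l : measurable [set x | sep_le (comp x) G (cs k x) (cs l x)].
Proof.
apply: (measurable_ext (Q := fun x =>
  (forall i, side1 G (cs k x) (phi i x) -> side1 G (cs l x) (phi i x)) /\
  (forall i, side2 (comp x) G (cs l x) (phi i x) ->
     side2 (comp x) G (cs k x) (phi i x)))).
  move=> x; split=> [[h1 h2]|[h1 h2]]; first by split=> i; [exact: h1|exact: h2].
  split=> y hy.
    by move: (hy); have /phiP[i <-] := side1_comp hy; exact: h1.
  by move: (hy); have [/phiP[i <-] _] := hy; exact: h2.
by apply: measurable_and; apply: measurable_forall => i; exact: measurable_imply.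
Qed.

Let m_eq k l : measurable [set x | cs k x = cs l x].
Proof. by apply: measurable_sep_eq; exact: measurable_coded_sep. Qed.

Let m_lt k l : measurable [set x | sep_lt (comp x) G (cs k x) (cs l x)].
Proof. by apply: measurable_and => //; exact: measurable_not. Qed.

Lemma measurable_coded_opp k l : measurable [set x | cs l x = opp_sep G (cs k x)].
Proof.
apply: (measurable_ext (Q := fun x => (cs l x).1 = (cs k x).1 /\
  forall ij : nat * nat, (phi ij.1 x, phi ij.2 x) \in (cs l x).2 <->
    boundary G (cs k x).1 (phi ij.1 x, phi ij.2 x) /\
    ~ ((phi ij.1 x, phi ij.2 x) \in (cs k x).2))).
  move=> x; split=> [->|[E1 E2]].
    split=> // ij; rewrite mem_opp_sep//.
    by split=> -[b] /negP.
  rewrite [LHS]surjective_pairing E1; congr pair; apply/fsetP => e; apply/idP/idP.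
    move=> es; apply/mem_opp_sep => //.
    have [p _ pe] := (mem_coded2 _ _ _).1 es; move: es; rewrite -pe => /E2[? ?].
    by split=> //; apply/negP.
  move=> /mem_opp_sep-/(_ finG); case: e => u v [b nb].
  have [uv uS _] := b.
  have [i _ iu] := (mem_coded1 _ _ _).1 uS.
  have [j jv] : exists j, phi j x = v.
    by apply/phiP; apply: Rel_trans (Rel_edge uv); apply/phiP; by exists i.
  rewrite /= in iu; rewrite -iu -jv; apply/(E2 (i, j)); rewrite /= iu jv.
  by split=> //; exact/negP.
apply: measurable_and.
  apply: (measurable_fset_eq cS).
    exact: ((measurable_fun_pairP _).1 (measurable_coded_sep l)).1.
  exact: ((measurable_fun_pairP _).1 (measurable_coded_sep k)).1.
apply: measurable_forall => ij; apply: measurable_iff => //.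
by apply: measurable_and => //; exact: measurable_not.
Qed.

Lemma measurable_least k : measurable [set x | least_in c (cs k x).1 x].
Proof.
apply: (measurable_ext (Q := fun x => phi 0 x \in (cs k x).1 /\
    forall i, phi i x \in (cs k x).1 -> ~ cell_prec c (phi i x) (phi 0 x))).
  move=> x; rewrite phi0; split=> -[xS xP]; split=> //; first by move=> i; exact: xP.
  by move=> y /[dup] /mem_coded1[i _ <-]; exact: xP.
apply: measurable_and => //; apply: measurable_forall => i.
by apply: measurable_imply => //; apply: measurable_not; exact: measurable_cell_prec.
Qed.

Let m_pred k l : measurable [set x |
  predecessor (comp x) G (loc x) (cs k x) (cs l x)].
Proof.
apply: (measurable_ext (Q := fun x => (C (cs k x) /\ C (cs l x)) /\
  (sep_lt (comp x) G (cs k x) (cs l x) /\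
   ~ exists m, C (cs m x) /\ (sep_lt (comp x) G (cs k x) (cs m x) /\
       sep_lt (comp x) G (cs m x) (cs l x))))).
  move=> x; split.
    move=> [/coded_local Ck /coded_local Cl kl none]; split=> //; split=> //.
    by move=> [m [Cm [km ml]]]; apply: none; exists (cs m x); split=> //; exact/coded_local.
  move=> [[Ck Cl] [kl none]]; split=> //; [exact/coded_local|exact/coded_local|].
  move=> [s [ls ks sl]]; have [m ms] := local_coded ls.
  by apply: none; exists m; rewrite ms; split=> //; case: ls.
apply: measurable_and; first by apply: measurable_and; exact: measurable_coded.
apply: measurable_and => //; apply: measurable_not; apply: measurable_exists => m.
by apply: measurable_and; [exact: measurable_coded|exact: measurable_and].
Qed.

Lemma measurable_class k l : measurable [set x | class_at G C x (cs k x) (cs l x)].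
Proof.
apply: (measurable_ext (Q := fun x => C (cs l x) /\ (cs k x = cs l x \/
  exists m, cs m x = opp_sep G (cs k x) /\
    predecessor (comp x) G (loc x) (cs m x) (cs l x)))).
  move=> x; split.
    move=> [/coded_local Cl [|p]]; first by split=> //; left.
    split=> //; right; have [lo _ _ _] := p; have [m mo] := local_coded lo.
    by exists m; rewrite mo.
  move=> [Cl h]; split; first exact/coded_local.
  by case: h => [|[m [mo p]]]; [left|right; rewrite -mo].
apply: measurable_and; first exact: measurable_coded.
apply: measurable_or => //; apply: measurable_exists => m.
by apply: measurable_and => //; exact: measurable_coded_opp.
Qed.

Definition code_at k x := C (cs k x) /\ x \in (cs k x).1.

Lemma measurable_code_at k : measurable [set x | code_at k x].
Proof.
apply: measurable_and; first exact: measurable_coded.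
by apply: measurable_ext (m_mem k 0) => x; rewrite phi0.
Qed.

Lemma code_at_local k x : code_at k x -> loc x (cs k x).
Proof. by case=> Ck _; exact/coded_local. Qed.

Lemma local_of_mem s x : C s -> x \in s.1 -> loc x s.
Proof.
move=> Cs xS; split=> // y yS; have [_ /(_ _ Cs)[x' [sV _ _]] _] := hC.
exact: Rel_trans (Rel_sym symG (sV _ xS)) (sV _ yS).
Qed.

Lemma code_at_exists s x : C s -> x \in s.1 -> exists2 k, code_at k x & cs k x = s.
Proof.
move=> Cs xS; have [k ks] := local_coded (local_of_mem Cs xS).
by exists k => //; rewrite /code_at ks.
Qed.

Lemma measurable_Uset : measurable (Uset G C).
Proof.
apply: (measurable_ext (P := Uset G C) (Q := fun x =>
  (forall k, C (cs k x) -> ~ (phi 0 x \in (cs k x).1)) /\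
  ((forall k, ~ C (cs k x)) \/ exists k, C (cs k x) /\
     forall l, class_at G C x (cs k x) (cs l x) -> side1 G (cs l x) (phi 0 x)))).
  move=> x; rewrite phi0; split.
    move=> [nx [t [/= tV [_ tx]]]]; split; first by move=> k /nx/negP.
    case: tV => [[s ls tE]|[C0 _]]; last first.
      by left=> k /coded_local; rewrite C0.
    right; have [k ks] := local_coded ls; exists k; split; first by rewrite ks; case: ls.
    by move=> l; rewrite ks => h; apply: tx; rewrite tE.
  move=> [nx h]; split.
    by move=> s Cs; apply/negP => /(code_at_exists Cs)[k [Ck kx] _]; exact: nx kx.
  case: h => [none|[k [Ck kP]]].
    exists set0; split=> /=; last by split; [exact: Rel_refl|move=> s []].
    right; split=> //; apply/seteqP; split=> // s ls.
    by have [k ks] := local_coded ls; apply: (none k); rewrite ks; case: ls.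
  exists (class_at G C x (cs k x)); split=> /=.
    by left; exists (cs k x) => //; exact/coded_local.
  split; first exact: Rel_refl.
  move=> s sk; have ls : loc x s by case: sk.
  by have [l lE] := local_coded ls; rewrite -lE; apply: kP; rewrite lE.
apply: measurable_and.
  apply: measurable_forall => k; apply: measurable_imply; first exact: measurable_coded.
  exact: measurable_not.
apply: measurable_or.
  by apply: measurable_forall => k; apply/measurable_not/measurable_coded.
apply: measurable_exists => k; apply: measurable_and; first exact: measurable_coded.
apply: measurable_forall => l; apply: measurable_imply => //; exact: measurable_class.
Qed.

Local Notation Z := (Zspace hG hC).

Definition base (z : Z) : X := (val z).1.
Definition vertex (z : Z) : set (sep X) := (val z).2.

Lemma Zspace_ext z z' : base z = base z' -> vertex z = vertex z' -> z = z'.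
Proof.
move=> E1 E2; apply: val_inj; rewrite [val z]surjective_pairing.
by rewrite [val z']surjective_pairing; congr pair.
Qed.

Lemma ZspaceP z : Zset G C (base z, vertex z).
Proof. by have := valP z; rewrite inE -surjective_pairing. Qed.

Lemma Zspace_exists x t : Zset G C (x, t) -> exists z : Z, base z = x /\ vertex z = t.
Proof. by move=> xt; exists (exist _ (x, t) (mem_set xt)). Qed.

Lemma measurable_base : measurable_fun setT base.
Proof.
apply: measurable_funT => A mA; split.
  exists (A `*` setT); first exact: measurableX.
  by move=> z s _ _; split=> [|[]].
by exists A.
Qed.

(* The points of Z over x are those (x, [s]) with s coded and x in its
   separator, or the only point over x when x is in U. *)
Definition over (o : option sep_code) x (z : Z) := base z = x /\
  if o is Some k then code_at k x /\ vertex z = class_at G C x (cs k x)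
  else Uset G C x.

Definition section_of o x : Z := xget point (over o x).

(** For a code the vertex is prescribed. Over a point of [U] it is unique by [part_inj], since such
    a point lies in no separator. *)
Lemma over_unique o x z z' : over o x z -> over o x z' -> z = z'.
Proof.
case: o => [k|] [zx +] [zx' +]; last first.
  move=> Ux _; have [nx _] := Ux; apply: Zspace_ext; first by rewrite zx.
  have := ZspaceP z; have := ZspaceP z'; rewrite zx zx' => -[/= V1 P1] [/= V2 P2].
  have [E|/set0P ne] := eqVneq (loc x) set0.
    have V0 t : vertex_at G C x t -> t = set0.
      by case=> [[s]|[]//]; rewrite E.
    by rewrite (V0 _ V1) (V0 _ V2).
  have TV t : vertex_at G C x t -> tree_vertices (loc x) (sep_le (comp x) G) (opp_sep G) t.
    by case=> // -[E _]; move: ne; rewrite E => -[].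
  apply: (part_inj symG finG (@sysC x) (@nestedC x) (@starC x) (TV _ V2) (TV _ V1) P2 P1).
  by move=> s [Cs _]; exact: nx.
by move=> [_ t1] [_ t2]; apply: Zspace_ext; [rewrite zx zx'|rewrite t1 t2].
Qed.

Definition over_ok o x := if o is Some k then code_at k x else Uset G C x.

Lemma section_over o x : over_ok o x -> over o x (section_of o x).
Proof.
move=> ok; apply: xgetPex; case: o ok => [k kx|[nx [t xt]]]; last first.
  by have [z [zx _]] := Zspace_exists xt; exists z; split=> //; split=> //; exists t.
have [Ck xS] := kx.
have [|z [zx zt]] := @Zspace_exists x (class_at G C x (cs k x)); last by exists z.
split; first by left; exists (cs k x) => //; exact: code_at_local.
exact: (part_of_separator (@sysC x) (code_at_local kx) xS).
Qed.

Lemma over_section o x z : over o x z -> section_of o x = z.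
Proof. by move=> oz; apply: (over_unique _ oz); apply: section_over; case: o oz => [k|] [_] // []. Qed.

Lemma sectionN o x : ~ over_ok o x -> section_of o x = point.
Proof.
by move=> no; apply: xgetPN => z; case: o no => [k|] no [_]; [case|].
Qed.

Lemma measurable_over_ok o : measurable [set x | over_ok o x].
Proof. by case: o => [k|]; [exact: measurable_code_at|exact: measurable_Uset]. Qed.

(** A Borel subset of Z comes with a Borel set in Y and one in X. The former is pulled back along
    [x] to [(x, cs k x)], the latter is used directly on [U]; elsewhere the section is constantly
    [point]. *)
Lemma measurable_section o : measurable_fun setT (section_of o).
Proof.
apply: measurable_funT => A mA.
have [[B mB BP] [B' mB' BP']] : Z_measurable A := mA.
have [Q mQ QP] : exists2 Q : set X, measurable Q &
    forall x, over_ok o x -> A (section_of o x) <-> Q x.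
  case: o => [k|].
    exists [set x | B (x, cs k x)].
      exact: measurable_preimage2 (@measurable_id _ _ setT) (measurable_coded_sep k) mB.
    move=> x kx; have [bx [_ tx]] := section_over (o := Some k) kx.
    have := BP (section_of (Some k) x) (cs k x).
    by rewrite -[(val _).1]/(base _) -[(val _).2]/(vertex _) bx tx; apply.
  exists B' => // x Ux; have [bx _] := section_over (o := None) Ux.
  by have := BP' (section_of None x); rewrite -[(val _).1]/(base _) bx; exact.
apply: (measurable_ext (Q := fun x => (over_ok o x /\ Q x) \/
    (~ over_ok o x /\ A point))).
  move=> x; have [ok|no] := pselect (over_ok o x).
    by split=> [/(QP _ ok)|[[_ /(QP _ ok)]|[]]//]; left.
  by rewrite (sectionN no); split=> [|[[]|[]]//]; right.
apply: measurable_or; apply: measurable_and => //.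
- exact: measurable_over_ok.
- exact/measurable_not/measurable_over_ok.
- exact: measurable_cstP.
Qed.

Lemma section_cover z : exists2 o, over_ok o (base z) & section_of o (base z) = z.
Proof.
suff [ o oz] : exists o, over o (base z) z.
  by exists o; [case: o oz => [k|] [_] // []|exact: over_section].
have [tV tP] := ZspaceP z.
have [[s Cs xs]|nx] := pselect (exists2 s, C s & base z \in s.1); last first.
  exists None; split=> //; split; last by exists (vertex z).
  by move=> s Cs; apply/negP => xs; apply: nx; exists s.
have ls := local_of_mem Cs xs.
have tV' : tree_vertices (loc (base z)) (sep_le (comp (base z)) G) (opp_sep G) (vertex z).
  by case: tV => // -[E _]; move: ls; rewrite E.
(* The separator containing [base z] may belong to an edge away from [vertex z]; it is exchanged for
   the separator of a member of [vertex z], which can serve as code. *)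
have [s' ts' xs'] := part_separator symG finG (@sysC (base z))
  (@nestedC (base z)) (@starC (base z)) tV' tP ls xs.
have ls' := vertex_sub tV' ts'.
have [k kx ks] := code_at_exists ls'.1 xs'.
exists (Some k); split=> //; split=> //; rewrite ks.
have [s0 ls0 E0] := tV'; rewrite E0 in ts' *.
exact: (tree_class_eq (tree_set_at _) ls0 ts').
Qed.

Lemma measurable_over o : measurable [set z : Z | over o (base z) z].
Proof.
case: o => [k|]; last first.
  have := measurable_preimage measurable_base measurable_Uset; congr measurable.
  by apply/seteqP; split => z /=; [|case].
split; last first.
  exists set0 => // z [nx _]; split=> // -[_ [[Ck xs] _]].
  by have := nx _ Ck; rewrite xs.
(* In Y the condition becomes that the second coordinate belongs to the class of [cs k]; recoding
   that coordinate as [cs l] makes this Borel. *)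
exists [set p : X * ({fset X} * {fset X * X}) | exists l, p.2 = cs l p.1 /\
    (code_at k p.1 /\ class_at G C p.1 (cs k p.1) (cs l p.1))].
  apply: measurable_exists => l; apply: measurable_and.
    apply: measurable_sep_eq; first exact: measurable_snd.
    exact: measurableT_comp (measurable_coded_sep l) measurable_fst.
  apply: measurable_and.
    exact: measurable_preimage measurable_fst (measurable_code_at k).
  exact: measurable_preimage measurable_fst (measurable_class k l).
move=> z s [Cs /= xs] zs; have ls := local_of_mem Cs xs; split.
  move=> [_ [kx zk]]; have [l lx lE] := code_at_exists Cs xs.
  exists l; rewrite /= lE; split=> //; split=> //.
  have h : vertex z s by rewrite [vertex z]zs; exact: tree_class_refl.
  by move: h; rewrite zk.
move=> [l [/= lE [kx kl]]]; split=> //; split=> //; rewrite /vertex zs lE.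
by apply: esym; apply: (tree_class_eq (tree_set_at _) (code_at_local kx)).
Qed.

Lemma measurable_Zspace_eq d' (W : measurableType d') (f g : W -> Z) :
  measurable_fun setT f -> measurable_fun setT g ->
  measurable [set w | f w = g w].
Proof.
apply: (measurable_eq (D := fun i : option sep_code + nat * nat =>
  match i with inl o => [set z | over o (base z) z]
  | inr ij => [set z | c ij.1 ij.2 (base z)] end)).
  case=> [k|ij]; first exact: measurable_over.
  by apply: measurable_preimage measurable_base _; exact: (cell_measurable cS).
move=> z z' zz'; have E : base z = base z'.
  by apply: (cell_sep cS) => ij; exact: (zz' (inr ij)).
have [ o ok oz] := section_cover z.
have oz1 : over o (base z) z by rewrite -[z in over _ _ z]oz; exact: section_over.
by apply: (over_unique oz1); rewrite E; exact: ((zz' (inl o)).1 oz1).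
Qed.

Lemma over_exists x : exists y o, Rel G (x, y) /\ over_ok o y.
Proof.
have [E|/set0P[s ls]] := eqVneq (loc x) set0.
  exists x, None; split; first exact: Rel_refl.
  split=> [s Cs|].
    by apply/negP => xs; have := local_of_mem Cs xs; rewrite E.
  by exists set0; split; [right|split; [exact: Rel_refl|move=> s []]].
have [e es] := sep_edge_exists (@sysC x) ls.
have [_ eS _] := sep_edges (@sysC x) ls es.
have [k kx _] := code_at_exists ls.1 eS.
by exists e.1, (Some k); split=> //; exact: (sep_vertices (@sysC x) ls).
Qed.

End Coding.

(** * The structure graph on Z *)

Section StructureGraph.
Context d (X : measurableType d) (G : set (X * X)) (C : set (sep X)).
Hypotheses (hG : locally_finite_borel_graph G) (hC : borel_separation_system G C).
Hypotheses (nestedC : nested_in_components G C) (starC : star_in_components G C).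
Variables (c : nat -> nat -> set X) (cS : cell_system c).
Local Notation comp := (component G).
Local Notation loc := (local_system G C).
Local Notation Z := (Zspace hG hC).
Local Notation opp := (opp_sep G).

Let symG : symmetric_graph G. Proof. by case: hG. Qed.
Let finG : locally_finite G. Proof. by case: hG. Qed.
Let sysC x : separation_system (comp x) G (loc x). Proof. by case: hC. Qed.
Let TS x := tree_set_at hG hC nestedC starC x.

Variables (A : set X) (T : set (Z * Z)).
Hypotheses (AG : forall x y, Rel G (x, y) -> A x -> A y)
  (TA : T `<=` [set z | A (base z)] `*` [set z | A (base z)])
  (symT : symmetric_graph T) (acT : acyclic T).
Hypothesis levelsT : forall z z', A (base z) -> A (base z') ->
  levels hG hC (z, z') <-> Rel T (z, z').

(* One edge joining the two ends [s] and [s^-] of each edge of the structure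
   tree, placed above the least point of the separator of s. *)
Definition tree_edges : set (Z * Z) := [set zz | base zz.1 = base zz.2 /\
  exists s, [/\ C s, least_in c s.1 (base zz.1),
    vertex zz.1 = class_at G C (base zz.1) s &
    vertex zz.2 = class_at G C (base zz.1) (opp s)]].

Definition structure_graph := T `|` tree_edges.
Local Notation H := structure_graph.

Let least_local s x : C s -> least_in c s.1 x -> loc x s.
Proof. by move=> Cs [xS _]; exact: (local_of_mem hG hC Cs xS). Qed.

Let T_levels (u v : Z) : T (u, v) -> vertex u = vertex v /\ Rel G (base u, base v).
Proof. by move=> uv; have [/= Au Av] := TA uv; exact: ((levelsT Au Av).2 (Rel_edge uv)). Qed.

Lemma structure_graph_sym : symmetric_graph H.
Proof.
move=> u v [/symT|[/= uv [s [Cs sx us vs]]]]; first by left.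
right; split=> //=; have ls := least_local Cs sx.
exists (opp s); rewrite -uv; split=> //; first exact: (sep_opp (@sysC _) ls).1.
by rewrite (opp_sepK symG finG (@sysC _) ls).
Qed.

Lemma structure_graph_Rel u v : H (u, v) -> Rel G (base u, base v).
Proof. by case=> [/T_levels[]//|[/= -> _]]; exact: Rel_refl. Qed.

Let vertex_tree (z : Z) s : loc (base z) s ->
  tree_vertices (loc (base z)) (sep_le (comp (base z)) G) opp (vertex z).
Proof. by move=> ls; have [[//|[E _]] _] := ZspaceP z; move: ls; rewrite E. Qed.

Let points_mem x (t : set (sep X)) s : t s -> points (sep_le (comp x) G) t s.
Proof. by move=> ts; exists s => //; split. Qed.

Let class_mem x s : loc x s -> class_at G C x s s.
Proof. exact: tree_class_refl. Qed.

Lemma structure_graph_bridged : bridged H.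
Proof.
have brT := acyclic_bridged symT acT.
move=> u v [uvT|[/= buv [s [Cs sx us vs]]]]; last first.
  have ls := least_local Cs sx; set x0 := base u in buv sx us vs ls.
  set le := sep_le (comp x0) G.
  (* The points above this component whose vertex lies on the side of the tree that [s] points to.
     Edges of [T] stay at one vertex, and by [points_edge] only the tree edge of [s] leaves this
     set. *)
  exists [set z | Rel G (x0, base z) /\ points le (vertex z) s].
  have lo := sep_opp (@sysC _) ls.
  split.
  - by split; [exact: Rel_refl|rewrite us; exact/points_mem/class_mem].
  - move=> [_].
    have tV : tree_vertices (loc x0) le opp (vertex v) by exists (opp s).
    move/(points_excl (TS x0) tV ls); apply.
    rewrite vs; exact/points_mem/class_mem.
  - move=> a b [abT|[/= bab [s' [Cs' sx' as' bs']]]] [xa pa] Kb.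
      have [vab bab] := T_levels abT; exfalso; apply: Kb.
      by rewrite /= -vab; split=> //; exact: Rel_trans bab.
    have ls' : loc x0 s' by rewrite (local_system_eq C hG xa); exact: least_local.
    rewrite -(class_at_eq C hG _ xa) in as'; rewrite -(class_at_eq C hG _ xa) in bs'.
    have xb : Rel G (x0, base b) by rewrite -bab.
    have npb : ~ points le (vertex b) s by move=> h; apply: Kb.
    have [E|ne] := pselect (s = s'); last first.
      have [E|neo] := pselect (s = opp s'); last first.
        exfalso; apply: npb; rewrite bs'.
        by rewrite as' in pa; exact: (points_edge (TS x0) ls' ls ne neo pa).
      exfalso; have tV : tree_vertices (loc x0) le opp (vertex a) by exists s'.
      apply: (points_excl (TS x0) tV ls pa); rewrite E.
      rewrite (opp_sepK symG finG (@sysC _) ls') as'.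
      exact/points_mem/class_mem.
    have Ex : base a = x0 by apply: (least_in_unique cS sx'); rewrite -E.
    split; apply: Zspace_ext => //.
    + by rewrite as' us E.
    + by rewrite -bab Ex.
    + by rewrite bs' vs E.
have [K0 [K0u K0v K0P]] := brT _ _ uvT.
have [vuv buv] := T_levels uvT.
set x0 := base u in buv; set t := vertex u in vuv; set le := sep_le (comp x0) G.
(* The end at [t] of the tree edge for [s] lies in [K0]. The cut is [K0] at the vertex [t], and a
   vertex other than [t] falls on the side of the edge of [t] that leads to it. *)
pose side (s : sep X) := exists w : Z, [/\ vertex w = t, least_in c s.1 (base w) & K0 w].
exists [set z | Rel G (x0, base z) /\ ((vertex z = t /\ K0 z) \/
  (vertex z <> t /\ exists s, [/\ t s, points le (vertex z) (opp s) & side s]))].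
split.
- by split; [exact: Rel_refl|left].
- by move=> [_ [[]//|[]]]; rewrite vuv.
move=> a b [abT|[/= bab [s [Cs sx as_ bs]]]] [xa Ka] nKb.
  have [vab bab] := T_levels abT; have xb := Rel_trans xa bab.
  have [at_ K0a] : vertex a = t /\ K0 a.
    by case: Ka => // h; exfalso; apply: nKb; split=> //; right; rewrite -vab.
  apply: K0P => // K0b; apply: nKb; split=> //; left.
  by rewrite -vab.
exfalso; apply: nKb; rewrite /= -bab; split=> //.
have ls : loc x0 s by rewrite (local_system_eq C hG xa); exact: least_local.
have lo := sep_opp (@sysC _) ls.
rewrite -(class_at_eq C hG _ xa) in as_; rewrite -(class_at_eq C hG _ xa) in bs.
have tV : tree_vertices (loc x0) le opp t by exact: vertex_tree ls.
have aV : tree_vertices (loc x0) le opp (vertex a) by exists s.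
have bV : tree_vertices (loc x0) le opp (vertex b) by exists (opp s).
have as1 : vertex a s by rewrite as_; exact: class_mem.
have bs1 : vertex b (opp s) by rewrite bs; exact: class_mem.
have oppK := opp_sepK symG finG (@sysC _) ls.
have [bt|bt] := pselect (vertex b = t).
  left; split=> //.
  have ne : vertex a <> t.
    move=> at_; apply: (points_excl (TS x0) aV ls); first exact: points_mem.
    by rewrite at_ -bt; exact: points_mem.
  (* The tree edge ends at [t], so the edge of [t] leading to [vertex a] is [opp s] by
     [side_unique], and the witness [w] is [b] itself. *)
  case: Ka => [[]//|[_ [s' [ts' ps' [w [wt wx K0w]]]]]].
  have pa : points le (vertex a) (opp (opp s)) by rewrite oppK; exact: points_mem.
  have E : s' = opp s.
    by apply: (side_unique (TS x0) tV aV) => //; rewrite -bt.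
  suff -> : b = w by [].
  apply: Zspace_ext; last by rewrite wt.
  by apply: (least_in_unique cS (S := s.1)); [rewrite -bab|move: wx; rewrite E].
right; split=> //; case: Ka => [[at_ K0a]|[at_ [s' [ts' ps' h]]]].
  exists s; split; [by rewrite -at_|exact: points_mem|by exists a].
exists s'; split=> //.
have ls' := vertex_sub tV ts'.
rewrite bs; rewrite as_ in ps'; apply: (points_edge (TS x0) ls) ps'.
- exact: (sep_opp (@sysC _) ls').
- move=> E; apply: bt; rewrite bs.
  have E' : s' = opp s by rewrite -E (opp_sepK symG finG (@sysC _) ls').
  have [s0 l0 t0] := tV; rewrite t0 in ts' *.
  by rewrite (tree_class_eq (TS x0) l0 ts') E'.
- move=> E; apply: at_; rewrite as_.
  have E' : s' = s by rewrite -oppK -E (opp_sepK symG finG (@sysC _) ls').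
  have [s0 l0 t0] := tV; rewrite t0 in ts' *.
  by rewrite (tree_class_eq (TS x0) l0 ts') E'.
Qed.

Lemma structure_graph_connected z z' : A (base z) -> Rel G (base z, base z') ->
  Rel H (z, z').
Proof.
set x0 := base z => Ax zz'.
have level (w w' : Z) : Rel G (x0, base w) -> Rel G (x0, base w') -> vertex w = vertex w' ->
    Rel H (w, w').
  move=> xw xw' E; apply: (@Rel_sub _ T); first by move=> e; left.
  apply/levelsT; [exact: AG xw _|exact: AG xw' _|split=> //=].
  exact: Rel_trans (Rel_sym symG xw) xw'.
have xz : Rel G (x0, base z) by exact: Rel_refl.
have [E|/set0P ne] := eqVneq (loc x0) set0.
  have V0 (w : Z) : Rel G (x0, base w) -> vertex w = set0.
    move=> xw; have [[[s /= ls _]|[]//] _] := ZspaceP w.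
    by move: ls; rewrite -(local_system_eq C hG xw) E.
  by apply: level => //; rewrite !V0.
have VT (w : Z) : Rel G (x0, base w) -> exists2 s, loc x0 s & vertex w = class_at G C x0 s.
  move=> xw; rewrite (local_system_eq C hG xw); have [[[s ls sE]|[E _]] _] := ZspaceP w.
    by exists s => //; rewrite (class_at_eq C hG _ xw).
  by move: ne; rewrite (local_system_eq C hG xw) E => -[].
have [s ls zs] := VT _ xz; have [s' ls' zs'] := VT _ zz'.
(* Some point at the class of [s] is joined to some point at the class of [s1]. Transitivity holds
   because all points at one vertex are joined by the treeing of the levels. *)
pose R (s s1 : sep X) := exists w w1 : Z, [/\ Rel G (x0, base w), Rel G (x0, base w1),
  vertex w = class_at G C x0 s, vertex w1 = class_at G C x0 s1 & Rel H (w, w1)].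
suff [w [w' [xw xw' ws ws' ww']]] : R s s'.
  apply: (Rel_trans (level _ w _ _ _)) => //; first by rewrite ws.
  by apply: (Rel_trans ww'); apply: level => //; rewrite ws'.
have point_over r x : loc x0 r -> Rel G (x0, x) -> x \in r.1 ->
    exists w : Z, base w = x /\ vertex w = class_at G C x0 r.
  move=> lr xx xr; apply: Zspace_exists; split; rewrite /= /vertex_at.
    left; exists r; first by rewrite -(local_system_eq C hG xx).
    exact: (class_at_eq C hG r xx).
  rewrite -(component_eq hG xx).
  exact: (part_of_separator (@sysC x0) lr xr).
have least r : loc x0 r -> exists x, [/\ Rel G (x0, x), x \in r.1 & least_in c r.1 x].
  move=> lr; have [e er] := sep_edge_exists (@sysC x0) lr.
  have [_ eS _] := sep_edges (@sysC x0) lr er.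
  have [x rx] := least_in_exists c eS; exists x; split=> //; last by case: rx.
  by apply: (sep_vertices (@sysC x0) lr); case: rx.
apply: (tree_connected (TS x0)) ls ls'.
- move=> r lr; have [x [xx xr rx]] := least _ lr.
  have lo := sep_opp (@sysC x0) lr.
  have [w [wx wr]] := point_over _ _ lr xx xr.
  have [w' [wx' wr']] := point_over _ _ lo xx xr.
  exists w, w'; rewrite wx wx'; split=> //; apply: Rel_edge; right; split=> /=.
    by rewrite wx wx'.
  exists r; rewrite wx -(class_at_eq C hG _ xx) -(class_at_eq C hG _ xx); split=> //.
  by case: lr.
- move=> r r' lr lr' E; have [x [xx xr rx]] := least _ lr.
  have [w [wx wr]] := point_over _ _ lr xx xr.
  exists w, w; rewrite wx; split=> //; last exact: Rel_refl.
  by rewrite wr; exact: E.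
- move=> r r' [w [w' [xw xw' wr wr' ww']]]; exists w', w; split=> //.
  exact: Rel_sym structure_graph_sym ww'.
- move=> r1 r2 r3 [w1 [w2 [x1 x2 v1 v2 w12]]] [w2' [w3 [x2' x3 v2' v3 w23]]].
  exists w1, w3; split=> //; apply: (Rel_trans w12); apply: Rel_trans w23.
  by apply: level => //; rewrite v2.
Qed.

End StructureGraph.

(** * From Z to X *)

Section Treeable.
Context d (X : measurableType d) (G : set (X * X)) (C : set (sep X)).
Hypotheses (hG : locally_finite_borel_graph G) (hC : borel_separation_system G C).
Hypotheses (nestedC : nested_in_components G C) (starC : star_in_components G C).
Variables (c : nat -> nat -> set X) (phi : nat -> X -> X).
Hypotheses (cS : cell_system c) (mphi : forall n, measurable_fun setT (phi n)).
Hypotheses (phi0 : forall x, phi 0 x = x)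
  (phiP : forall x y, Rel G (x, y) <-> exists n, phi n x = y).
Local Notation Z := (Zspace hG hC).
Local Notation zbase := (@base _ X G C hG hC).

Let symG : symmetric_graph G. Proof. by case: hG. Qed.

Definition point_code (n : nat) : option sep_code * nat :=
  odflt (None, 0) (unpickle n).

(** Countably many Borel maps that exhaust, at each [x], the points of Z over the component of [x]:
    first move to a point of the component, then apply a section. *)
Definition above n x : Z :=
  section_of hG hC phi (point_code n).1 (phi (point_code n).2 x).

Definition above_ok n x := over_ok G C phi (point_code n).1 (phi (point_code n).2 x).

Lemma measurable_above n : measurable_fun setT (above n).
Proof.
apply: (@measurableT_comp _ _ _ _ _ _ (section_of hG hC phi (point_code n).1)).
  exact: measurable_section cS mphi phi0 phiP _.
exact: mphi.
Qed.

Lemma measurable_above_ok n : measurable [set x | above_ok n x].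
Proof.
apply: (measurable_preimage (mphi (point_code n).2)).
exact: (measurable_over_ok hG hC cS mphi phi0 phiP).
Qed.

Lemma above_base n x : above_ok n x -> Rel G (x, base (above n x)).
Proof.
move=> /(section_over hG hC phiP)[-> _]; apply/phiP; by exists (point_code n).2.
Qed.

Lemma above_cover x z : Rel G (x, base z) -> exists2 n, above_ok n x & above n x = z.
Proof.
move=> /phiP[i ix]; have [ o ok oz] := section_cover nestedC starC phiP z.
exists (pickle (o, i)); rewrite /above_ok /above /point_code pickleK /= ix//.
Qed.

Lemma above_exists x : exists n, above_ok n x.
Proof.
have [y [ o [/phiP[i <-] ok]]] := over_exists hG hC phiP x.
by exists (pickle (o, i)); rewrite /above_ok /point_code pickleK.
Qed.

Let m_base := @measurable_base _ X G C hG hC.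
Let m_Zeq := @measurable_Zspace_eq _ X G C hG hC nestedC starC c phi cS mphi phi0 phiP.

Lemma measurable_tree_edges : measurable (tree_edges c : set (Z * Z)).
Proof.
rewrite (_ : tree_edges c = [set zz : Z * Z | base zz.1 = base zz.2 /\
  exists kl : sep_code * sep_code, (over phi (Some kl.1) (base zz.1) zz.1 /\
    over phi (Some kl.2) (base zz.2) zz.2) /\
   (coded_sep phi kl.2 (base zz.1) = opp_sep G (coded_sep phi kl.1 (base zz.1)) /\
    least_in c (coded_sep phi kl.1 (base zz.1)).1 (base zz.1))]).
  have m1 : measurable_fun setT (zbase \o fst : Z * Z -> X).
    exact: measurableT_comp m_base measurable_fst.
  have m2 : measurable_fun setT (zbase \o snd : Z * Z -> X).
    exact: measurableT_comp m_base measurable_snd.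
  apply: measurable_and; first exact: (measurable_cell_eq cS).
  apply: measurable_exists => kl; apply: measurable_and; apply: measurable_and.
  - exact: measurable_preimage measurable_fst
      (measurable_over hG hC nestedC starC cS mphi phi0 phiP (Some kl.1)).
  - exact: measurable_preimage measurable_snd
      (measurable_over hG hC nestedC starC cS mphi phi0 phiP (Some kl.2)).
  - exact: measurable_preimage m1 (measurable_coded_opp hG cS mphi phiP kl.1 kl.2).
  - exact: measurable_preimage m1 (measurable_least cS mphi phi0 kl.1).
apply/seteqP; split => -[u v] /= [/= uv].
  move=> [s [Cs sx us vs]]; have [xS _] := sx; split=> //.
  have [k kx ks] := code_at_exists hG hC phiP Cs xS.
  have ls := local_of_mem hG hC Cs xS.
  have Co : C (opp_sep G s) by have [_ _ sysC] := hC; have [] := sep_opp (sysC _) ls.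
  have [l lx lo] := @code_at_exists _ _ _ _ hG hC _ phiP (opp_sep G s) _ Co xS.
  have ou : over phi (Some k) (base u) u by split=> //; split; rewrite ?ks.
  have ov : over phi (Some l) (base v) v by split=> //; rewrite -uv; split; rewrite ?lo.
  exists (k, l); split; first exact: conj ou ov.
  by split; [apply: etrans lo (congr1 _ (esym ks))|rewrite -[s]ks in sx].
move=> [[k l] /= [[[_ [[Ck kx] us]] [_ [_ vs]]] [lo sx]]]; split=> //.
exists (coded_sep phi k (base u)); split=> //.
by rewrite vs -uv lo.
Qed.

Variables (A : set X) (T : set (Z * Z)).
Hypotheses (mA : measurable A) (AG : forall x y, Rel G (x, y) -> A x -> A y)
  (mT : measurable T)
  (TA : T `<=` [set z | A (base z)] `*` [set z | A (base z)])
  (symT : symmetric_graph T) (acT : acyclic T).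
Hypothesis levelsT : forall z z', A (base z) -> A (base z') ->
  levels hG hC (z, z') <-> Rel T (z, z').
Local Notation H := (structure_graph c T).

Let mH : measurable H.
Proof. by apply: measurableU => //; exact: measurable_tree_edges. Qed.

Let symH : symmetric_graph H.
Proof. exact: structure_graph_sym. Qed.

Let H_Rel z z' : H (z, z') -> Rel G (base z, base z').
Proof. exact: (structure_graph_Rel TA levelsT). Qed.

Variable rho : X -> Z.
Hypotheses (mrho : measurable_fun setT rho)
  (rhoG : forall x, Rel G (x, base (rho x))).

(** Walks of length exactly [n] to the image of [rho]; the distance is the least such [n], singled
    out by [first_dist]. *)
Fixpoint rho_dist (n : nat) : set Z := if n is m.+1
  then [set z | exists k, H (z, above k (base z)) /\ rho_dist m (above k (base z))]
  else [set z | exists i, rho (phi i (base z)) = z].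

Let m_above_base k : measurable_fun setT (above k \o zbase : Z -> Z).
Proof. exact: measurableT_comp (measurable_above k) m_base. Qed.

Let m_phi_base i : measurable_fun setT (phi i \o zbase : Z -> X).
Proof. exact: measurableT_comp (mphi i) m_base. Qed.

Let m_rho_eq i : measurable [set z : Z | rho (phi i (base z)) = z].
Proof.
apply: (m_Zeq (f := rho \o (phi i \o zbase))); last exact: measurable_id.
exact: measurableT_comp mrho (m_phi_base i).
Qed.

Let m_H_above k : measurable [set z : Z | H (z, above k (base z))].
Proof. exact: measurable_preimage2 (@measurable_id _ _ setT) (m_above_base k) mH. Qed.

Let m_dist n : measurable (rho_dist n).
Proof.
elim: n => [|n IH]; first exact: measurable_exists.
apply: measurable_exists => k; apply: measurable_and; first exact: m_H_above.
exact: measurable_preimage (m_above_base k) IH.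
Qed.

Let dist_exists z : A (base z) -> exists n, rho_dist n z.
Proof.
move=> Az; have zr := rhoG (base z).
have conn := structure_graph_connected nestedC starC c AG symT levelsT Az zr.
have start : rho_dist 0 (rho (base z)).
  have [i iP] := (phiP _ _).1 (Rel_sym symG zr).
  by exists i; rewrite iP.
apply: (Rel_invariant (P := fun y => exists n, rho_dist n y) _
  (Rel_sym symH conn)); last by exists 0.
move=> y y' yy' [n yn]; exists n.+1.
have [k _ ky] := above_cover (H_Rel (symH yy')).
by exists k; rewrite ky; split=> //; exact: symH.
Qed.

Let first_dist n z := rho_dist n z /\ forall m, rho_dist m z -> (n <= m)%N.

Let first_dist_exists z : A (base z) -> exists n, first_dist n z.
Proof.
move=> /dist_exists[n nz]; have ex : exists n, `[< rho_dist n z >] by exists n; apply/asboolP.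
case: (ex_minnP ex) => m /asboolP mz mmin; exists m; split=> // l lz.
by apply: mmin; apply/asboolP.
Qed.

Let descent : exists f : Z -> Z, measurable_fun setT f /\
  forall z n, first_dist n.+1 z -> H (z, f z) /\ rho_dist n (f z).
Proof.
have [||f [mf fP _]] := @measurable_first _ _ _ _
  (fun k z => exists n, first_dist n.+1 z /\
     (H (z, above k (base z)) /\ rho_dist n (above k (base z))))
  (fun k => above k \o zbase) (fun z => z) _ _ (@measurable_id _ _ setT).
- move=> k; apply: measurable_exists => n; apply: measurable_and.
    apply: measurable_and; first exact: m_dist.
    apply: measurable_forall => m; apply: measurable_imply; first exact: m_dist.
    exact: measurable_cstP.
  apply: measurable_and; first exact: m_H_above.
  exact: measurable_preimage (m_above_base k) (m_dist n).
- exact: m_above_base.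
exists f; split=> // z n zn; have [|k [[m [zm [zk mk]]] -> _]] := fP z.
  by have [[k [zk nk]] _] := zn; exists k, n.
suff -> : n = m by [].
have [dn nmin] := zn; have [dm mmin] := zm.
by apply/eqP; rewrite -eqSS eqn_leq nmin// mmin.
Qed.

Let retraction : exists (f : Z -> Z) (r : Z -> X) (rank : Z -> nat),
  [/\ measurable_fun setT r,
    forall z, A (base z) -> Rel G (base z, r z),
    forall z, rho_dist 0 z -> rho (r z) = z &
    forall z, A (base z) -> rho (r z) = z \/
      [/\ H (z, f z), r (f z) = r z & (rank (f z) < rank z)%N]].
Proof.
have [f [mf fP]] := descent.
have [r0 [mr0 r0P _]] := measurable_first m_rho_eq m_phi_base m_base.
have miter n : measurable_fun setT (iter n f).
  elim: n => [|n IH]; first exact: measurable_id.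
  exact: measurableT_comp mf IH.
(* [r] follows [f] until it first meets the image of [rho] and then takes a preimage under [rho]
   chosen by [r0]. *)
have [||r [mr rP _]] := @measurable_first _ _ _ _
  (fun n z => rho_dist 0 (iter n f z)) (fun n => r0 \o iter n f) r0 _ _ mr0.
- by move=> n; exact: measurable_preimage (miter n) (m_dist 0).
- by move=> n; exact: measurableT_comp mr0 (miter n).
have r_base z : rho_dist 0 z -> r z = r0 z.
  move=> z0; have [|n [_ -> nmin]] := rP z; first by exists 0.
  by have := nmin 0 z0; rewrite leqn0 => /eqP ->.
have r0_base z : rho_dist 0 z -> Rel G (base z, r0 z) /\ rho (r0 z) = z.
  move=> /r0P[k [kz -> _]]; split=> //; apply/phiP; by exists k.
have [rank rankP] : exists rank : Z -> nat, forall z, A (base z) -> first_dist (rank z) z.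
  have /choice[rank rankP] z : exists n, A (base z) -> first_dist n z.
    have [/first_dist_exists[n nz]|] := pselect (A (base z)); first by exists n.
    by exists 0.
  by exists rank.
have step z n : A (base z) -> rank z = n.+1 ->
    [/\ H (z, f z), A (base (f z)) & (rank (f z) < rank z)%N].
  move=> Az zn; have := rankP _ Az; rewrite zn => /fP[zf nf].
  have Af : A (base (f z)) by exact: AG (H_Rel zf) Az.
  by split=> //; have [_] := rankP _ Af; rewrite ltnS; apply.
have hit z : A (base z) -> exists n, rho_dist 0 (iter n f z).
  have [m] := ubnP (rank z); elim: m z => // m IH z; rewrite ltnS => zm Az.
  case zn: (rank z) => [|n]; first by exists 0; have := rankP _ Az; rewrite zn => -[].
  have [_ Af fz] := step _ _ Az zn.
  have [|k kP] := IH _ _ Af; first exact: leq_trans zm.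
  by exists k.+1; rewrite iterSr.
have r_step z n : A (base z) -> rank z = n.+1 -> r (f z) = r z.
  move=> Az zn; have [zf Af _] := step _ _ Az zn.
  have [k [kz -> kmin]] := rP _ (hit _ Az); have [l [lz -> lmin]] := rP _ (hit _ Af).
  rewrite -!iterSr in lz lmin *; rewrite /= -iterSr.
  (* A point of positive rank is not in the image of [rho], so its hitting time is one more than
     that of [f z]. *)
  suff -> : k = l.+1 by [].
  apply/eqP; rewrite eqn_leq kmin//=.
  case: k kz kmin => [z0|k kz _]; last by apply: lmin; rewrite -iterSr.
  have [_ /(_ 0 z0)] := rankP _ Az; by rewrite zn.
exists f, r, rank; split=> //.
- move=> z; have [m] := ubnP (rank z); elim: m z => // m IH z; rewrite ltnS => zm Az.
  case zn: (rank z) => [|n].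
    have z0 : rho_dist 0 z by have := rankP _ Az; rewrite zn => -[].
    by rewrite r_base//; case: (r0_base _ z0).
  have [zf Af fz] := step _ _ Az zn; rewrite -(r_step _ _ Az zn).
  by apply: (Rel_trans (H_Rel zf)); apply: IH => //; exact: leq_trans zm.
- by move=> z z0; rewrite r_base//; case: (r0_base _ z0).
- move=> z Az; case zn: (rank z) => [|n].
    have z0 : rho_dist 0 z by have := rankP _ Az; rewrite zn => -[].
    by left; rewrite r_base//; case: (r0_base _ z0).
  by right; have [zf Af fz] := step _ _ Az zn; rewrite -zn; split=> //; exact: r_step zn.
Qed.

Lemma structure_graph_treeable : borel_treeable_on A (Rel G).
Proof.
have [f [r [rank [mr rG rho_r rP]]]] := retraction.
pose D := [set z : Z | A (base z)].
have HD z z' : H (z, z') -> D z -> D z' by move=> /H_Rel; exact: AG.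
have rhoD x : A x -> D (rho x) by exact: AG.
have rA z : D z -> A (r z) by move=> Dz; exact: AG (rG _ Dz) Dz.
have rho_r_rho x : A x -> rho (r (rho x)) = rho x.
  move=> Ax; apply: rho_r; have [i iP] := (phiP _ _).1 (Rel_sym symG (rhoG x)).
  by exists i; rewrite iP.
have symK : symmetric_graph (contraction A D H rho r) by exact: contraction_sym.
have Kbr : bridged (contraction A D H rho r).
  apply: (contraction_bridged symH HD rho_r_rho rP).
  exact: (structure_graph_bridged nestedC starC cS TA symT acT levelsT).
have KG x y : contraction A D H rho r (x, y) -> Rel G (x, y).
  have to_leaf u : A u -> Rel G (u, r (rho u)).
    by move=> Au; apply: Rel_trans (rhoG u) (rG _ (rhoD _ Au)).
  move=> [/= Ax Ay _ [->|->|[z [z' [Dz zz' <- <-]]]]].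
  - exact: to_leaf.
  - by apply: Rel_sym => //; exact: to_leaf.
  - apply: Rel_trans (Rel_sym symG (rG _ Dz)) _.
    exact: Rel_trans (H_Rel zz') (rG _ (HD _ _ zz' Dz)).
exists (contraction A D H rho r); split.
(* The two points of Z in the third kind of edge lie over the component of [xy.1], so they range
   over the countably many values [above m xy.1]. *)
- rewrite (_ : contraction A D H rho r = [set xy : X * X |
    (A xy.1 /\ A xy.2) /\ (xy.1 <> xy.2 /\
     ((xy.2 = r (rho xy.1) \/ xy.1 = r (rho xy.2)) \/
      exists m : nat * nat, (D (above m.1 xy.1) /\ H (above m.1 xy.1, above m.2 xy.1)) /\
        (r (above m.1 xy.1) = xy.1 /\ r (above m.2 xy.1) = xy.2)))]).
    have mfst : measurable_fun setT (fst : X * X -> X) by exact: measurable_fst.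
    have msnd : measurable_fun setT (snd : X * X -> X) by exact: measurable_snd.
    have mrr (p : X * X -> X) : measurable_fun setT p -> measurable_fun setT (r \o (rho \o p)).
      by move=> mp; apply: measurableT_comp mr (measurableT_comp mrho mp).
    have mab k : measurable_fun setT (above k \o (fst : X * X -> X)).
      exact: measurableT_comp (measurable_above k) mfst.
    have meq (p q : X * X -> X) : measurable_fun setT p -> measurable_fun setT q ->
      measurable [set w | p w = q w] by exact: (measurable_cell_eq cS).
    apply: measurable_and.
      by apply: measurable_and; [exact: measurable_preimage mfst mA|exact: measurable_preimage msnd mA].
    apply: measurable_and; first exact: measurable_not (meq _ _ mfst msnd).
    apply: measurable_or.
      by apply: measurable_or; apply: meq => //; exact: mrr.
    apply: measurable_exists => m; apply: measurable_and; apply: measurable_and.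
    + exact: measurable_preimage (measurableT_comp m_base (mab m.1)) mA.
    + exact: measurable_preimage2 (mab m.1) (mab m.2) mH.
    + by apply: meq => //; exact: measurableT_comp mr (mab m.1).
    + by apply: meq => //; exact: measurableT_comp mr (mab m.2).
  apply/seteqP; split => -[x y] /=.
    move=> [/= Ax Ay xy h]; split=> //; split=> //.
    case: h => [h|h|[z [z' [Dz zz' zx zy]]]]; [by left; left|by left; right|right].
    have xz : Rel G (x, base z) by rewrite -zx; apply: Rel_sym => //; exact: rG.
    have [m _ mz] := above_cover xz.
    have [m' _ mz'] := above_cover (Rel_trans xz (H_Rel zz')).
    by exists (m, m'); rewrite /= mz mz'.
  move=> [[Ax Ay] [xy h]]; split=> //=.
  case: h => [[h|h]|[[m m'] /= [[Dz zz'] [zx zy]]]]; [exact: Or31|exact: Or32|].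
  by apply: Or33; exists (above m x), (above m' x).
- by move=> [x y] [].
- exact: symK.
- exact: bridged_acyclic.
- move=> x y Ax Ay; split=> [xy|]; last exact: Rel_rel.
  apply: (contraction_Rel symH HD rhoD rA) => //.
  apply: (structure_graph_connected nestedC starC c AG symT levelsT); first exact: rhoD.
  exact: Rel_trans (Rel_sym symG (rhoG x)) (Rel_trans xy (rhoG y)).
Qed.

End Treeable.

(** * Invariant conull sets *)

Section Mixture.
Import Order.TTheory GRing.Theory Num.Theory.
Local Open Scope ring_scope.
Local Open Scope ereal_scope.
Context d d' (X : measurableType d) (Y : measurableType d') (R : realType).
Variables (mu : probability X R) (e : nat -> X -> Y).
Hypothesis me : forall n, measurable_fun setT (e n).

Let w (n : nat) : R := (1 / (2 ^ (n + 1))%:R)%R.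

Let w_gt0 n : (0 < w n)%R.
Proof. by rewrite divr_gt0// ltr0n expn_gt0. Qed.

Let image_measure n : {measure set Y -> \bar R} :=
  measure_function_pushforward__canonical__measure_function_Measure mu (me n).

Definition mixture : set Y -> \bar R :=
  mseries (fun n => mscale (NngNum (ltW (w_gt0 n))) (image_measure n)) 0.

HB.instance Definition _ := Measure.on mixture.

Let mixtureE A : mixture A = \sum_(0 <= n <oo) (w n)%:E * mu (e n @^-1` A).
Proof. by []. Qed.

Let mixture_setT : mixture setT = 1.
Proof.
rewrite mixtureE (eq_eseriesr (g := fun n => (w n)%:E)); last first.
  by move=> n _; rewrite preimage_setT probability_setT mule1.
apply/cvg_lim => //; have := @cvg_geometric_eseries_half R 1 0.
by rewrite expr0 divr1.
Qed.

HB.instance Definition _ := Measure_isProbability.Build _ _ _ mixture mixture_setT.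

(** The complement of [B] is null for a sum of nonnegative terms with positive weights, hence null
    for each image measure. *)
Lemma mixture_conull (B : set Y) n : measurable B -> mixture B = 1 ->
  mu (e n @^-1` B) = 1.
Proof.
move=> mB B1; have meB A : measurable A -> measurable (e n @^-1` A).
  by move=> mA; rewrite -[X in measurable X]setTI; exact: me.
have BC0 : mixture (~` B) = 0 by rewrite probability_setC// [X in _ - X]B1 subee.
have term0 : (w n)%:E * mu (e n @^-1` (~` B)) = 0.
  apply/eqP; rewrite eq_le; apply/andP; split; last first.
    by rewrite mule_ge0// lee_fin ltW.
  rewrite -BC0 mixtureE; apply: le_trans (nneseries_lim_ge n.+1 _); last first.
    by move=> k _ _; rewrite mule_ge0// lee_fin ltW.
  rewrite big_nat_recr//= leeDr// sume_ge0// => k _.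
  by rewrite mule_ge0// lee_fin ltW.
have mu0 : mu (e n @^-1` (~` B)) = 0.
  move/eqP: term0; rewrite mule_eq0 eqe => /orP[|/eqP//].
  by rewrite gt_eqF.
have := probability_setC mu (meB _ mB).
rewrite preimage_setC mu0 => h.
have fB : mu (e n @^-1` B) \is a fin_num by apply: fin_num_measure; exact: meB.
move: h; rewrite -(fineK fB) => -[h].
by congr EFin; apply/esym/eqP; rewrite -subr_eq0 -h.
Qed.

End Mixture.

(** * Passing from the levels relation to components *)

Section Reduction.
Import Order.TTheory.
Context d (X : measurableType d) (G : set (X * X)) (C : set (sep X)).
Hypotheses (hG : locally_finite_borel_graph G) (hC : borel_separation_system G C).
Hypotheses (nestedC : nested_in_components G C) (starC : star_in_components G C).
Variables (c : nat -> nat -> set X) (phi : nat -> X -> X).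
Hypotheses (cS : cell_system c) (mphi : forall n, measurable_fun setT (phi n)).
Hypotheses (phi0 : forall x, phi 0 x = x)
  (phiP : forall x y, Rel G (x, y) <-> exists n, phi n x = y).
Local Notation Z := (Zspace hG hC).

Let symG : symmetric_graph G. Proof. by case: hG. Qed.

Lemma levels_treeable (A : set X) : measurable A ->
  (forall x y, Rel G (x, y) -> A x -> A y) ->
  borel_treeable_on [set z : Z | A (base z)] (levels hG hC) ->
  borel_treeable_on A (Rel G).
Proof.
move=> mA AG [T [mT TA symT acT levelsT]].
have [rho [mrho rhoP _]] := measurable_first
  (measurable_above_ok hG hC cS mphi phi0 phiP)
  (measurable_above cS mphi phi0 phiP)
  (@measurable_cst _ _ X Z setT point).
have rhoG x : Rel G (x, base (rho x)).
  have [k [kx -> _]] := rhoP x (above_exists hG hC phiP x).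
  exact: (above_base hG hC phiP kx).
exact: (structure_graph_treeable nestedC starC cS mphi phi0 phiP mA AG mT TA symT acT
  levelsT mrho rhoG).
Qed.

(** Edges of the treeing stay over one component and [A] is a union of components, so a path
    starting over [A] remains over [A]. *)
Lemma levels_treeable_restrict (A : set X) (B : set Z) : measurable A ->
  (forall x y, Rel G (x, y) -> A x -> A y) -> (forall z : Z, A (base z) -> B z) ->
  borel_treeable_on B (levels hG hC) ->
  borel_treeable_on [set z : Z | A (base z)] (levels hG hC).
Proof.
move=> mA AG AB [T [mT TB symT acT levelsT]].
have TG u v : T (u, v) -> Rel G (base u, base v).
  move=> uv; have [/= Bu Bv] := TB _ uv.
  by have [] := (levelsT _ _ Bu Bv).2 (Rel_edge uv).
exists [set uv : Z * Z | (A (base uv.1) /\ A (base uv.2)) /\ T uv]; split.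
- have mAb : measurable [set z : Z | A (base z)].
    exact: (measurable_preimage (@measurable_base _ X G C hG hC) mA).
  apply: measurable_and => //; apply: measurable_and.
    exact: (measurable_preimage (measurable_fst (T1 := Z) (T2 := Z)) mAb).
  exact: (measurable_preimage (measurable_snd (T1 := Z) (T2 := Z)) mAb).
- by move=> [u v] [[]].
- by move=> u v [[/= Au Av] /symT].
- have [irr cyc] := acT; split; first by move=> x [_ /irr].
  move=> p cp; apply: cyc; apply: sub_cycle cp => u v.
  by move=> /adjacentP[_ uv]; apply/adjacentP.
- move=> u v Au Av; rewrite (levelsT _ _ (AB _ Au) (AB _ Av)); split; last first.
    by apply: Rel_sub => e [].
  move=> uv; suff [] : A (base v) /\
    Rel [set uv : Z * Z | (A (base uv.1) /\ A (base uv.2)) /\ T uv] (u, v) by [].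
  apply: (Rel_invariant (P := fun w : Z => A (base w) /\
    Rel [set uv : Z * Z | (A (base uv.1) /\ A (base uv.2)) /\ T uv] (u, w)) _ uv).
    move=> w w' ww' [Aw uw]; have Aw' := AG _ _ (TG _ _ ww') Aw; split=> //.
    by apply: (Rel_trans uw); apply: Rel_edge.
  by split=> //; exact: Rel_refl.
Qed.

Lemma levels_mu_treeable (R : realType) (mu : probability X R) :
  measure_treeable R (levels hG hC) -> mu_treeable mu (Rel G).
Proof.
have mabove n : measurable_fun setT (above hG hC phi n).
  exact: (measurable_above cS mphi phi0 phiP).
move=> /(_ (mixture mu mabove)) [B [mB B1 BT]].
(* All points of Z over the component of [x] lie in [B]: a Borel condition by the enumeration, and
   visibly invariant. It holds on the countable intersection of the conull preimages of [B] under
   the maps [above n]. *)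
pose A := [set x | forall n, above_ok G C phi n x -> B (above hG hC phi n x)].
have AE x : A x <-> forall z : Z, Rel G (x, base z) -> B z.
  split=> [Ax z xz|h n ok]; last by apply: h; exact: (above_base hG hC phiP ok).
  by have [n ok <-] := above_cover nestedC starC phiP xz; exact: Ax.
have mA : measurable A.
  apply: measurable_forall => n; apply: measurable_imply.
    exact: (measurable_above_ok hG hC cS mphi phi0 phiP).
  exact: measurable_preimage.
have AG x y : Rel G (x, y) -> A x -> A y.
  by move=> xy /AE Ax; apply/AE => z yz; apply: Ax; exact: Rel_trans xy yz.
exists A; split=> //; last first.
  apply: levels_treeable => //; apply: levels_treeable_restrict BT => //.
  by move=> z /AE; apply; exact: Rel_refl.
have sub : \bigcap_n (above hG hC phi n @^-1` B) `<=` A.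
  by move=> x xB n _; exact: xB.
have mpre n : measurable (above hG hC phi n @^-1` B) by exact: measurable_preimage.
have mcap : measurable (\bigcap_n (above hG hC phi n @^-1` B)).
  by apply: bigcap_measurableType => n _; exact: mpre.
suff cap1 : mu (\bigcap_n (above hG hC phi n @^-1` B)) = 1%E.
  apply/eqP; rewrite eq_le probability_le1//= -cap1.
  by apply: le_measure; rewrite ?inE.
have conull n : mu (~` (above hG hC phi n @^-1` B)) = 0%E.
  by rewrite probability_setC// (mixture_conull _ mB B1) subee.
have cap0 : mu (~` \bigcap_n (above hG hC phi n @^-1` B)) = 0%E.
  apply/negligibleP; first exact: measurableC.
  rewrite setC_bigcap; apply: negligible_bigcup => n.
  by apply/negligibleP; [exact: measurableC|exact: conull].
by rewrite -[X in mu X]setCK probability_setC ?cap0 ?sube0//; exact: measurableC.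
Qed.

End Reduction.

Theorem theorem3p3 (R : realType) (d : measure_display) (X : measurableType d)
    (G : set (X * X)) (C : set (sep X))
    (stdX : standard_borel R X)
    (hG : locally_finite_borel_graph G)
    (hC : borel_separation_system G C)
    (nestedC : nested_in_components G C)
    (starC : star_in_components G C) :
  (borel_treeable (levels hG hC) -> borel_treeable (Rel G)) /\
  (measure_treeable R (levels hG hC) -> measure_treeable R (Rel G)).
Proof.
have [c cS] := standard_borel_cells stdX.
have [mG _ finG] := hG.
have [phi [mphi phi0 phiP]] := component_enumeration cS mG finG.
split=> [treeQ|treeQ mu].
  apply: (levels_treeable nestedC starC cS mphi phi0 phiP) => //.
exact: (levels_mu_treeable nestedC starC cS mphi phi0 phiP).
Qed.
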